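(* Let $A$ be the automaton over $X=\{0,1\}$ with kneading sequence $0(011)^{\omega}$, i.e. the automaton with states $a,b,c,t,id$ described in the context. Then the group $G(A)$ has subexponential growth. Moreover, $G(A)$ is the iterated monodromy group of a complex post-critically finite quadratic polynomial.
   Context: Let $X=\{0,1\}$ and let $X^{*}$ be the free monoid on $X$, viewed as a rooted binary tree (the children of $w$ are $w0$ and $w1$). The automaton $A$ with kneading sequence $0(011)^{\omega}$ has states $a,b,c,t,id$, which act as automorphisms of $X^{*}$ fixing the empty word and given recursively by: $id$ is the identity; $t(0w)=1w$, $t(1w)=0w$; $a(0w)=0\,t(w)$, $a(1w)=1\,c(w)$; $b(0w)=0\,a(w)$, $b(1w)=1w$; $c(0w)=0w$, $c(1w)=1\,b(w)$, for all $w\in X^{*}$. $G(A)$ is the subgroup of $\mathrm{Aut}(X^{*})$ generated by $a,b,c,t$. A finitely generated group has subexponential growth if $\lim_{n\to\infty}|B(n)|^{1/n}=1$, where $B(n)$ is the ball of radius $n$ in the word metric of some (equivalently any) finite generating set. A complex polynomial $p$ is post-critically finite if, for each critical point $c$ of $p$ (i.e. $p'(c)=0$), the set of forward iterates $\{p^{n}(c): n\ge 1\}$ is finite. Let $P$ be the (finite) union of these sets. For a base point $z_0\in\mathbb{C}\setminus P$, the set $\bigsqcup_{n\ge 0}p^{-n}(z_0)$ is a rooted $\deg(p)$-ary tree ($y\in p^{-n}(z_0)$ is joined to $p(y)\in p^{-(n-1)}(z_0)$), on which $\pi_1(\mathbb{C}\setminus P,z_0)$ acts by monodromy (lifting loops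 through $p^{n}$). The iterated monodromy group $\mathrm{IMG}(p)$ is the quotient of $\pi_1(\mathbb{C}\setminus P,z_0)$ by the kernel of this action; it is a group of automorphisms of this rooted tree. A group $G\le\mathrm{Aut}(X^{*})$ ''is the iterated monodromy group of $p$'' if some isomorphism of rooted trees from $X^{*}$ to this tree of preimages conjugates $G$ to $\mathrm{IMG}(p)$. *)

(* Defs.v *)
From HB Require Import structures.
From mathcomp Require Import all_boot all_order all_algebra.
From mathcomp Require Import all_classical all_reals all_analysis.
From mathcomp Require Import finmap complex.

Set Implicit Arguments.
Unset Strict Implicit.
Unset Printing Implicit Defensive.

Import Order.TTheory GRing.Theory Num.Theory numFieldNormedType.Exports.

Local Open Scope classical_set_scope.
Local Open Scope ring_scope.

Section Growth.
Variable gT : groupType.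

Definition is_subgroup (H : set gT) : Prop :=
  H 1%g /\ forall x y, H x -> H y -> H (x / y)%g.

Definition generated_subgroup (S : seq gT) : set gT :=
  smallest is_subgroup [set` S].

Definition word_ball (S : seq gT) (n : nat) : set gT :=
  [set (\prod_(x <- s) x)%g | s in
    [set s : seq gT | (size s <= n)%N /\
                      {in s, forall x, x \in S \/ (x^-1)%g \in S}]].

(* Hence [fset_set (word_ball S n)] below is never the default value that
   [fset_set] takes on infinite sets. *)
Lemma finite_word_ball (S : seq gT) (n : nat) : finite_set (word_ball S n).
Proof.
elim: n => [|n IHn].
  apply: (@sub_finite_set _ _ [set 1%g]); last exact: finite_set1.
  by move=> _ [s [+ _] <-]; rewrite leqn0 size_eq0 => /eqP ->; rewrite big_nil.
pose T : set gT := [set` S ++ [seq x^-1%g | x <- S]].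
apply: (@sub_finite_set _ _
  ([set 1%g] `|` [set (x * y)%g | x in T & y in word_ball S n])).
  move=> _ [[|x s] [ss sS] <-]; first by left; rewrite big_nil.
  right; rewrite big_cons; exists x.
    rewrite /T /= mem_cat; have [-> //|xS] := sS x (mem_head _ _).
    by apply/orP; right; apply/mapP; exists x^-1%g; rewrite ?invgK.
  exists (\prod_(j <- s) j)%g => //; exists s => //; split=> // y ys.
  by apply: sS; rewrite inE ys orbT.
rewrite finite_setU; split; first exact: finite_set1.
by apply: finite_image2 => //; exact: finite_seq.
Qed.

Definition subexponential_growth (R : realType) (G : set gT) : Prop :=
  exists S : seq gT, generated_subgroup S = G /\
    (#|` fset_set (word_ball S n)|%:R `^ n%:R^-1 : R) @[n --> \oo] --> (1 : R).

End Growth.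

(* The edges join [v] to [tree_parent v] for every [v] other than the root;
   that every vertex eventually reaches the root makes this graph a tree. *)
Record rootedTree := RootedTree {
  tree_vertex :> Type;
  tree_root : tree_vertex;
  tree_parent : tree_vertex -> tree_vertex;
  tree_parent_root : tree_parent tree_root = tree_root;
  tree_connected : forall v, exists n, iter n tree_parent v = tree_root }.

Definition tree_iso (T U : rootedTree) (f : T -> U) : Prop :=
  [/\ bijective f,
      f (tree_root T) = tree_root U &
      forall v, f (tree_parent v) = tree_parent (f v)].

Record tree_aut (T : rootedTree) := TreeAut {
  tree_aut_fun :> T -> T;
  tree_autP : tree_iso tree_aut_fun }.

HB.instance Definition _ (T : rootedTree) := gen_eqMixin (tree_aut T).
HB.instance Definition _ (T : rootedTree) := gen_choiceMixin (tree_aut T).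

Section TreeAutGroup.
Variable T : rootedTree.
Implicit Types f g h : tree_aut T.

Lemma tree_aut_ext f g : f =1 g -> f = g.
Proof.
case: f g => [f fP] [g gP] /= /funext fg; move: fP gP; rewrite fg => fP gP.
by congr TreeAut; exact: Prop_irrelevance.
Qed.

Lemma tree_aut_id_subproof : tree_iso (@idfun T).
Proof. by split=> //; exists idfun. Qed.

Definition tree_aut_id := TreeAut tree_aut_id_subproof.

Lemma tree_aut_comp_subproof f g : tree_iso (f \o g).
Proof.
case: (tree_autP f) (tree_autP g) => [bf rf pf] [bg rg pg].
split; first exact: bij_comp.
- by rewrite /= rg rf.
- by move=> v; rewrite /= pg pf.
Qed.

Definition tree_aut_comp f g := TreeAut (tree_aut_comp_subproof f g).

Lemma tree_aut_inv_exists f : exists g, cancel f g /\ cancel g f.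
Proof.
have [[g fg gf] rf pf] := tree_autP f.
suff gP : tree_iso g by exists (TreeAut gP).
split; first by exists f.
- by rewrite -rf fg.
- by move=> v; rewrite -{1}[v]gf -pf fg.
Qed.

Definition tree_aut_inv f := sval (cid (tree_aut_inv_exists f)).

Lemma tree_autK f : cancel f (tree_aut_inv f).
Proof. exact: (svalP (cid (tree_aut_inv_exists f))).1. Qed.

Lemma tree_autVK f : cancel (tree_aut_inv f) f.
Proof. exact: (svalP (cid (tree_aut_inv_exists f))).2. Qed.

Lemma tree_aut_compA : associative tree_aut_comp.
Proof. by move=> f g h; exact: tree_aut_ext. Qed.

Lemma tree_aut_comp1f : left_id tree_aut_id tree_aut_comp.
Proof. by move=> f; exact: tree_aut_ext. Qed.

Lemma tree_aut_compf1 : right_id tree_aut_id tree_aut_comp.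
Proof. by move=> f; exact: tree_aut_ext. Qed.

Lemma tree_aut_compVf : left_inverse tree_aut_id tree_aut_inv tree_aut_comp.
Proof. by move=> f; apply: tree_aut_ext => v /=; rewrite tree_autK. Qed.

Lemma tree_aut_compfV : right_inverse tree_aut_id tree_aut_inv tree_aut_comp.
Proof. by move=> f; apply: tree_aut_ext => v /=; rewrite tree_autVK. Qed.

End TreeAutGroup.

HB.instance Definition _ (T : rootedTree) := isGroup.Build (tree_aut T)
  (@tree_aut_compA T) (@tree_aut_comp1f T) (@tree_aut_compf1 T)
  (@tree_aut_compVf T) (@tree_aut_compfV T).

Definition word_parent (w : seq bool) : seq bool := take (size w).-1 w.

Lemma word_parent_rcons w x : word_parent (rcons w x) = w.
Proof. by rewrite /word_parent size_rcons /= -cats1 take_size_cat. Qed.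

Lemma word_parent_connected w : exists n, iter n word_parent w = [::].
Proof.
elim/last_ind: w => [|w x [n IHn]]; first by exists 0%N.
by exists n.+1; rewrite iterSr word_parent_rcons.
Qed.

(* The letters 0 and 1 of the alphabet are [false] and [true]. *)
Definition binary_tree : rootedTree :=
  @RootedTree (seq bool) [::] word_parent erefl word_parent_connected.

Definition state_t (w : seq bool) : seq bool :=
  if w is x :: w' then ~~ x :: w' else [::].

Fixpoint state_a (w : seq bool) : seq bool :=
  match w with
  | [::] => [::]
  | false :: w' => false :: state_t w'
  | true :: w' => true :: state_c w'
  end
with state_b (w : seq bool) : seq bool :=
  match w with
  | [::] => [::]
  | false :: w' => false :: state_a w'
  | true :: w' => true :: w'
  end
with state_c (w : seq bool) : seq bool :=
  match w with
  | [::] => [::]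
  | false :: w' => false :: w'
  | true :: w' => true :: state_b w'
  end.

Lemma state_tK : involutive state_t.
Proof. by case=> //= x w; rewrite negbK. Qed.

Lemma state_abcK w : [/\ state_a (state_a w) = w, state_b (state_b w) = w &
  state_c (state_c w) = w].
Proof.
elim: w => [//|[] w [aK bK cK]] /=; split=> //.
- by rewrite cK.
- by rewrite bK.
- by rewrite state_tK.
- by rewrite aK.
Qed.

Lemma state_t_take n w : state_t (take n w) = take n (state_t w).
Proof. by case: w n => [|x w] []. Qed.

Lemma state_abc_take w : forall n,
  [/\ state_a (take n w) = take n (state_a w),
      state_b (take n w) = take n (state_b w) &
      state_c (take n w) = take n (state_c w)].
Proof.
elim: w => [//|[] w IHw] [|n] //=; have [aE bE cE] := IHw n; split=> //.
- by rewrite cE.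
- by rewrite bE.
- by rewrite state_t_take.
- by rewrite aE.
Qed.

Lemma size_state_t w : size (state_t w) = size w.
Proof. by case: w. Qed.

Lemma size_state_abc w : [/\ size (state_a w) = size w,
  size (state_b w) = size w & size (state_c w) = size w].
Proof.
elim: w => [//|[] w [aE bE cE]] /=; split=> //; first by rewrite cE.
- by rewrite bE.
- by rewrite size_state_t.
- by rewrite aE.
Qed.

Lemma binary_tree_iso (f : seq bool -> seq bool) :
  involutive f -> (forall w, size (f w) = size w) ->
  (forall n w, f (take n w) = take n (f w)) ->
  @tree_iso binary_tree binary_tree f.
Proof.
move=> fK fs ft; split; first by exists f.
- by apply: size0nil; rewrite fs.
- by move=> v /=; rewrite /word_parent ft fs.
Qed.

Lemma state_a_iso : @tree_iso binary_tree binary_tree state_a.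
Proof.
apply: binary_tree_iso => [w|w|n w]; first by case: (state_abcK w).
- by case: (size_state_abc w).
- by case: (state_abc_take w n).
Qed.

Lemma state_b_iso : @tree_iso binary_tree binary_tree state_b.
Proof.
apply: binary_tree_iso => [w|w|n w]; first by case: (state_abcK w).
- by case: (size_state_abc w).
- by case: (state_abc_take w n).
Qed.

Lemma state_c_iso : @tree_iso binary_tree binary_tree state_c.
Proof.
apply: binary_tree_iso => [w|w|n w]; first by case: (state_abcK w).
- by case: (size_state_abc w).
- by case: (state_abc_take w n).
Qed.

Lemma state_t_iso : @tree_iso binary_tree binary_tree state_t.
Proof.
apply: binary_tree_iso; [exact: state_tK|exact: size_state_t|].
exact: state_t_take.
Qed.

Definition automaton_group : set (tree_aut binary_tree) :=
  generated_subgroup [:: TreeAut state_a_iso; TreeAut state_b_iso;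
                         TreeAut state_c_iso; TreeAut state_t_iso].

(* The complex numbers with their usual topology; the type annotation triggers
   the topological structure that the library puts on a [numFieldType]. *)
Notation Cplx R := (R[i] : numFieldType) (only parsing).

Section FundamentalGroup.
Variables (R : realType) (D : set (Cplx R)) (z0 : Cplx R).

(* Paths and homotopies are parametrized by [0, 1] and its square; their values
   outside are irrelevant. *)
Definition is_loop (gamma : R -> Cplx R) : Prop :=
  [/\ {within `[0, 1], continuous gamma},
      {in `[0, 1], forall s, D (gamma s)},
      gamma 0 = z0 & gamma 1 = z0].

Definition loop_homotopic (gamma gamma' : R -> Cplx R) : Prop :=
  exists H : R * R -> Cplx R,
    [/\ {within `[0, 1] `*` `[0, 1], continuous H},
        {in `[0, 1] &, forall u s, D (H (u, s))},
        {in `[0, 1], forall s, H (0, s) = gamma s},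
        {in `[0, 1], forall s, H (1, s) = gamma' s} &
        {in `[0, 1], forall u, H (u, 0) = z0 /\ H (u, 1) = z0}].

Definition homotopy_class (gamma : R -> Cplx R) : set (R -> Cplx R) :=
  [set gamma' | is_loop gamma' /\ loop_homotopic gamma gamma'].

Definition fundamental_group : set (set (R -> Cplx R)) :=
  [set homotopy_class gamma | gamma in is_loop].

End FundamentalGroup.

Section IteratedMonodromy.
Variables (R : realType) (p : {poly Cplx R}).

Definition forward_orbit (c : Cplx R) : set (Cplx R) :=
  [set iter n.+1 (horner p) c | n in [set: nat]].

Definition postcritically_finite : Prop :=
  forall c, root p^`() c -> finite_set (forward_orbit c).

Definition postcritical_set : set (Cplx R) :=
  \bigcup_(c in [set c | root p^`() c]) forward_orbit c.

Variable z0 : Cplx R.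

(* The vertices are the pairs (n, y) with y in p^{-n}(z0). *)
Definition preimage_vertex : Type :=
  {v : nat * Cplx R | iter v.1 (horner p) v.2 == z0}.

Definition preimage_root : preimage_vertex :=
  exist _ (0%N, z0) (eqxx z0).

Definition preimage_parent_fun (v : nat * Cplx R) : nat * Cplx R :=
  if v.1 is n.+1 then (n, p.[v.2]) else v.

Lemma preimage_parent_subproof (v : preimage_vertex) :
  iter (preimage_parent_fun (val v)).1 (horner p)
       (preimage_parent_fun (val v)).2 == z0.
Proof. by case: v => -[[|n] y] //=; rewrite -iterSr. Qed.

Definition preimage_parent (v : preimage_vertex) : preimage_vertex :=
  exist _ (preimage_parent_fun (val v)) (preimage_parent_subproof v).

Lemma preimage_parent_root : preimage_parent preimage_root = preimage_root.
Proof. exact: val_inj. Qed.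

Lemma preimage_connected v : exists n, iter n preimage_parent v = preimage_root.
Proof.
case: v => -[n y]; elim: n y => [|n IHn] y yP.
  by exists 0%N; apply: val_inj => /=; move/eqP: (yP) => /= ->.
have yP' : iter n (horner p) p.[y] == z0 by rewrite -iterSr.
have [m mE] := IHn _ yP'; exists m.+1; rewrite iterSr -mE.
by congr iter; exact: val_inj.
Qed.

Definition preimage_tree : rootedTree :=
  RootedTree preimage_parent_root preimage_connected.

Definition lift_endpoint (n : nat) (gamma : R -> Cplx R) (y y' : Cplx R) : Prop :=
  exists delta : R -> Cplx R,
    [/\ {within `[0, 1], continuous delta},
        {in `[0, 1], forall s, iter n (horner p) (delta s) = gamma s},
        delta 0 = y & delta 1 = y'].

Definition monodromy (kappa : set (R -> Cplx R)) (g : tree_aut preimage_tree) :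
    Prop :=
  exists2 gamma, kappa gamma &
    forall v : preimage_vertex,
      lift_endpoint (val v).1 gamma (val v).2 (val (g v)).2.

(* The quotient of the fundamental group by the kernel of the monodromy action,
   realized as the image of this action in the automorphisms of the tree. *)
Definition IMG : set (tree_aut preimage_tree) :=
  [set g | exists2 kappa, fundamental_group (~` postcritical_set) z0 kappa &
                          monodromy kappa g].

End IteratedMonodromy.

Arguments IMG {R} p z0 _.

Definition is_IMG_of (R : realType) (G : set (tree_aut binary_tree))
    (p : {poly Cplx R}) : Prop :=
  forall z0 : Cplx R, ~ postcritical_set p z0 ->
    exists Phi : binary_tree -> preimage_tree p z0, tree_iso Phi /\
      IMG p z0 = [set h | exists2 g, G g & forall w, h (Phi w) = Phi (g w)].

(* Main.v *)
Require Import Defs.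
From HB Require Import structures.
From mathcomp Require Import all_boot all_order all_algebra.
From mathcomp Require Import all_classical all_reals all_analysis.
From mathcomp Require Import finmap complex.
From mathcomp Require Import zify ring lra.

Set Implicit Arguments.
Unset Strict Implicit.
Unset Printing Implicit Defensive.

Import Order.TTheory GRing.Theory Num.Theory numFieldNormedType.Exports.
Local Open Scope classical_set_scope.
Local Open Scope ring_scope.

(** Growth: give the letters a, b, c weight 1 and t weight 0.  Passing to the
    two sections does not increase the total weight.  If a word loses no
    weight down to level 4, then counting letters in the t-free gaps on
    consecutive levels shows that on level 2 all but boundedly many gaps are
    abc or bac up to the position of c, and agree with the gap two places
    before.  Hence there are polynomially many such elements of a given
    weight.  Cut a word into long windows of equal weight: either few windows
    lose weight, which leaves few elements, or the weight on level 4 drops by a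
    fixed proportion.  Both are incompatible with a growth rate above 1.

    Iterated monodromy: let c be the root of
    c^6 + 2 c^5 + 2 c^4 + 2 c^3 + c^2 + 1 near -0.156 + 1.112 i, for which the
    third iterate of c under p = z^2 + c is -c.  Four disjoint rays from the
    postcritical points to infinity cut the plane, and the word of the cuts
    crossed by a path plays the role of its homotopy class.  The preimages of
    the cuts are again these cuts up to narrow strips; correcting by the letter
    of the strip in which a point lies, the coding of preimages by the two
    half planes of p intertwines the lifting of paths with the action of words
    on {0,1}^*. *)


(** * Words, sections and weights *)

(** Two features of the automaton drive the growth argument. The generator c commutes with a and b,
    so it moves freely inside a gap, and two c in one gap cancel. And the sections of the letters of
    positive weight follow the cycle a -> c -> b -> a, so a occurs equally often on levels 0 and 3;
    between these levels the number of a cannot fall far below the number of gaps, which forces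
    almost every gap to contain each letter once. No explicit growth function comes out: as long as
    the infimum of the admissible rates exceeds 1, a smaller rate is found.

    In the monodromy part the obstacle is that a continuous path can meet a cut infinitely often.
    Crossings are therefore not listed; positions at nearby times are compared through half-open
    conditions [0 <= side], and the word is assembled along [0, 1] by connectedness. Words matter
    only through their action on binary words, and every loop is matched with the word of its own
    crossings. *)

Variant letter := LT | LA | LB | LC.

Definition letter_eq (l m : letter) : bool :=
  match l, m with
  | LT, LT | LA, LA | LB, LB | LC, LC => true
  | _, _ => false
  end.

Lemma letter_eqP : Equality.axiom letter_eq.
Proof. by case=> -[] /=; constructor. Qed.

HB.instance Definition _ := hasDecEq.Build letter letter_eqP.

Section Words.
Local Open Scope nat_scope.
Implicit Types (l : letter) (u v w : seq letter) (x : bool) (s : seq bool).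

Definition letter_act l : seq bool -> seq bool :=
  match l with
  | LT => state_t | LA => state_a | LB => state_b | LC => state_c
  end.

(* A word acts from left to right. *)
Definition wact w s : seq bool := foldl (fun s l => letter_act l s) s w.

Definition lsec x l : seq letter :=
  match l, x with
  | LA, false => [:: LT] | LA, true => [:: LC]
  | LB, false => [:: LA] | LC, true => [:: LB]
  | _, _ => [::]
  end.

Fixpoint sec x w : seq letter :=
  if w is l :: w' then lsec x l ++ sec (x (+) (l == LT)) w' else [::].

Lemma wact_cat v w s : wact (v ++ w) s = wact w (wact v s).
Proof. exact: foldl_cat. Qed.

Lemma wact_cons l w s : wact (l :: w) s = wact w (letter_act l s).
Proof. by []. Qed.

Lemma wact_nil w : wact w [::] = [::].
Proof. by elim: w => [//|[] w IHw]. Qed.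

Lemma wact_sec w x s :
  wact w (x :: s) = x (+) odd (count_mem LT w) :: wact (sec x w) s.
Proof.
elim: w x s => [|l w IHw] x s; first by rewrite /= addbF.
by case: l; case: x; rewrite wact_cons /= IHw /= ?oddD ?addbF ?addbT ?negbK.
Qed.

Lemma letter_actK l s : letter_act l (letter_act l s) = s.
Proof. by case: l (state_abcK s) => -[] //=; rewrite state_tK. Qed.

Lemma wact_rev w s : wact (rev w) (wact w s) = s.
Proof.
elim: w s => [//|l w IHw] s.
by rewrite rev_cons -cats1 wact_cat /= IHw letter_actK.
Qed.

Lemma wact_size w s : size (wact w s) = size s.
Proof.
elim: w s => [//|l w IHw] s; rewrite wact_cons IHw.
by case: l; case: (size_state_abc s) => //; rewrite size_state_t.
Qed.

Lemma wact_take w n s : wact w (take n s) = take n (wact w s).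
Proof.
elim: w s => [//|l w IHw] s; rewrite !wact_cons -IHw; congr wact.
by case: l; case: (state_abc_take s n); rewrite //= state_t_take.
Qed.

Lemma sec_cat x v w : sec x (v ++ w) =
  sec x v ++ sec (x (+) odd (count_mem LT v)) w.
Proof.
elim: v x => [|l v IHv] x /=; first by rewrite addbF.
by rewrite IHv catA oddD oddb addbA.
Qed.

(** The automorphism b acts only below 0 and c only below 1, so they commute. Below 0, c is trivial,
    and below 1 the pair a, c becomes c, b; hence a and c commute as well. *)
Lemma letter_act_comm l s : l != LT -> 
  letter_act l (letter_act LC s) = letter_act LC (letter_act l s).
Proof.
suff: [/\ state_a (state_c s) = state_c (state_a s) &
          state_b (state_c s) = state_c (state_b s)].
  by case: l => -[].
elim: s => [//|[] s [IHa IHb]] /=; split=> //.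
by rewrite IHb.
Qed.

Lemma wact_commC v s : LT \notin v ->
  wact v (letter_act LC s) = letter_act LC (wact v s).
Proof.
elim: v s => [//|l v IHv] s; rewrite inE negb_or => /andP[lT vT].
by rewrite !wact_cons letter_act_comm 1?eq_sym // IHv.
Qed.

Definition wt w := count (predC1 LT) w.

Lemma wt_cat v w : wt (v ++ w) = wt v + wt w.
Proof. exact: count_cat. Qed.

Lemma wt_sec w : wt (sec false w) + wt (sec true w) = wt w.
Proof.
suff H x : wt (sec x w) + wt (sec (~~ x) w) = wt w by rewrite (H false).
elim: w x => [//|l w IHw] x.
change (wt (lsec x l ++ sec (x (+) (l == LT)) w) +
  wt (lsec (~~ x) l ++ sec (~~ x (+) (l == LT)) w) = wt ([:: l] ++ w)).
rewrite !wt_cat -(IHw (x (+) (l == LT))) addNb.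
have -> : wt [:: l] = wt (lsec x l) + wt (lsec (~~ x) l) by case: l; case: x.
lia.
Qed.

Lemma norm_exists w :
  exists n, `[< exists2 w', wact w =1 wact w' & wt w' = n >].
Proof. by exists (wt w); apply/asboolP; exists w. Qed.

Definition norm w := ex_minn (norm_exists w).

Lemma norm_le w w' : wact w =1 wact w' -> norm w <= wt w'.
Proof.
move=> ww'; rewrite /norm; case: ex_minnP => n _; apply.
by apply/asboolP; exists w'.
Qed.

Lemma norm_wit w : exists2 w', wact w =1 wact w' & wt w' = norm w.
Proof. by rewrite /norm; case: ex_minnP => n /asboolP. Qed.

Lemma norm_eq w w' : wact w =1 wact w' -> norm w = norm w'.
Proof.
suff H u u' : wact u =1 wact u' -> norm u <= norm u'.
  by move=> ww'; apply/eqP; rewrite eqn_leq !H // => s; rewrite ww'.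
by move=> uu'; have [v u'v <-] := norm_wit u'; apply: norm_le => s; rewrite uu'.
Qed.

Lemma norm_cat v w : norm (v ++ w) <= norm v + norm w.
Proof.
have [v' vE <-] := norm_wit v; have [w' wE <-] := norm_wit w.
by rewrite -wt_cat norm_le // => s; rewrite !wact_cat vE wE.
Qed.

(** The sum of the norms of the sections on level [k]. It depends only on the group element, is
    subadditive and does not increase with [k]. *)
Fixpoint lnorm k w :=
  if k is k'.+1 then lnorm k' (sec false w) + lnorm k' (sec true w)
  else norm w.

Lemma wact_eq_sec x v w : wact v =1 wact w -> wact (sec x v) =1 wact (sec x w).
Proof. by move=> vw s; have := vw (x :: s); rewrite !wact_sec => -[]. Qed.

Lemma wact_eqP v w : odd (count_mem LT v) = odd (count_mem LT w) ->
  (forall x, wact (sec x v) =1 wact (sec x w)) -> wact v =1 wact w.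
Proof.
by move=> pE sE [|x s]; rewrite ?wact_nil // !wact_sec pE sE.
Qed.

Lemma lnorm_eq k v w : wact v =1 wact w -> lnorm k v = lnorm k w.
Proof.
elim: k v w => [|k IHk] v w vw /=; first exact: norm_eq.
by congr (_ + _); apply: IHk; apply: wact_eq_sec.
Qed.

Lemma lnorm_cat k v w : lnorm k (v ++ w) <= lnorm k v + lnorm k w.
Proof.
elim: k v w => [|k IHk] v w /=; first exact: norm_cat.
rewrite !sec_cat addFb addTb.
apply: (leq_trans (leq_add (IHk _ _) (IHk _ _))).
by case: odd => /=; lia.
Qed.

Lemma lnorm_wt k w : lnorm k w <= wt w.
Proof.
elim: k w => [|k IHk] w /=; first exact: norm_le.
by rewrite -(wt_sec w) leq_add.
Qed.

Definition geodesic w := norm w == wt w.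
(** The weights of the sections on level [k] always add up to [wt w], so this says that all of them
    are geodesic; level 0 is [geodesic] itself. *)
Definition lossless k w := lnorm k w == wt w.

Lemma lnormS k w : lnorm k.+1 w <= lnorm k w.
Proof.
elim: k w => [|k IHk] w; last by apply: leq_add; apply: IHk.
have [w' wE nE] := norm_wit w.
by rewrite (lnorm_eq _ wE) /lnorm -/lnorm -nE; exact: (lnorm_wt 1).
Qed.

Lemma losslessS k w : lossless k.+1 w -> lossless k w.
Proof.
rewrite /lossless => /eqP wE; apply/eqP.
by have := lnormS k w; have := lnorm_wt k w; lia.
Qed.

Lemma lossless_geodesic k w : lossless k w -> geodesic w.
Proof. by elim: k => [//|k IHk] /losslessS /IHk. Qed.

Lemma lossless_sec k x w : lossless k.+1 w -> lossless k (sec x w).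
Proof.
rewrite /lossless /= -wt_sec => wE.
have := lnorm_wt k (sec false w); have := lnorm_wt k (sec true w).
by case: x; lia.
Qed.

End Words.

Lemma letter_eqE (l m : letter) : (l == m) = letter_eq l m.
Proof. by []. Qed.

(** * Missing and repeated letters in the gaps *)

Section Scanning.
Local Open Scope nat_scope.
Implicit Types (l P : letter) (g u v w : seq letter) (f x : bool).

(* A gap is a maximal subword without [LT]; [nz] counts the gaps that miss the
   letter [P], and [np] counts the pairs of consecutive [P] in a common gap.
   The flag says that [P] has already been seen in the current gap. *)
Fixpoint nz P f w : nat :=
  if w is l :: w' then
    if l == LT then ~~ f + nz P false w' else nz P (f || (l == P)) w'
  else ~~ f.

Fixpoint np P f w : nat :=
  if w is l :: w' then
    if l == LT then np P false w' else (f && (l == P)) + np P (f || (l == P)) w'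
  else 0.

Fixpoint seen P f w : bool :=
  if w is l :: w' then
    seen P (if l == LT then false else f || (l == P)) w'
  else f.

Lemma nz_cat P f u v :
  nz P f (u ++ v) + ~~ seen P f u = nz P f u + nz P (seen P f u) v.
Proof.
elim: u f => [|l u IHu] f /=; first by rewrite addnC.
by case: (l == LT); rewrite ?IHu // -addnA IHu addnA.
Qed.

Lemma np_cat P f u v : np P f (u ++ v) = np P f u + np P (seen P f u) v.
Proof.
elim: u f => [//|l u IHu] f /=.
by case: (l == LT); rewrite IHu // addnA.
Qed.

Lemma seen_nz P f w : ~~ seen P f w <= nz P f w.
Proof.
elim: w f => [//|l w IHw] f /=; case: (l == LT) => //.
by apply: (leq_trans (IHw _)); exact: leq_addl.
Qed.

Definition occ P w : nat := count_mem P w.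
#[global] Arguments occ : simpl never.

Lemma occ_cons P l w : occ P (l :: w) = (l == P) + occ P w.
Proof. by []. Qed.

(** A gap with m > 0 letters [P] has m - 1 consecutive pairs, and a gap without [P] enters [nz]; sum
    over the [occ LT w + 1] gaps. The flag counts as one more [P] in front. *)
Lemma count_nz_np P f w : P != LT ->
  occ P w + nz P f w + f = occ LT w + 1 + np P f w.
Proof.
move=> PT; elim: w f => [|l w IHw] f; first by case: f.
rewrite !occ_cons /=; case: (eqVneq l LT) => [->|lT].
  by have := IHw false; rewrite eq_sym (negbTE PT); case: f => /=; lia.
have := IHw (f || (l == P)).
by case: f; case: (l == P) => /=; lia.
Qed.

Lemma np_split P f w : P != LT -> 0 < np P f w ->
  (exists u v z, w = u ++ P :: v ++ P :: z /\ LT \notin v) \/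
  (f /\ exists v z, w = v ++ P :: z /\ LT \notin v).
Proof.
move=> PT; elim: w f => [//|l w IHw] f /=.
case: (eqVneq l LT) => [->|lT].
  by case/IHw => [[u [v [z [-> vT]]]]|[]//]; left; exists (LT :: u), v, z.
case: (boolP (f && (l == P))) => [/andP[-> /eqP->] _|].
  by right; split=> //; exists [::], w.
move=> fl /= /IHw [[u [v [z [-> vT]]]]|[/orP[f1|/eqP->] [v [z [-> vT]]]]].
- by left; exists (l :: u), v, z.
- right; split=> //; exists (l :: v), z; split=> //.
  by rewrite inE negb_or eq_sym lT.
- by left; exists [::], v, z.
Qed.

(** The letters between two c of one gap commute with c, and c is an involution. Both can be erased,
    which lowers the weight by 2. *)
Lemma geodesic_npC w : geodesic w -> np LC false w = 0.
Proof.
move=> geo; apply/eqP; rewrite -leqn0 leqNgt; apply/negP.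
move=> /np_split -/(_ isT) [|[]//] [u [v [z [wE vT]]]].
have /norm_le : wact w =1 wact (u ++ v ++ z).
  move=> s; rewrite wE !(wact_cat, wact_cons) -wact_commC //.
  by rewrite [letter_act LC (letter_act _ _)]letter_actK.
have wtC y : wt (LC :: y) = (wt y).+1 by [].
by rewrite (eqP geo) wE !(wt_cat, wtC) leq_add2l addnS ltnNge leqnSn.
Qed.

(** Two a of one gap become two c in the section that reads this gap at 1, with no t between them,
    since only an a read at 0 yields t. Reading t swaps the two sections, hence the two flags. *)
Lemma npA_sec f f0 f1 w : f ==> f1 ->
  np LA f w <= np LC f1 (sec true w) + np LC f0 (sec false w).
Proof.
elim: w f f0 f1 => [//|l w IHw] f f0 f1 ff1; case: l; rewrite /= !letter_eqE /=.
- by rewrite addnC; exact: IHw.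
- rewrite orbT !andbT orbT.
  apply: leq_trans (_ : f1 + (np LC true (sec true w) + np LC false (sec false w)) <= _).
    by apply: leq_add; [case: f ff1 => //= ->|exact: IHw].
  by rewrite addnA.
- rewrite andbF orbF; apply: (leq_trans (IHw f (f0 || false) f1 ff1)).
  by rewrite andbF orbF.
- rewrite andbF orbF; apply: (leq_trans (IHw f f0 (f1 || false) _)).
    by rewrite orbF.
  by rewrite andbF orbF.
Qed.

Lemma lossless1_npA w : lossless 1 w -> np LA false w = 0.
Proof.
move=> w1; apply/eqP; rewrite -leqn0.
have g x : np LC false (sec x w) = 0.
  by apply: geodesic_npC; exact: (lossless_sec x w1).
by apply: leq_trans (npA_sec (f1 := false) false w _) _; rewrite // !g.
Qed.

(** A b of a section comes from a c read at 1. Two b in one gap of the section come either from one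
    gap of [w], counted by [np LC], or from gaps separated by one read at 0; the latter yields no t,
    so it lacks a and [nz LA] counts it. The last term pays for a pair left open by [f1]. An a read
    at 0 resets [f0], whence the condition on [fa]. *)
Lemma npB_sec f0 f1 fa fc w : ~~ (fa && f0) ->
  np LB f1 (sec true w) + np LB f0 (sec false w) <=
  nz LA fa w + np LC fc w + (f1 && ~~ fc).
Proof.
elim: w f0 f1 fa fc => [//|l w IHw] f0 f1 fa fc H; case: l; rewrite /= !letter_eqE /=.
- have := IHw f1 f0 false false isT.
  case: f0 f1 fa fc H => [] [] [] [] //= _ IH; lia.
- rewrite !(andbF, orbF, orbT).
  exact: IHw.
- rewrite !(andbF, orbF, orbT).
  exact: IHw.
- rewrite !(andbF, orbF, orbT, andbT).
  have := IHw f0 true fa true H.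
  by case: f1 fc => -[]/=; lia.
Qed.

Lemma count_sec w :
  [/\ occ LT (sec false w) + occ LT (sec true w) = occ LA w,
      occ LA (sec false w) + occ LA (sec true w) = occ LB w,
      occ LB (sec false w) + occ LB (sec true w) = occ LC w &
      occ LC (sec false w) + occ LC (sec true w) = occ LA w].
Proof.
suff H x : [/\
   occ LT (sec x w) + occ LT (sec (~~ x) w) = occ LA w,
   occ LA (sec x w) + occ LA (sec (~~ x) w) = occ LB w,
   occ LB (sec x w) + occ LB (sec (~~ x) w) = occ LC w &
   occ LC (sec x w) + occ LC (sec (~~ x) w) = occ LA w].
  exact: (H false).
elim: w x => [//|l w IHw] x; have [] := IHw (x (+) (l == LT)).
by case: l; case: x; rewrite /= !occ_cons !letter_eqE /= => *; split; lia.
Qed.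

Fixpoint total (F : seq letter -> nat) k w : nat :=
  if k is k'.+1 then total F k' (sec false w) + total F k' (sec true w)
  else F w.

Lemma totalSr F k w :
  total F k.+1 w = total (fun v => F (sec false v) + F (sec true v)) k w.
Proof. by elim: k w => [//|k IHk] w /=; rewrite -!IHk. Qed.

Lemma totalD F G k w : total (fun v => F v + G v) k w = total F k w + total G k w.
Proof. by elim: k w => [//|k IHk] w /=; rewrite !IHk addnACA. Qed.

Lemma total_cst c k w : total (fun _ => c) k w = c * 2 ^ k.
Proof.
elim: k w => [|k IHk] w /=; first by rewrite muln1.
by rewrite !IHk expnS mulnCA mul2n addnn.
Qed.

Lemma le_total F G k m w : lossless (k + m) w ->
  (forall v, lossless m v -> F v <= G v) -> total F k w <= total G k w.
Proof.
move=> wl FG; elim: k w wl => [|k IHk] w wl /=; first exact: FG.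
by apply: leq_add; apply: IHk; exact: lossless_sec.
Qed.

Lemma le_total0 F G k w : (forall v, F v <= G v) -> total F k w <= total G k w.
Proof.
by move=> FG; elim: k w => [|k IHk] w //=; rewrite leq_add.
Qed.

Lemma eq_total F G k m w : lossless (k + m) w ->
  (forall v, lossless m v -> F v = G v) -> total F k w = total G k w.
Proof.
move=> wl FG; apply/eqP.
by rewrite eqn_leq !(le_total wl) // => v /FG ->.
Qed.

Lemma total_nz P k w : P != LT ->
  total (occ P) k w + total (nz P false) k w =
  total (occ LT) k w + 2 ^ k + total (np P false) k w.
Proof.
move=> PT; elim: k w => [|k IHk] w /=; first by have := count_nz_np false w PT; rewrite addn0 => ->.
by have := IHk (sec false w); have := IHk (sec true w); rewrite expnS mul2n -addnn; lia.
Qed.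

Lemma total_sec k w :
  [/\ total (occ LT) k.+1 w = total (occ LA) k w,
      total (occ LA) k.+1 w = total (occ LB) k w,
      total (occ LB) k.+1 w = total (occ LC) k w &
      total (occ LC) k.+1 w = total (occ LA) k w].
Proof.
elim: k w => [|k IHk] w /=; first exact: count_sec.
by have [/= -> -> -> ->] := IHk (sec false w);
  have [/= -> -> -> ->] := IHk (sec true w).
Qed.

(** Let A_k be the number of a on level k. No gap on levels up to 3 holds two a, and the t of level
    k come from the a of level k - 1, so the gaps without a on level k number A_(k-1) + 2^k - A_k.
    Going back three levels an a comes from b, c and a in turn, so A_3 = A_0, and these numbers add
    up to 2 + 4 + 8 = 14 over k = 1, 2, 3. The other bounds follow from [npB_sec] and the same count
    for b and c. *)
Lemma lossless_total w : lossless 4 w ->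
  [/\ total (nz LA false) 2 w + total (nz LB false) 2 w +
      total (nz LC false) 2 w + total (np LA false) 2 w +
      total (np LB false) 2 w + total (np LC false) 2 w <= 52,
      total (nz LA false) 3 w + total (np LA false) 3 w <= 14,
      total (np LA false) 2 w + total (np LB false) 2 w +
      total (np LC false) 2 w <= 14 &
      total (occ LT) 2 w <= wt w].
Proof.
move=> w4.
(* The sections on level 3 still have one lossless level below them; this is what level 4 is for. *)
have npA k : k < 4 -> total (np LA false) k w = 0.
  move=> k4; rewrite (eq_total (G := fun _ => 0) (m := 1)) ?total_cst //.
    by rewrite /lossless addn1; case: k k4 => [|[|[|[]]]] // _;
      do 3?[exact: w4|apply: losslessS].
  exact: lossless1_npA.
have npC k : k < 4 -> total (np LC false) k w = 0.
  move=> k4; rewrite (eq_total (G := fun _ => 0) (m := 1)) ?total_cst //.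
    by rewrite /lossless addn1; case: k k4 => [|[|[|[]]]] // _;
      do 3?[exact: w4|apply: losslessS].
  by move=> v /lossless_geodesic; exact: geodesic_npC.
have npB : total (np LB false) 2 w <= total (nz LA false) 1 w + total (np LC false) 1 w.
  rewrite totalSr -totalD; apply: le_total0 => v.
  by have := @npB_sec false false false false v isT; lia.
have nzA k := @total_nz LA k w isT; have nzB k := @total_nz LB k w isT.
have nzC k := @total_nz LC k w isT.
have [T1 A1 B1 C1] := total_sec 0 w; have [T2 A2 B2 C2] := total_sec 1 w.
have [T3 A3 B3 C3] := total_sec 2 w.
have ow : total (occ LB) 0 w <= wt w by apply: sub_count => l /eqP->.
have e0 : 2 ^ 0 = 1 by []. have e1 : 2 ^ 1 = 2 by [].
have e2 : 2 ^ 2 = 4 by []. have e3 : 2 ^ 3 = 8 by [].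
move: (nzA 0) (nzA 1) (nzA 2) (nzA 3) (nzB 2) (nzC 0) (nzC 1) (nzC 2) (nzC 3).
rewrite !npA // !npC //; move: npB; rewrite !npC // ?(e0, e1, e2, e3).
move=> npB E1 E2 E3 E4 E5 E6 E7 E8 E9; 
clear -T1 A1 B1 C1 T2 A2 B2 C2 T3 A3 B3 C3 ow npB E1 E2 E3 E4 E5 E6 E7 E8 E9.
split; lia.
Qed.

End Scanning.

(** * Almost periodicity of the sequence of gaps *)

Section Gaps.
Local Open Scope nat_scope.
Implicit Types (l P : letter) (g u v w : seq letter) (gs : seq (seq letter)).
Implicit Types (f x : bool).

Fixpoint gaps w : seq (seq letter) :=
  if w is l :: w' then
    if l == LT then [::] :: gaps w'
    else (l :: head [::] (gaps w')) :: behead (gaps w')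
  else [:: [::]].

Definition ungap gs : seq letter := flatten [seq rcons g LT | g <- gs].

Lemma gaps_neq0 w : gaps w = head [::] (gaps w) :: behead (gaps w).
Proof. by case: w => [|l w] //=; case: ifP. Qed.

Lemma ungap_cons g gs : ungap (g :: gs) = rcons g LT ++ ungap gs.
Proof. by []. Qed.

Lemma ungapK w : ungap (gaps w) = rcons w LT.
Proof.
elim: w => [//|l w IHw] /=; case: eqP => [->|_].
  by rewrite /ungap /= -/(ungap _) IHw.
by rewrite -IHw [in RHS]gaps_neq0.
Qed.

Lemma gaps_noT w : all (fun g => LT \notin g) (gaps w).
Proof.
elim: w => [//|l w IHw] /=; case: eqP => [_ //|/eqP lT].
move: IHw; rewrite {1}gaps_neq0 /= inE negb_or (eq_sym LT) lT.
by case/andP => -> ->.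
Qed.

Lemma size_gaps w : size (gaps w) = (occ LT w).+1.
Proof.
elim: w => [//|l w IHw]; rewrite occ_cons /=; case: eqP => [_|_] /=.
  by rewrite IHw.
by rewrite size_behead IHw.
Qed.

Definition perfect g : bool :=
  g \in [:: [:: LA; LB; LC]; [:: LA; LC; LB]; [:: LC; LA; LB];
            [:: LB; LA; LC]; [:: LB; LC; LA]; [:: LC; LB; LA]].

Definition A_before_B g : bool := index LA g < index LB g.

(** Since c commutes with a and b, the six perfect gaps represent only the elements abc and bac. *)
Definition nf g : seq letter :=
  if perfect g then
    if A_before_B g then [:: LA; LB; LC] else [:: LB; LA; LC]
  else g.

Lemma wact_nf g : wact (nf g) =1 wact g.
Proof.
rewrite /nf; case: ifP => // + s; rewrite /perfect !inE.
have AC r : state_a (state_c r) = state_c (state_a r).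
  exact: (@letter_act_comm LA r isT).
have BC r : state_b (state_c r) = state_c (state_b r).
  exact: (@letter_act_comm LB r isT).
by do !case/orP; move=> /eqP->; rewrite /A_before_B /= ?letter_eqE /= ?AC ?BC ?AC.
Qed.

Definition nimp gs := count (fun g => ~~ perfect g) gs.

Lemma nimp_cons g gs : nimp (g :: gs) = ~~ perfect g + nimp gs.
Proof. by []. Qed.

Lemma perfect_occ g : LT \notin g ->
  occ LA g = 1 -> occ LB g = 1 -> occ LC g = 1 -> perfect g.
Proof.
move=> gT; have : size g = occ LT g + occ LA g + occ LB g + occ LC g.
  elim: g {gT} => [//|l g IHg] /=; rewrite !occ_cons IHg !letter_eqE.
  by case: l => /=; lia.
have -> : occ LT g = 0 by apply/count_memPn.
move=> + A1 B1 C1; rewrite A1 B1 C1.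
case: g gT A1 B1 C1 => [|l1 [|l2 [|l3 [|]]]] //.
by case: l1; case: l2; case: l3.
Qed.

(** An imperfect gap lacks or repeats a letter, so it contributes to some [nz] or [np]. The three
    extra units belong to the empty gap after the last t of [ungap gs], which lacks all three
    letters. *)
Lemma imperfect_le gs : all (fun g => LT \notin g) gs ->
  (nimp gs).+3 <=
  nz LA false (ungap gs) + nz LB false (ungap gs) + nz LC false (ungap gs) +
  np LA false (ungap gs) + np LB false (ungap gs) + np LC false (ungap gs).
Proof.
have scan P f g r : LT \notin g -> P != LT -> 
    nz P f (rcons g LT ++ r) + np P f (rcons g LT ++ r) =
    nz P f g + np P f g + nz P false r + np P false r.
  move=> gT PT; elim: g f gT => [|l g IHg] f /=; first by move=> _; lia.
  rewrite inE negb_or eq_sym => /andP[/negbTE-> gT].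
  by have := IHg (f || (l == P)) gT; lia.
elim: gs => [//|g gs IHgs] /andP[gT gsT]; have := IHgs gsT.
rewrite nimp_cons ungap_cons.
have := scan LA false g (ungap gs) gT isT.
have := scan LB false g (ungap gs) gT isT.
have := scan LC false g (ungap gs) gT isT.
have gT0 : occ LT g = 0 by apply/count_memPn.
have := @count_nz_np LA false g isT; have := @count_nz_np LB false g isT.
have := @count_nz_np LC false g isT.
have := perfect_occ gT; rewrite gT0 !addn0.
case: (perfect g) => [_|H] /=; first by lia.
have H' : ~ [/\ occ LA g = 1, occ LB g = 1 & occ LC g = 1] by case=> a b c; have := H a b c.
have {H'} : (occ LA g != 1) || (occ LB g != 1) || (occ LC g != 1).
  apply: contra_notT H'; rewrite !negb_or !negbK.
  by move=> /andP[/andP[/eqP ? /eqP ?] /eqP ?].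
by lia.
Qed.

(** Distance 2 is the natural one: reading t swaps the sections, so a given section reads every
    other gap at 0. *)
Fixpoint breaks gs : nat :=
  if gs is g1 :: gs' then
    (if gs' is _ :: g3 :: _ then (nf g1 != nf g3 : nat) else 0) + breaks gs'
  else 0.

Lemma seen_perfect g f : perfect g ->
  [/\ seen LA f (sec false g) = A_before_B g,
      seen LA f (sec true g) = f &
      (f != A_before_B g) + ~~ A_before_B g <=
      nz LA f (sec false g) + np LA f (sec false g)].
Proof.
rewrite /perfect !inE.
by do !case/orP; move=> /eqP->; case: f.
Qed.

(** [h0] and [h1] are the two gaps before [gs], and the flags are the traces of their orders in the
    sections. An imperfect gap is charged once as the new gap, once as [h1] and once as [h0]; this
    makes the factor 3. *)
Lemma breaks_le h0 h1 gs f0 f1 : all (fun g => LT \notin g) gs ->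
  (perfect h0 -> perfect h1 -> f0 = A_before_B h0) ->
  (perfect h1 -> f1 = A_before_B h1) ->
  breaks [:: h0, h1 & gs] <=
  ~~ perfect h0 + 2 * ~~ perfect h1 + 3 * nimp gs +
  nz LA f0 (sec false (ungap gs)) + np LA f0 (sec false (ungap gs)) +
  nz LA f1 (sec true (ungap gs)) + np LA f1 (sec true (ungap gs)).
Proof.
elim: gs h0 h1 f0 f1 => [|g gs IHgs] h0 h1 f0 f1 // /andP[gT gsT] H0 H1.
pose f0' := seen LA f1 (sec true g); pose f1' := seen LA f0 (sec false g).
have := IHgs h1 g f0' f1' gsT; rewrite /f0' /f1'.
have secE x : sec x (ungap (g :: gs)) = sec x g ++ sec (~~ x) (ungap gs).
  rewrite ungap_cons cat_rcons sec_cat; congr (_ ++ _).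
  have -> : count_mem LT g = 0 by apply/count_memPn.
  by rewrite /= addbF addbT; case: x.
rewrite !secE nimp_cons /=.
have := nz_cat LA f0 (sec false g) (sec true (ungap gs)).
have := nz_cat LA f1 (sec true g) (sec false (ungap gs)).
rewrite (np_cat LA f0 (sec false g) (sec true (ungap gs))).
rewrite (np_cat LA f1 (sec true g) (sec false (ungap gs))).
have := seen_nz LA f0 (sec false g); have := seen_nz LA f1 (sec true g).
case: (boolP (perfect g)) => [gP|_] /=.
  have [-> _] := @seen_perfect g f0 gP.
  have [_ -> _] := @seen_perfect g f1 gP.
  have : (nf h0 != nf g) <= ~~ perfect h0 + ~~ perfect h1 + (f0 != A_before_B g).
    case: (boolP (perfect h0)) H0 => [P0 H0|_ _]; last by case: eqP.
    case: (boolP (perfect h1)) H0 => [P1 H0|_ _]; last by case: eqP.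
    by rewrite /nf P0 gP H0 //; do 2 case: A_before_B.
  move=> h1E h2 h3 h4 h5 h6 /(_ (fun q _ => H1 q) (fun _ => erefl)).
  move: h1E h2 h3 h4 h5 h6.
  set N := nat_of_bool (nf _ != nf _); set p0 := nat_of_bool (~~ perfect h0).
  set p1 := nat_of_bool (~~ perfect h1); set e := nat_of_bool (f0 != _).
  set s0 := nat_of_bool (~~ A_before_B g); set s1 := nat_of_bool (~~ f1).
  by move: N p0 p1 e s0 s1; clear; lia.
have : (nf h0 != nf g) <= 1 by case: eqP.
move=> h1E h2 h3 h4 h5 /(_ (fun _ (F : false) => ltac:(by [])) (fun (F : false) => ltac:(by []))).
move: h1E h2 h3 h4 h5; set N := nat_of_bool (nf _ != nf _).
set p0 := nat_of_bool (~~ perfect h0); set p1 := nat_of_bool (~~ perfect h1).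
set s0 := nat_of_bool (~~ seen _ _ _); set s1 := nat_of_bool (~~ seen _ _ _).
by move: N p0 p1 s0 s1; clear; lia.
Qed.

Lemma breaks_total w : lossless 4 w ->
  total (fun v => breaks (gaps v)) 2 w <= 500.
Proof.
move=> /lossless_total[H1 H2 _ _].
have bnd v : breaks (gaps v) <= 12 +
    3 * (nz LA false v + nz LB false v + nz LC false v + np LA false v +
         np LB false v + np LC false v) +
    (nz LA false (sec false v) + np LA false (sec false v) +
     nz LA false (sec true v) + np LA false (sec true v)).
  (* The two empty gaps put in front are imperfect, so the conditions on the flags are void; they
     cost 1 + 2. *)
  have := @breaks_le [::] [::] (gaps v) false false (gaps_noT v).
  move=> /(_ (fun F : false => ltac:(by [])) (fun F : false => ltac:(by []))).
  have := imperfect_le (gaps_noT v); rewrite ungapK.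
  have secE x : sec x (rcons v LT) = sec x v.
    by rewrite -cats1 sec_cat /= !cats0.
  have nzE P : nz P false (rcons v LT) <= (nz P false v).+1.
    have := nz_cat P false v [:: LT]; have := seen_nz P false v.
    by rewrite cats1 /=; case: (seen P false v) => /=; lia.
  have npE P : np P false (rcons v LT) = np P false v.
    by have := np_cat P false v [:: LT]; rewrite cats1 addn0.
  rewrite !secE !npE; have := nzE LA; have := nzE LB; have := nzE LC.
  have : breaks (gaps v) <= breaks [:: [::], [::] & gaps v].
    by apply: leq_trans (leq_addl _ _); exact: leq_addl.
  by rewrite /=; clear; lia.
(* Over the four sections this amounts to at most 4 * 12 + 3 * 52 + 14. *)
apply: (leq_trans (le_total0 2 w bnd)); move: H1 H2.
by rewrite /= /nz /np; clear; lia.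
Qed.

End Gaps.

(** * Counting group elements through words *)

Section Covers.
Local Open Scope nat_scope.
Implicit Types (g u v w : seq letter) (P Q : seq letter -> Prop).

(* The elements represented by the words in [P] number at most [m]. *)
Definition covered P m : Prop :=
  exists2 s : seq (seq letter), size s <= m &
    forall w, P w -> exists2 v, v \in s & wact w =1 wact v.

(** A key determines the element, so one word per key is enough. For keys that no word has, [pick]
    falls back to the empty word. *)
Lemma covered_key (K : eqType) (ks : seq K) (r : K -> seq letter -> Prop) P m :
  size ks <= m -> (forall w, P w -> exists2 k, k \in ks & r k w) ->
  (forall k w w', r k w -> r k w' -> wact w =1 wact w') -> covered P m.
Proof.
move=> ksm Pr rE.
pose pick k := if pselect (exists w, r k w) is left h then sval (cid h) else [::].
exists [seq pick k | k <- ks]; rewrite ?size_map // => w /Pr[k kks rkw].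
exists (pick k); first exact: map_f.
rewrite /pick; case: pselect => [h|[]]; last by exists w.
exact: rE rkw (svalP (cid h)).
Qed.

Lemma covered_sub P Q m n : (forall w, P w -> Q w) -> m <= n ->
  covered Q m -> covered P n.
Proof.
by move=> PQ mn [s sm H]; exists s => [|w /PQ/H//]; exact: leq_trans mn.
Qed.

(** The factor 2 is the action on the first letter, given by the parity of the number of t. *)
Lemma covered_sec P P0 P1 m0 m1 :
  (forall w, P w -> P0 (sec false w) /\ P1 (sec true w)) ->
  covered P0 m0 -> covered P1 m1 -> covered P (2 * (m0 * m1)).
Proof.
move=> PP [s0 s0m H0] [s1 s1m H1].
pose r (k : bool * (seq letter * seq letter)) w :=
  [/\ odd (count_mem LT w) = k.1, wact (sec false w) =1 wact k.2.1 &
      wact (sec true w) =1 wact k.2.2].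
pose ks := [seq (b, vw) | b <- [:: false; true],
  vw <- [seq (v, w) | v <- s0, w <- s1]].
apply: (@covered_key _ ks r).
- by rewrite !size_allpairs /= leq_mul // leq_mul.
- move=> w /PP[/H0[v0 v0s E0] /H1[v1 v1s E1]].
  exists (odd (count_mem LT w), (v0, v1)); last by split.
  apply: allpairs_f; first by case: odd; rewrite !inE.
  exact: allpairs_f.
- move=> k w w' [p1 a1 b1] [p2 a2 b2]; apply: wact_eqP; first by rewrite p1 p2.
  by case=> s; rewrite ?(a1, a2, b1, b2).
Qed.

Lemma covered_cat P P0 P1 m0 m1 :
  (forall w, P w -> exists u v, [/\ w = u ++ v, P0 u & P1 v]) ->
  covered P0 m0 -> covered P1 m1 -> covered P (m0 * m1).
Proof.
move=> PP [s0 s0m H0] [s1 s1m H1].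
exists [seq u ++ v | u <- s0, v <- s1]; first by rewrite size_allpairs leq_mul.
move=> _ /PP[u [v [-> /H0[u' us uE] /H1[v' vs vE]]]].
exists (u' ++ v'); first exact: allpairs_f.
by move=> s; rewrite !wact_cat uE vE.
Qed.

Lemma covered_bigcup P (Q : nat -> seq letter -> Prop) (m : nat -> nat) n :
  (forall w, P w -> exists2 i, i < n & Q i w) ->
  (forall i, i < n -> covered (Q i) (m i)) -> covered P (\sum_(i < n) m i).
Proof.
elim: n P => [|n IHn] P PQ Qc.
  by exists [::] => [|w Pw]; rewrite ?big_ord0 //; have [] := PQ w Pw.
have [s sn H] := IHn (fun w => exists2 i, i < n & Q i w) (fun _ h => h)
  (fun i (h : i < n) => Qc i (ltnW h)).
have [s' sn' H'] := Qc n (ltnSn n).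
exists (s ++ s'); first by rewrite size_cat big_ord_recr leq_add.
move=> w Pw; have [i + Qw] := PQ w Pw.
rewrite ltnS leq_eqVlt => /orP[/eqP iE|iltn].
  rewrite iE in Qw; by have [v vs E] := H' w Qw; exists v; rewrite // mem_cat vs orbT.
have [v vs E] := H w (ex_intro2 _ _ i iltn Qw).
by exists v; rewrite // mem_cat vs.
Qed.

End Covers.

Lemma sumn_le (s : seq nat) (c : nat) :
  all (fun x => x <= c)%N s -> (sumn s <= size s * c)%N.
Proof.
elim: s => [//|x s IHs] /= /andP[xc sc].
by rewrite mulSn leq_add // IHs.
Qed.

Lemma leq_expnr (m n k : nat) : (m <= n)%N -> (m ^ k <= n ^ k)%N.
Proof. by case: k => [//|k]; rewrite leq_exp2r. Qed.

(** * Polynomial bounds for almost periodic sequences and lossless words *)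

Section Almost_periodic.
Local Open Scope nat_scope.
Variables (T : eqType) (A : seq T).

Fixpoint defects (s : seq T) : nat :=
  if s is x :: s' then
    (if s' is _ :: z :: _ then (x != z : nat) else 0) + defects s'
  else 0.

(** An entry either repeats the one two places before or is any member of [A], at the price of one
    of [k] defects. For fixed [k] the number of such lists is polynomial in [n]. *)
Fixpoint almost_periodic n k (x y : T) : seq (seq T) :=
  if n is n'.+1 then
    [seq x :: s | s <- almost_periodic n' k y x] ++
    (if k is k'.+1 then [seq z :: s | z <- A, s <- almost_periodic n' k' y z]
     else [::])
  else [:: [::]].

Lemma size_almost_periodic n k x y :
  size (almost_periodic n k x y) <= (size A * n).+1 ^ k.
Proof.
elim: n k x y => [|n IHn] k x y /=; first by rewrite muln0 exp1n.
case: k => [|k]; rewrite size_cat size_map.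
  by rewrite addn0 (leq_trans (IHn _ _ _)).
rewrite size_allpairs_dep.
have le_sum : sumn [seq size (almost_periodic n k y z) | z <- A] <=
    size A * (size A * n).+1 ^ k.
  rewrite -[size A in X in _ <= X * _](size_map (fun z => size (almost_periodic n k y z))).
  by apply: sumn_le; apply/allP => _ /mapP[z _ ->].
apply: leq_trans (leq_add (IHn _ _ _) le_sum) _.
rewrite expnS -mulnDl expnS; apply: leq_mul; first by rewrite mulnS; lia.
by apply: leq_expnr; rewrite ltnS leq_mul.
Qed.

Lemma mem_almost_periodic n k x y s : size s = n -> all (mem A) s ->
  defects [:: x, y & s] <= k -> s \in almost_periodic n k x y.
Proof.
elim: n k x y s => [|n IHn] k x y [|z s] //= [sn] /andP[zA sA] sk.
rewrite mem_cat; case: (eqVneq x z) sk => [<- sk|xz].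
  by apply/orP; left; apply: map_f; apply: IHn.
case: k => [//|k] sk; apply/orP; right.
by apply/allpairsPdep; exists z, s; split=> //; apply: IHn.
Qed.

End Almost_periodic.

Fixpoint words_upto n : seq (seq letter) :=
  if n is n'.+1 then
    [::] :: [seq l :: w | l <- [:: LT; LA; LB; LC], w <- words_upto n']
  else [:: [::]].

Lemma mem_words_upto n w : (size w <= n)%N -> w \in words_upto n.
Proof.
elim: n w => [|n IHn] [|l w] // wn.
have : l :: w \in [seq l :: w | l <- [:: LT; LA; LB; LC], w <- words_upto n].
  by apply: allpairs_f; [by case: (l)|exact: IHn].
by move=> lw; rewrite [words_upto _]/= in_cons; apply/orP; right; exact: lw.
Qed.

Section Lossless_count.
Local Open Scope nat_scope.
Implicit Types (g u v w : seq letter).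

(** For each of the three letters [P], a gap holds at most [np P + 1] of them. *)
Lemma gap_size w g : g \in gaps w ->
  size g <= 3 + (np LA false w + np LB false w + np LC false w).
Proof.
have npE P v : np P false (rcons v LT) = np P false v.
  by have := np_cat P false v [:: LT]; rewrite cats1 addn0.
move=> gw; have gT : LT \notin g := allP (gaps_noT w) g gw.
have np_le P : np P false g <= np P false w.
  rewrite -(npE P w) -ungapK; elim: (gaps w) gw => [//|h gs IHgs].
  rewrite inE ungap_cons np_cat -cats1 np_cat.
  have -> : seen P false (h ++ [:: LT]) = false.
    suff seenT k f : seen P f (k ++ [:: LT]) = false by [].
    by elim: k f => [//|l k IHk] f; exact: IHk.
  by case/orP=> [/eqP->|/IHgs]; lia.
have gT0 : occ LT g = 0 by apply/count_memPn.
have : size g = occ LT g + occ LA g + occ LB g + occ LC g.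
  elim: g {gT np_le gw gT0} => [//|l g IHg] /=; rewrite !occ_cons IHg !letter_eqE.
  by case: l => /=; lia.
have := count_nz_np false g (isT : LA != LT).
have := count_nz_np false g (isT : LB != LT).
have := count_nz_np false g (isT : LC != LT).
have := np_le LA; have := np_le LB; have := np_le LC.
by rewrite gT0 !addn0; lia.
Qed.

Definition tame K M L v : Prop :=
  [/\ breaks (gaps v) <= K,
      np LA false v + np LB false v + np LC false v <= M & occ LT v <= L].

(** The possible numbers of gaps, times the almost periodic sequences of short gaps. Two further
    defects come from starting these sequences after two empty gaps. *)
Definition tame_bound K M L := L.+1 * (size (words_upto (3 + M)) * L.+1).+1 ^ K.+2.

Lemma defects_breaks gs : defects (map nf gs) = breaks gs.
Proof. by elim: gs => [//|g [|g' [|g2 gs]] IHgs] //; exact: (congr1 (addn _) IHgs). Qed.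

Lemma defects_cons (T : eqType) (x : T) s : defects (x :: s) <= (defects s).+1.
Proof. by case: s => [//|y [|z s]] //=; rewrite -add1n leq_add2r; case: eqP. Qed.

(** The key is the list of normal forms of the gaps. It determines the element because the final t
    added by [ungap] cancels on both sides. *)
Lemma covered_tame K M L : covered (tame K M L) (tame_bound K M L).
Proof.
set A := words_upto (3 + M).
pose r gs v := map nf (gaps v) = gs.
apply: (@covered_key _ (flatten [seq almost_periodic A n.+1 K.+2 [::] [::] |
  n <- iota 0 L.+1]) r).
- rewrite size_flatten /shape -map_comp /tame_bound -/A.
  suff /sumn_le : all (fun x => x <= (size A * L.+1).+1 ^ K.+2)
      [seq (size \o (fun n => almost_periodic A n.+1 K.+2 [::] [::])) n |
        n <- iota 0 L.+1] by rewrite size_map size_iota.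
  apply/allP => _ /mapP[n + ->]; rewrite mem_iota /= add0n => nL.
  move/leq_trans: (size_almost_periodic A n.+1 K.+2 [::] [::]); apply.
  by apply: leq_expnr; rewrite ltnS leq_mul.
- move=> v [v1 v2 v3]; exists (map nf (gaps v)) => //.
  apply/flatten_mapP; exists (occ LT v); first by rewrite mem_iota.
  apply: mem_almost_periodic; first by rewrite size_map size_gaps.
    apply/allP => _ /mapP[g gv ->]; apply: mem_words_upto.
    have -> : size (nf g) = size g.
      rewrite /nf /perfect !inE; case: ifP => //.
      by do !case/orP; move=> /eqP->; case: A_before_B.
    by apply: leq_trans (gap_size gv) _; rewrite leq_add2l.
  rewrite -defects_breaks in v1.
  by apply: leq_trans (defects_cons _ _) _; rewrite ltnS;
    apply: leq_trans (defects_cons _ _) _.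
- move=> gs w w' <- E s.
  have nfE u : wact (ungap (map nf (gaps u))) =1 wact (rcons u LT).
    rewrite -ungapK => {}s; elim: (gaps u) s => [//|g hs IHg] s.
    by rewrite !ungap_cons !wact_cat IHg -!cats1 !wact_cat wact_nf.
  have : wact (rcons w LT) s = wact (rcons w' LT) s by rewrite -!nfE E.
  rewrite -!cats1 !wact_cat /= => /(congr1 state_t).
  by rewrite !state_tK.
Qed.

Definition lossless_bound K M L :=
  2 * ((2 * (tame_bound K M L * tame_bound K M L)) *
       (2 * (tame_bound K M L * tame_bound K M L))).

(** Tameness is available on level 2 only, so the count is carried up through two levels of
    sections. The constants [K] and [M] do not depend on [L]. *)
Lemma covered_lossless : exists K M, forall L,
  covered (fun w => lossless 4 w /\ wt w = L) (lossless_bound K M L).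
Proof.
suff [K [M tameP]] : exists K M, forall L w x y, lossless 4 w -> wt w = L ->
    tame K M L (sec y (sec x w)).
  exists K, M => L.
  pose Q1 v := tame K M L (sec false v) /\ tame K M L (sec true v).
  have cQ1 : covered Q1 (2 * (tame_bound K M L * tame_bound K M L)).
    by apply: (covered_sec _ (covered_tame K M L) (covered_tame K M L)) => w [].
  by apply: (covered_sec _ cQ1 cQ1) => w [w4 wL]; split; split; apply: tameP.
exists 500, 14 => L w x y w4 <-.
have := breaks_total w4; have [_ _] := lossless_total w4.
by rewrite /tame; case: x; case: y => /= *; split; lia.
Qed.

End Lossless_count.

(** * Growth rates *)

Section Exponential_rates.
Variable R : realType.
Implicit Types (x y z C : R) (f g : nat -> nat).

Lemma bernoulli x n : 0 <= x -> 1 + x * n%:R <= (1 + x) ^+ n.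
Proof.
move=> x0; elim: n => [|n IHn]; first by rewrite mulr0 addr0 expr0.
rewrite exprS; apply: le_trans (_ : (1 + x) * (1 + x * n%:R) <= _); last first.
  by rewrite ler_wpM2l // addr_ge0.
rewrite -natr1 -subr_ge0.
have -> : (1 + x) * (1 + x * n%:R) - (1 + x * (n%:R + 1)) = x * x * n%:R by ring.
by rewrite !mulr_ge0.
Qed.

Lemma linear_le_exp x : 1 < x -> exists2 C, 0 < C & forall n : nat,
  n.+1%:R <= C * x ^+ n.
Proof.
move=> x1; pose h := x - 1; have h0 : 0 < h by rewrite subr_gt0.
exists (1 + h^-1); first by rewrite addr_gt0 ?invr_gt0.
move=> n; have := bernoulli n (ltW h0); have -> : 1 + h = x by rewrite subrKC.
move=> xn; apply: le_trans (_ : (1 + h^-1) * (1 + h * n%:R) <= _).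
  rewrite mulrDl mul1r mulrDr mulr1 mulrA mulVf ?gt_eqF //.
  rewrite mul1r -natr1 -subr_ge0.
  have -> : 1 + h * n%:R + (h^-1 + n%:R) - (n%:R + 1) = h * n%:R + h^-1 by ring.
  by rewrite addr_ge0 ?mulr_ge0 ?invr_ge0 // ltW.
by rewrite ler_wpM2l // addr_ge0 ?invr_ge0 // ltW.
Qed.

Lemma exp_unbounded x C : 1 < x -> exists n, C <= x ^+ n.
Proof.
move=> x1; have [D D0 H] := linear_le_exp x1.
exists (Num.trunc (D * C)); rewrite -(ler_pM2l D0).
by apply: le_trans (H _); exact/ltW/truncnS_gt.
Qed.

Lemma sqrt_gt1 x : 1 < x -> 1 < Num.sqrt x.
Proof. by move=> x1; rewrite -sqrtr1 ltr_sqrt // (lt_trans ltr01). Qed.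

Lemma small_root x k : 1 < x -> exists2 z, 1 < z & z ^+ k <= x.
Proof.
elim: k x => [|k IHk] x x1; first by exists x; rewrite ?expr0 ?ltW.
have s1 := sqrt_gt1 x1; have [z z1 zk] := IHk _ s1.
have x0 : 0 <= x by apply: ltW; exact: lt_trans x1.
have m1 : 1 < Num.min z (Num.sqrt x) by rewrite lt_min z1.
exists (Num.min z (Num.sqrt x)) => //.
rewrite exprS -[leRHS]sqr_sqrtr // expr2 ler_pM //.
- by rewrite ltW // (lt_trans ltr01).
- by rewrite exprn_ge0 // ltW // (lt_trans ltr01).
- by rewrite ge_min lexx orbT.
apply: le_trans zk; rewrite lerXn2r ?nnegrE //.
- by rewrite ltW // (lt_trans ltr01).
- by rewrite ltW // (lt_trans ltr01).
- by rewrite ge_min lexx.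
Qed.

Definition exp_bounded x f : Prop :=
  exists C, forall n, (f n)%:R <= C * x ^+ n.

Lemma exp_bounded_pos x f : exp_bounded x f -> 0 <= x ->
  exists2 C, 0 < C & forall n, (f n)%:R <= C * x ^+ n.
Proof.
move=> [C H] x0; exists (`|C| + 1) => [|n]; first by rewrite ltr_pwDr.
apply: (le_trans (H n)); rewrite ler_wpM2r ?exprn_ge0 //.
by rewrite (le_trans (ler_norm _)) // lerDl.
Qed.

Lemma exp_bounded_le x y f : 0 <= x -> x <= y ->
  exp_bounded x f -> exp_bounded y f.
Proof.
move=> x0 xy /exp_bounded_pos -/(_ x0)[C C0 H]; exists C => n.
apply: (le_trans (H n)); rewrite ler_pM2l // lerXn2r ?nnegrE //.
exact: le_trans xy.
Qed.

Definition subexponential f : Prop := forall x, 1 < x -> exp_bounded x f.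

Lemma subexponential_mul f g : subexponential f -> subexponential g ->
  subexponential (fun n => f n * g n)%N.
Proof.
move=> sf sg x x1; have s1 := sqrt_gt1 x1.
have s0 : 0 <= Num.sqrt x by [].
have [C C0 Cf] := exp_bounded_pos (sf _ s1) s0.
have [D D0 Dg] := exp_bounded_pos (sg _ s1) s0.
exists (C * D) => n; rewrite natrM.
have -> : C * D * x ^+ n = C * Num.sqrt x ^+ n * (D * Num.sqrt x ^+ n).
  by rewrite mulrACA -exprMn -expr2 sqr_sqrtr // ltW // (lt_trans ltr01).
by rewrite ler_pM.
Qed.

Lemma subexponential_cst c : subexponential (fun=> c).
Proof.
move=> x x1; exists c%:R => n; rewrite ler_peMr // exprn_ege1 // ltW //.
Qed.

Lemma subexponentialS : subexponential succn.
Proof.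
by move=> x /linear_le_exp[C _ H]; exists C.
Qed.

Lemma subexponential_exp f k : subexponential f ->
  subexponential (fun n => f n ^ k)%N.
Proof.
move=> sf; elim: k => [|k IHk]; first exact: (subexponential_cst 1).
have := subexponential_mul sf IHk.
by congr subexponential; apply/funext => n; rewrite expnS.
Qed.

Lemma subexponential_affine a : subexponential (fun n => (a * n.+1).+1)%N.
Proof.
have := subexponential_mul (subexponential_cst a.+1) subexponentialS.
move=> H x /H[C HC]; exists C => n; apply: le_trans (HC n).
by rewrite ler_nat mulSn; lia.
Qed.

Lemma subexponential_lossless K M : subexponential (lossless_bound K M).
Proof.
have H : subexponential (tame_bound K M).
  apply: (subexponential_mul subexponentialS).
  exact/subexponential_exp/subexponential_affine.
have H2 : subexponential (fun L => 2 * (tame_bound K M L * tame_bound K M L))%N.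
  by apply: (subexponential_mul (subexponential_cst 2)); exact: subexponential_mul.
by apply: (subexponential_mul (subexponential_cst 2)); exact: subexponential_mul.
Qed.

Lemma exp_bounded_sum x y f : 1 <= x -> x < y -> exp_bounded x f ->
  exp_bounded y (fun n => \sum_(i < n.+1) f i)%N.
Proof.
move=> x1 xy; have x0 : 0 < x by exact: lt_le_trans x1.
move=> /exp_bounded_pos -/(_ (ltW x0))[C C0 H].
have yx : 1 < y / x by rewrite ltr_pdivlMr // mul1r.
have [D D0 HD] := linear_le_exp yx.
exists (C * D) => n; rewrite natr_sum.
apply: le_trans (_ : \sum_(i < n.+1) C * x ^+ n <= _).
  apply: ler_sum => i _; apply: (le_trans (H i)).
  by rewrite ler_pM2l // ler_weXn2l // -ltnS.
rewrite sumr_const card_ord -mulr_natr -!mulrA ler_pM2l // mulrC.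
by have := HD n; rewrite expr_div_n mulrA ler_pdivlMr ?exprn_gt0.
Qed.

(** This is the sum that arises when a norm is distributed over two sections; its [n.+1] terms cost
    a linear factor, which the step from [x] to [y] absorbs. *)
Lemma exp_bounded_conv x y f : 1 <= x -> x < y -> exp_bounded x f ->
  exp_bounded y (fun n => \sum_(i < n.+1) 2 * (f i * f (n - i)))%N.
Proof.
move=> x1 xy; have x0 : 0 < x by exact: lt_le_trans x1.
move=> /exp_bounded_pos -/(_ (ltW x0))[C C0 H].
have yx : 1 < y / x by rewrite ltr_pdivlMr // mul1r.
have [D D0 HD] := linear_le_exp yx.
have [E E0 EE] : exists2 E, 0 < E & E = 2 * (C * C).
  by exists (2 * (C * C)); rewrite // !mulr_gt0.
exists (E * D) => n; rewrite natr_sum.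
apply: le_trans (_ : \sum_(i < n.+1) E * x ^+ n <= _).
  apply: ler_sum => i _; rewrite !natrM EE -mulrA ler_pM2l //.
  have -> : C * C * x ^+ n = C * x ^+ i * (C * x ^+ (n - i)).
    by rewrite mulrACA -exprD subnKC // -ltnS.
  by rewrite ler_pM.
rewrite sumr_const card_ord -mulr_natl mulrCA -mulrA ler_pM2l //.
by have := HD n; rewrite expr_div_n mulrA ler_pdivlMr ?exprn_gt0.
Qed.

End Exponential_rates.

(** * Cutting words into windows *)

Section Windows.
Local Open Scope nat_scope.
Implicit Types (u v w : seq letter).
Variable L : nat.

(** There are [m] windows and a tail; at most [j] windows are exempt from being lossless, and of
    these only the weight is bounded. *)
Fixpoint few_lossy m j w : Prop :=
  if m is m'.+1 then
    exists u v, w = u ++ v /\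
      ([/\ lossless 4 u, wt u = L & few_lossy m' j v] \/
       [/\ 0 < j, wt u <= L & few_lossy m' j.-1 v])
  else wt w <= L.

Lemma wt_split w n : n <= wt w -> exists u v, w = u ++ v /\ wt u = n.
Proof.
elim: w n => [|l w IHw] n; first by rewrite leqn0 => /eqP->; exists [::], [::].
case: n => [|n] nw; first by exists [::], (l :: w).
case: (eqVneq l LT) nw => [->|lT] nw.
  have [u [v [-> uE]]] := IHw n.+1 nw.
  by exists (LT :: u), v; split=> //; rewrite -uE.
have wtE y : wt (l :: y) = (wt y).+1 by rewrite /wt /= lT.
have [|u [v [-> uE]]] := IHw n; first by rewrite wtE in nw.
by exists (l :: u), v; rewrite wtE uE.
Qed.

(** Cut off windows of weight [L] from the left. As [lnorm 4] is subadditive and each lossy window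
    loses at least 1, more than [j] lossy windows make it drop by more than [j]. *)
Lemma few_lossy_or m j r w : r < L -> wt w = m * L + r ->
  few_lossy m j w \/ lnorm 4 w + j < wt w.
Proof.
move=> rL; elim: m j w => [|m IHm] j w wE.
  by left; rewrite /= wE; exact: ltnW.
have [|u [v [{}w_uv uL]]] := @wt_split w L.
  by rewrite wE mulSn -addnA leq_addr.
have vE : wt v = m * L + r by move: wE; rewrite w_uv wt_cat uL mulSn; lia.
have := lnorm_cat 4 u v; rewrite -w_uv.
case: (boolP (lossless 4 u)) => u4.
  have /eqP := u4; rewrite uL => ->.
  case: (IHm j v vE) => [vf _|vl le0]; first by left; exists u, v; split=> //; left.
  by right; rewrite w_uv wt_cat uL; rewrite w_uv in le0; lia.
have ul : lnorm 4 u < wt u by rewrite ltn_neqAle u4 lnorm_wt.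
case: j => [|j] le.
  by right; have := lnorm_wt 4 v; rewrite w_uv wt_cat; rewrite w_uv in le; lia.
case: (IHm j v vE) => [vf|vl].
  by left; exists u, v; split=> //; right; rewrite uL.
by right; rewrite w_uv wt_cat; rewrite w_uv in le; lia.
Qed.

Variables q b : nat.
Hypothesis q_gt0 : 0 < q.
Hypothesis b_gt0 : 0 < b.
Hypothesis covered_q : covered (fun w => lossless 4 w /\ wt w = L) q.
Hypothesis covered_b : covered (fun w => wt w <= L) b.

Lemma covered_or (P Q : seq letter -> Prop) m n :
  covered P m -> covered Q n -> covered (fun w => P w \/ Q w) (m + n).
Proof.
move=> [s sm Hs] [t tn Ht]; exists (s ++ t); first by rewrite size_cat leq_add.
by move=> w [/Hs|/Ht] [v vs E]; exists v; rewrite // mem_cat vs ?orbT.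
Qed.

(** The factor 2 for each window is the choice between lossless and lossy; a lossy window and the
    tail each represent one of at most [b] elements. *)
Lemma covered_few_lossy m j : covered (few_lossy m j) ((2 * q) ^ m * b ^ j * b).
Proof.
elim: m j => [|m IHm] j /=.
  apply: (covered_sub _ _ covered_b) => //.
  by rewrite mul1n -expnSr -{1}(expn1 b) leq_pexp2l.
pose P1 w := exists u v, [/\ w = u ++ v, lossless 4 u /\ wt u = L & few_lossy m j v].
have c1 : covered P1 (q * ((2 * q) ^ m * b ^ j * b)).
  exact: (covered_cat (fun _ h => h) covered_q (IHm j)).
pose P2 w := exists u v, [/\ w = u ++ v, wt u <= L & 0 < j /\ few_lossy m j.-1 v].
have c2 : covered P2 (q * ((2 * q) ^ m * b ^ j * b)).
  apply: (@covered_sub _ P2 (b * (q * ((2 * q) ^ m * b ^ j.-1 * b)) * (0 < j))) => //.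
    case: j {c1 IHm P1 P2} => [|j]; rewrite ?muln0 // muln1 expnS.
    by rewrite /= [_ * (b * _)]mulnCA -(mulnA b) [b * (q * _)]mulnCA.
  case: j {c1 P1} @P2 IHm => [|j] P2 IHm.
    by exists [::] => // w [u [v [_ _ []]]].
  have c : covered P2 (b * ((2 * q) ^ m * b ^ j * b)).
    by apply: (covered_cat _ covered_b (IHm j)) => w [u [v [-> uL [_ vf]]]]; exists u, v.
  apply: (covered_sub (fun _ h => h) _ c).
  by rewrite muln1 leq_mul2l leq_pmull ?orbT.
apply: (covered_sub _ _ (covered_or c1 c2)).
  move=> w [u [v [-> [[u4 uL vf]|[j0 uL vf]]]]]; [left|right]; exists u, v; split=> //.
by rewrite addnn -mul2n expnS !mulnA.
Qed.

End Windows.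

(** * Improving the growth rate of balls *)

Section Growth_rate.
Variable R : realType.
Implicit Types (u v w : seq letter) (x y z C lam : R).

Definition rate (P : nat -> seq letter -> Prop) x : Prop :=
  exists2 f, (forall n, covered (P n) (f n)) & exp_bounded x f.

Definition ball (n : nat) w : Prop := (wt w <= n)%N.

Lemma covered_eq (P Q : seq letter -> Prop) m :
  (forall w, P w -> exists2 w', wact w =1 wact w' & Q w') ->
  covered Q m -> covered P m.
Proof.
move=> PQ [s sm H]; exists s => // w /PQ[w' E /H[v vs E']].
by exists v => // t; rewrite E.
Qed.

Lemma covered_ball0 : covered (ball 0) 2.
Proof.
exists [:: [::]; [:: LT]] => //; elim=> [_|l w IHw]; first by exists [::].
rewrite /ball; case: (eqVneq l LT) => [->|lT]; last by rewrite /wt /= lT.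
move=> /IHw[v]; rewrite !inE => /orP[]/eqP-> E; [exists [:: LT]|exists [::]] => //.
- by move=> s; rewrite wact_cons E.
- by move=> s; rewrite wact_cons E /= state_tK.
Qed.

Lemma covered_ballS n m : covered (ball n) m ->
  covered (ball n.+1) (2 * (5 * m)).
Proof.
move=> cm; pose P1 w := (size w <= 1)%N.
have c1 : covered P1 5.
  exists [:: [::]; [:: LT]; [:: LA]; [:: LB]; [:: LC]] => // w w1.
  by exists w => //; case: w w1 => [|[] []].
pose P2 w := exists u v, [/\ w = u ++ v, P1 u & ball n v].
have c2 : covered P2 (5 * m) by exact: (covered_cat (fun _ h => h) c1 cm).
apply: (covered_cat _ covered_ball0 c2); elim=> [|l w IHw] wn.
  by exists [::], [::]; split=> //; exists [::], [::].
case: (eqVneq l LT) wn => [->|lT] wn.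
  by have [u [v [-> u0 v2]]] := IHw wn; exists (LT :: u), v.
exists [::], (l :: w); split=> //; exists [:: l], w; split=> //.
by move: wn; rewrite /ball /wt /= lT add1n ltnS.
Qed.

Lemma rate_ball10 : rate ball 10.
Proof.
exists (fun n => 2 * 10 ^ n)%N; last by exists 2 => n; rewrite natrM natrX.
elim=> [|n IHn]; first exact: covered_ball0.
by apply: (covered_sub (fun _ h => h) _ (covered_ballS IHn)); rewrite expnS; lia.
Qed.

(** An element is determined by its sections and a parity, so each level is one convolution. Half of
    the distance from [lam] to [x] pays for it, which is why rates are assumed for all [x > lam] and
    not at [lam]. *)
Lemma rate_lnorm lam : 1 <= lam -> (forall x, lam < x -> rate ball x) ->
  forall k x, lam < x -> rate (fun N w => (lnorm k w <= N)%N) x.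
Proof.
move=> lam1 H; elim=> [|k IHk] x lx.
  have [f fc fb] := H _ lx; exists f => // n.
  apply: covered_eq (fc n) => w wn; have [w' E wE] := norm_wit w.
  by exists w' => //; rewrite /ball wE.
pose y := (lam + x) / 2; have ly : lam < y by rewrite /y; lra.
have yx : y < x by rewrite /y; lra.
have [f fc fb] := IHk _ ly; exists (fun n => \sum_(i < n.+1) 2 * (f i * f (n - i)))%N.
  move=> n; apply: (@covered_bigcup _ (fun i w =>
    lnorm k (sec false w) <= i /\ lnorm k (sec true w) <= n - i)%N
    (fun i => 2 * (f i * f (n - i)))%N).
    move=> w /= wn; exists (lnorm k (sec false w)).
      by rewrite ltnS (leq_trans _ wn) // leq_addr.
    by split=> //; rewrite leq_subRL ?(leq_trans _ wn) // leq_addr.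
  by move=> i _; apply: covered_sec (fc i) (fc (n - i)%N).
by apply: exp_bounded_conv yx fb; apply: ltW; exact: le_lt_trans ly.
Qed.

(** The bound for lossless words is subexponential, so it falls below x^L / 4. Of the factor 4, one
    2 pays for the choice made in each window and the other for the lossy windows. *)
Lemma lossless_window x : 1 < x -> exists L q : nat,
  [/\ (0 < L)%N, (0 < q)%N, covered (fun w => lossless 4 w /\ wt w = L) q &
      (4 * q)%:R <= x ^+ L].
Proof.
move=> x1; have [K [M H]] := covered_lossless.
have s1 := sqrt_gt1 x1; have s0 : 0 <= Num.sqrt x by [].
have [C C0 Cf] := exp_bounded_pos (@subexponential_lossless R K M _ s1) s0.
have [n nC] := exp_unbounded (4 * C) s1.
exists n.+1, (lossless_bound K M n.+1); split=> //.
  by rewrite !(muln_gt0, expn_gt0).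
rewrite natrM; apply: le_trans (_ : 4 * (C * Num.sqrt x ^+ n.+1) <= _).
  by rewrite ler_pM2l.
rewrite mulrA -[X in _ <= X ^+ _]sqr_sqrtr; last by rewrite ltW // (lt_trans ltr01).
rewrite -exprM mulSn mul1n exprD; apply: ler_wpM2r; first by rewrite exprn_ge0.
by apply: (le_trans nC); rewrite exprS ler_peMl ?exprn_ge0 // ltW.
Qed.

(** Allow one lossy window in every [b]. Words within this allowance have rate [x1 < lam]. For all
    others of weight n, [lnorm 4] is at most n (1 - 1 / M) with [M = b * L], so their rate is x^(1 -
    1 / M) for any [x > lam], which is below [lam] once [x] is close to [lam]. *)
Lemma ball_improve lam : 1 < lam -> (forall x, lam < x -> rate ball x) ->
  exists2 y, 1 <= y < lam & rate ball y.
Proof.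
move=> lam1 H; pose x1 := (1 + lam) / 2.
have x11 : 1 < x1 by rewrite /x1; lra.
have x1l : x1 < lam by rewrite /x1; lra.
have [L [q [L0 q0 cq qx]]] := lossless_window x11.
have [fb fbc _] := H (lam + 1) (ltac:(lra)).
pose b := maxn 1 (fb L); have b0 : (0 < b)%N by rewrite leq_max.
have cb : covered (fun w => wt w <= L)%N b.
  by apply: (covered_sub _ _ (fbc L)); rewrite // leq_max leqnn orbT.
pose M := (b * L)%N; have M0 : (0 < M)%N by rewrite muln_gt0 b0.
(* With [x = lam * z] and [y = lam / z], the bound on z^(2 M) is what gives x^(M - 1) <= y^M. *)
have [z z1 zM] := small_root (M + M) lam1.
have z0 : 0 < z by exact: lt_trans z1.
have lam0 : 0 < lam by exact: lt_trans lam1.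
pose x := lam * z; pose y := lam / z.
have lx : lam < x by rewrite /x ltr_pMr.
have yl : y < lam by rewrite /y ltr_pdivrMr // ltr_pMr.
have xy : x ^+ M.-1 <= y ^+ M.
  rewrite /y expr_div_n ler_pdivlMr ?exprn_gt0 // -[in lam ^+ M](prednK M0).
  rewrite /x exprMn -mulrA exprSr ler_pM2l ?exprn_gt0 // -exprD.
  by apply: le_trans zM; rewrite ler_weXn2l ?ltW // leq_add2r leq_pred.
have [f4 f4c] := rate_lnorm (ltW lam1) H 4 lx.
have x0 : 0 < x by exact: lt_trans lx.
have y0 : 0 < y by rewrite divr_gt0.
move=> /exp_bounded_pos -/(_ (ltW x0))[C C0 HC].
pose g n := let m := (n %/ L)%N in let j := (m %/ b)%N in
  ((2 * q) ^ m * b ^ j * b + f4 (n - j.+1))%N.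
have gc n : covered (fun w => wt w = n) (g n).
  have cf := covered_few_lossy q0 b0 cq cb (n %/ L) (n %/ L %/ b)%N.
  have cc := covered_or cf (f4c (n - (n %/ L %/ b).+1)%N).
  apply: (covered_sub _ _ cc) => // w wn.
  have wE : (wt w = n %/ L * L + n %% L)%N by rewrite -divn_eq.
  have [wf|lw] := few_lossy_or (n %/ L %/ b)%N (ltn_pmod n L0) wE.
    by left.
  by right; rewrite wn in lw; move: (n %/ L %/ b)%N lw => k; clear; lia.
pose y' := Num.max x1 y.
have y'l : y' < lam by rewrite gt_max x1l.
have y'1 : 1 <= y' by rewrite le_max (ltW x11).
have gb : exp_bounded y' g.
  exists (b%:R + C) => n; rewrite /g; cbv zeta; rewrite natrD mulrDl; apply: lerD.
    set m := (n %/ L)%N.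
    apply: le_trans (_ : (b * (4 * q) ^ m)%:R <= _).
      rewrite ler_nat [leqRHS]mulnC leq_mul2r; apply/orP; right.
      rewrite (_ : 4 * q = 2 * q * 2)%N; last by rewrite mulnAC.
      rewrite (expnMn (2 * q)) leq_mul2l; apply/orP; right.
      (* From b <= 2^b the lossy windows contribute at most 2^m, the second factor 2 of [4 * q]. *)
      apply: leq_trans (_ : (2 ^ b) ^ (m %/ b) <= _)%N.
        by apply: leq_expnr; exact/ltnW/ltn_expl.
      by rewrite -expnM leq_pexp2l // mulnC leq_trunc_div.
    rewrite natrM ler_pM2l ?ltr0n // natrX.
    apply: le_trans (_ : (x1 ^+ L) ^+ m <= _).
      by rewrite lerXn2r ?nnegrE // exprn_ge0 // ltW // (lt_trans ltr01).
    rewrite -exprM; apply: le_trans (_ : x1 ^+ n <= _).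
      by rewrite ler_weXn2l ?ltW // mulnC leq_trunc_div.
    by rewrite lerXn2r ?nnegrE ?le_max ?lexx ?(ltW (lt_trans ltr01 x11)).
  apply: (le_trans (HC (n - (n %/ L %/ b).+1)%N)); rewrite ler_pM2l //.
  apply: le_trans (_ : y ^+ n <= _); last first.
    by rewrite lerXn2r ?nnegrE ?le_max ?lexx ?(ltW y0) ?orbT.
  set N := (n - _)%N.
  (* This is [N] <= n (1 - 1 / M) without denominators; it holds because the number of allowed lossy
     windows plus one exceeds n / M. *)
  have MN : (N * M <= M.-1 * n)%N.
    have : (n < (n %/ L %/ b).+1 * M)%N.
      rewrite /M mulnA; apply: (leq_trans (ltn_ceil n L0)).
      by rewrite leq_mul2r ltn_ceil ?orbT.
    rewrite /N -subn1 !mulnBl mul1n [(n * M)%N]mulnC.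
    by move: (_ * M)%N (M * n)%N => k1 k2; clear; lia.
  have yn0 : 0 <= y ^+ n by rewrite exprn_ge0 // ltW.
  have xn0 : 0 <= x ^+ N by rewrite exprn_ge0 // ltW.
  rewrite -(ler_pXn2r M0) ?nnegrE // -!exprM.
  apply: le_trans (_ : x ^+ (M.-1 * n) <= _).
    by rewrite ler_weXn2l // ltW // (lt_trans lam1).
  rewrite exprM [(n * M)%N]mulnC [leRHS]exprM.
  by rewrite lerXn2r ?nnegrE ?exprn_ge0 // ltW.
pose y2 := (y' + lam) / 2.
exists y2; first by rewrite /y2; apply/andP; split; lra.
exists (fun n => \sum_(i < n.+1) g i)%N.
  move=> n; apply: (@covered_bigcup _ (fun i w => wt w = i) g) => // w wn.
  by exists (wt w).
by apply: exp_bounded_sum gb => //; rewrite /y2; lra.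
Qed.

(** All rates above the infimum of [E] are valid. If it exceeded 1, [ball_improve] would yield a
    member of [E] below it. *)
Lemma ball_rate x : 1 < x -> rate ball x.
Proof.
move=> x1; pose E : set R := [set y | 1 <= y /\ rate ball y].
have E0 : E !=set0 by exists 10; split; [lra|exact: rate_ball10].
have E1 : lbound E 1 by move=> y [].
have up y : inf E < y -> rate ball y.
  move=> /(inf_lt E0)[e [e1 [f fc fb]] ey]; exists f => //.
  exact: exp_bounded_le (le_trans ler01 e1) (ltW ey) fb.
have inf1 : 1 <= inf E by exact: lb_le_inf.
apply: (up); have [/(fun h => le_lt_trans h x1)//|lam1] := leP (inf E) 1.
have [y /andP[y1 yl] yb] := ball_improve lam1 up.
have : inf E <= y by apply: ge_inf; [exists 1|].
by rewrite leNgt yl.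
Qed.

End Growth_rate.

(** * From words to tree automorphisms *)

Section Automaton_group.
Implicit Types (u v w : seq letter).

Lemma wact_iso w : @tree_iso binary_tree binary_tree (wact w).
Proof.
split; last by move=> s /=; rewrite /word_parent wact_take wact_size.
  exists (wact (rev w)); first exact: wact_rev.
  by move=> s; rewrite -{1}(revK w) wact_rev.
by rewrite /= wact_nil.
Qed.

Definition waut w : tree_aut binary_tree := TreeAut (wact_iso w).

(** The order is reversed: words act from left to right, automorphisms compose as functions. *)
Lemma wautM v w : waut (v ++ w) = (waut w * waut v)%g.
Proof. by apply: tree_aut_ext => s; rewrite /= wact_cat. Qed.

Lemma wautV w : (waut w)^-1%g = waut (rev w).
Proof.
apply: (mulgI (waut w)); rewrite mulgV -wautM.
by apply: tree_aut_ext => s; rewrite /= wact_cat -{1}(revK w) wact_rev.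
Qed.

Definition generators : seq (tree_aut binary_tree) :=
  [:: TreeAut state_a_iso; TreeAut state_b_iso;
      TreeAut state_c_iso; TreeAut state_t_iso].

Lemma generatorsP x : x \in generators -> exists l, x = waut [:: l].
Proof.
rewrite !inE => /or4P[]/eqP->; [exists LA|exists LB|exists LC|exists LT];
  exact: tree_aut_ext.
Qed.

Lemma waut_generators l : waut [:: l] \in generators.
Proof.
have -> : waut [:: l] = match l with
    LA => TreeAut state_a_iso | LB => TreeAut state_b_iso
  | LC => TreeAut state_c_iso | LT => TreeAut state_t_iso end.
  by case: l; apply: tree_aut_ext.
by case: l; rewrite !inE eqxx ?orbT.
Qed.

Lemma automaton_groupP g : automaton_group g <-> exists w, g = waut w.
Proof.
split=> [|[w ->]].
  move=> gG; apply: (gG [set h | exists w, h = waut w]); split; first split.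
  - by exists [::]; apply: tree_aut_ext.
  - by move=> _ _ [v ->] [w ->]; exists (rev w ++ v); rewrite wautM wautV.
  - by move=> x /= /generatorsP[l ->]; exists [:: l].
move=> H [[H1 HV] Hgen].
have Hinv x : H x -> H x^-1%g by rewrite -[x^-1%g]mul1g; exact: HV.
elim/last_ind: w => [|w l Hw].
  by have -> : waut [::] = 1%g by apply: tree_aut_ext.
rewrite -cats1 wautM -[waut w]invgK; apply: HV; last exact: Hinv.
by apply: Hgen; exact: waut_generators.
Qed.

Lemma word_ball_waut n g : word_ball generators n g ->
  exists2 w, (size w <= n)%N & g = waut w.
Proof.
move=> [s [sn sg] <-]; elim: s n sn sg => [|x s IHs] n sn sg.
  by exists [::]; rewrite // big_nil; apply: tree_aut_ext.
case: n sn => [//|n] sn; have [|w wn wE] := IHs n sn.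
  by move=> y ys; apply: sg; rewrite inE ys orbT.
have [l xE] : exists l, x = waut [:: l].
  have [/generatorsP//|/generatorsP[l lE]] := sg x (mem_head _ _).
  by exists l; rewrite -[x]invgK lE wautV.
by exists (rcons w l); rewrite ?size_rcons // big_cons wE xE -cats1 wautM.
Qed.

Lemma card_word_ball (n m : nat) : covered (ball n) m ->
  (#|` fset_set (word_ball generators n)| <= m)%N.
Proof.
move=> [s sm H].
have /fsubset_leq_card : (fset_set (word_ball generators n) `<=`
    [fset g in [seq waut v | v <- s]])%fset.
  apply/fsubsetP => g; rewrite in_fset_set; last exact: finite_word_ball.
  move=> /set_mem/word_ball_waut[w wn ->]; rewrite inE.
  have [|v vs E] := H w; first by rewrite /ball (leq_trans _ wn) ?count_size.
  by apply/mapP; exists v => //; exact: tree_aut_ext.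
move=> /leq_trans; apply; rewrite card_fseq.
by apply: leq_trans (size_undup _) _; rewrite size_map.
Qed.

Lemma automaton_group_subexponential (R : realType) :
  subexponential_growth R automaton_group.
Proof.
exists generators; split=> //.
apply/cvgrPdist_le => e e0.
pose x := 1 + e; have x1 : 1 < x by rewrite ltrDl.
(* Using the rate [Num.sqrt x] leaves a second factor [Num.sqrt x ^+ n], which absorbs the constant
   [C] for large [n]. *)
have s1 := sqrt_gt1 x1; have s0 : 0 <= Num.sqrt x by [].
have x0 : 0 < x by exact: lt_trans x1.
have [f fc fb] := ball_rate s1; have [C C0 HC] := exp_bounded_pos fb s0.
have [N NC] := exp_unbounded C s1.
near=> n.
have n0 : (0 < n)%N by near: n; exact: nbhs_infty_gt.
set k := #|` _|; have k1 : (0 < k)%N.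
  rewrite cardfs_gt0; apply/fset0Pn; exists 1%g.
  rewrite in_fset_set; last exact: finite_word_ball.
  by apply/mem_set; exists [::]; rewrite ?big_nil.
have kx : k%:R <= x ^+ n.
  apply: le_trans (_ : (f n)%:R <= _).
    by rewrite ler_nat; exact: card_word_ball.
  apply: (le_trans (HC n)); rewrite -[in leRHS](sqr_sqrtr (ltW x0)).
  rewrite -exprM mulSn mul1n exprD ler_wpM2r ?exprn_ge0 //.
  apply: (le_trans NC); rewrite ler_weXn2l ?ltW //.
  by near: n; exact: nbhs_infty_ge.
have lb : 1 <= k%:R `^ n%:R^-1 :> R.
  by rewrite -[leLHS](powRr0 k%:R) ler_powR ?ler1n ?invr_ge0.
have ub : k%:R `^ n%:R^-1 <= x.
  have -> : x = (x ^+ n) `^ n%:R^-1.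
    by rewrite -powR_mulrn ?(ltW x0) // -powRrM mulfV ?powRr1 ?(ltW x0) // pnatr_eq0 -lt0n.
  by rewrite ge0_ler_powR ?nnegrE ?invr_ge0 ?exprn_ge0 ?(ltW x0).
rewrite ler0_norm ?subr_le0 // opprB lerBlDr addrC; exact: ub.
Unshelve. all: by end_near.
Qed.

End Automaton_group.

(** * Cuts, strips and halves of the plane *)

Section Plane.
Variables (R : realType) (al be : R).
Implicit Types (z u v : R * R) (l : letter).

Definition sq z : R * R :=
  (z.1 * z.1 - z.2 * z.2 + al, z.1 * z.2 + z.1 * z.2 + be).

(** The orbit of the critical value c. As -c and c have the same image it closes up after four
    points; the letter of a point is the generator given by a loop around it. *)
Definition cpt l : R * R :=
  match l with
  | LT => (al, be) | LA => sq (al, be) | LB => sq (sq (al, be))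
  | LC => (- al, - be)
  end.

(** The first clause closes the critical orbit. The inequalities put each cut into its own sector
    between the diagonals and keep the explicit loops used later away from the wrong cuts. *)
Definition good_params : Prop :=
  [/\ sq (cpt LB) = cpt LC,
      [/\ - 2^-1 < al, al < 0, be < 2 & - al *+ 4 < be],
      [/\ - 3 < (cpt LA).1, (cpt LA).1 < - 2^-1, 0 < (cpt LA).2 &
          (cpt LA).2 < - (cpt LA).1] &
      [/\ 0 < (cpt LB).1, (cpt LB).1 < 3, (cpt LB).2 < 0 &
          - (cpt LB).2 < (cpt LB).1]].

(* The cut at [cpt l] is the ray on which [side l] vanishes and [beyond l] is
   positive: it goes up for [LT], left for [LA], right for [LB], down for
   [LC]. *)
Definition side l z : R :=
  match l with
  | LT => z.1 - al | LA => z.2 - (cpt LA).2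
  | LB => z.2 - (cpt LB).2 | LC => z.1 + al
  end.

Definition beyond l z : R :=
  match l with
  | LT => z.2 - be | LA => (cpt LA).1 - z.1
  | LB => z.1 - (cpt LB).1 | LC => - be - z.2
  end.

(** Meant for [v] close to [u]: then the sign of [side] changes only if [u] lies on the line of the
    cut, so [beyond] is tested at [u]. *)
Definition cross l u v : bool :=
  (0 < beyond l u) && ((0 <= side l u) != (0 <= side l v)).

(* The region between the cut at [cpt l] and the preimage of the cut at
   [sq (cpt l)] that ends at [cpt l]. *)
Definition strip l z : bool :=
  let: (x, y) := z in
  match l with
  | LT => [&& 0 < y, al <= x & x * y < al * be]
  | LA => [&& x < 0, y < (cpt LA).2 & x * y < (cpt LA).1 * (cpt LA).2]
  | LB => [&& 0 < x, y < (cpt LB).2 & - al *+ 2 <= x * x - y * y]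
  | LC => [&& y < 0, x < - al & x * y < al * be]
  end.

(* The preimage of the cut at [cpt LT] is the diagonal, and this tells on
   which side of it a point is. *)
Definition half z : bool := if 0 < z.1 + z.2 then z.2 <= z.1 else z.2 < z.1.

(** The open quadrants between the diagonals. Each contains one cut and its strip, so at any point
    at most one letter is active. *)
Definition sector l z : bool :=
  match l with
  | LT => (- z.2 < z.1) && (z.1 < z.2)
  | LA => (z.1 < z.2) && (z.1 < - z.2)
  | LB => (z.2 < z.1) && (- z.2 < z.1)
  | LC => (z.2 < z.1) && (z.1 < - z.2)
  end.

Lemma sector_inj z l l' : sector l z -> sector l' z -> l = l'.
Proof. by case: l; case: l' => //= /andP[? ?] /andP[? ?]; exfalso; lra. Qed.

Definition sgn_le (a b : R) : Prop := (0 < a -> 0 < b) /\ (a < 0 -> b < 0).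

Lemma sgn_le_ge0 a b : sgn_le a b -> a != 0 -> (0 <= b) = (0 <= a).
Proof.
case=> ab ba; rewrite neq_lt => /orP[a0|a0].
  by rewrite !leNgt ba ?a0.
by rewrite !ltW // ab.
Qed.

Lemma sgn_le_gt0 a b : sgn_le a b -> a != 0 -> (0 < b) = (0 < a).
Proof.
case=> ab ba; rewrite neq_lt => /orP[a0|a0].
  by rewrite !ltNge !ltW // ba.
by rewrite a0 ab.
Qed.

(** True of all [v] in a neighbourhood of [u]. It is not symmetric: where [u] lies on one of the
    lines, nothing is asked of [v], which may fall on either side. *)
Definition close u v : Prop :=
  [/\ forall l, sgn_le (side l u) (side l v) /\ sgn_le (beyond l u) (beyond l v),
      sgn_le u.1 v.1, sgn_le u.2 v.2 & sgn_le (u.1 - u.2) (v.1 - v.2) /\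
      sgn_le (u.1 + u.2) (v.1 + v.2)].

Definition regular z : Prop := forall l, z <> cpt l.

Definition flips (b : letter -> bool) : seq letter :=
  [seq l <- [:: LT; LA; LB; LC] | b l].

(** Only one letter can satisfy [S], so all words involved are powers of a single involution and
    parities decide. *)
Lemma flips_eq (S b1 b2 b3 b4 : letter -> bool) :
  (forall l l', S l -> S l' -> l = l') ->
  (forall l, b1 l -> S l) -> (forall l, b2 l -> S l) ->
  (forall l, b3 l -> S l) ->
  (forall l, b1 l (+) b2 l = b3 l (+) b4 l) ->
  wact (flips b1 ++ flips b2) =1 wact (flips b3 ++ flips b4).
Proof.
move=> SS S1 S2 S3 E.
have S4 l : b4 l -> S l.
  move: (E l) (S1 l) (S2 l) (S3 l).
  by case: (b1 l) (b2 l) (b3 l) (b4 l) => [] [] [] [] //= _ H1 H2 H3 _; auto.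
have [l0 Sl0] : exists l0, forall l, S l -> l = l0.
  case: (boolP [exists l : 'I_4, S (nth LT [:: LT; LA; LB; LC] l)]).
    by move=> /existsP[k Sk]; eexists => l /SS; apply; exact: Sk.
  rewrite negb_exists => /forallP H; exists LT => l Sl.
  have [k lk] : exists k : 'I_4, l = nth LT [:: LT; LA; LB; LC] k.
    by case: l {Sl}; [exists (inord 0)|exists (inord 1)|exists (inord 2)|
      exists (inord 3)]; rewrite inordK.
  by move: (H k); rewrite -lk Sl.
have one (b : letter -> bool) : (forall l, b l -> S l) ->
    flips b = if b l0 then [:: l0] else [::].
  move=> bS; have bl l : b l = (l == l0) && b l0.
    apply/idP/idP => [bl|/andP[/eqP->]//].
    by have <- := Sl0 _ (bS _ bl); rewrite eqxx bl.
  rewrite /flips /= (bl LT) (bl LA) (bl LB) (bl LC).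
  by case: (l0); case: (b _).
move=> s; rewrite !one //; move: (E l0).
by case: (b1 l0) (b2 l0) (b3 l0) (b4 l0) => [] [] [] [] //= _;
  rewrite letter_actK.
Qed.

Hypothesis par : good_params.

Lemma cross_sector l u v : close u v -> cross l u v -> sector l u.
Proof.
move=> [/(_ l)[sl _] _ _ _] /andP[b]; case: eqVneq => // /eqP ne _.
have {ne sl} s0 : side l u = 0.
  by apply/eqP; apply: contra_notT ne => s0; rewrite (sgn_le_ge0 sl s0).
case: par => _ [h1 h2 h3 h4] [g1 g2 g3 g4] [k1 k2 k3 k4].
by case: l b s0; rewrite /side /beyond [sector _ _]/=; case: u => x y; cbn [fst snd] => b s0;
  apply/andP; split; move: (cpt LA) (cpt LB) g1 g2 g3 g4 k1 k2 k3 k4 b s0 => [x1 y1] [x2 y2];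
  cbn [fst snd]; lra.
Qed.

(** Off the line of the cut nothing is crossed near [z]. On the line, regularity keeps [z] away from
    the end point, so [beyond] has the same sign at [z] and [u], and the changes of side add up. *)
Lemma cross_trans l z u v : regular z -> close z u -> close z v ->
  cross l z v (+) false = cross l z u (+) cross l u v.
Proof.
move=> zr [/(_ l)[su bu] _ _ _] [/(_ l)[sv bv] _ _ _]; rewrite addbF /cross.
case: (eqVneq (side l z) 0) => s0; last first.
  by rewrite (sgn_le_ge0 su s0) (sgn_le_ge0 sv s0) eqxx !andbF.
have b0 : beyond l z != 0.
  apply/eqP => b0; apply: (zr l); case: z s0 b0 {zr su sv bu bv} => x y.
  rewrite [(x, y)]surjective_pairing [cpt l]surjective_pairing.
  case: l; rewrite /side /beyond; cbn [fst snd];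
    try (move: (cpt LA)); try (move: (cpt LB)) => *; congr (_, _);
    rewrite /cpt; cbn [fst snd]; lra.
rewrite (sgn_le_gt0 bu b0) s0 lexx.
by case: (0 < beyond l z); case: (0 <= side l u); case: (0 <= side l v).
Qed.

End Plane.

(** * Strips between the cuts and their preimages *)

Section Strips.
Variable R : realType.

Lemma sgn_le_addl (a b c : R) : sgn_le (a - c) (b - c) ->
  (a < c -> b < c) /\ (c < a -> c < b).
Proof. by case; rewrite !subr_gt0 !subr_lt0; split. Qed.

(** Common form of the cases t, a and c. A horizontal cut has as preimage an arc of the hyperbola X
    Y = A B ending at (A, B), where a vertical cut starts as well; the strip lies between them.
    Membership changes exactly when one of the two is crossed, and [h] selects the arc at (A, B)
    rather than the opposite one. *)
Lemma hyperbola_strip_flip (A B X Y X' Y' : R) (s s' h : bool) :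
  A < 0 -> 0 < B -> ~ (X = A /\ Y = B) ->
  (X < A -> ~~ s /\ ~~ s') -> (A < X -> s /\ s') ->
  sgn_le Y Y' -> sgn_le (X * Y - A * B) (X' * Y' - A * B) ->
  (0 < Y -> X < 0 -> h) -> (Y < 0 -> 0 < X -> ~~ h) ->
  [&& 0 < Y, s & X * Y < A * B] (+)
    [&& X * X - Y * Y < A * A - B * B,
        (A * B <= X * Y) != (A * B <= X' * Y') & h] =
  ((B < Y) && (s != s')) (+) [&& 0 < Y', s' & X' * Y' < A * B].
Proof.
move=> A0 B0 ne sl sg [Yp Yn] /sgn_le_addl[Pl Pg] hT hF.
have AB0 : A * B < 0 by rewrite nmulr_rlt0.
case: (ltgtP X A) sl sg ne => [XA /(_ isT)[/negbTE-> /negbTE->] _ _ |XA _ /(_ isT)[-> ->] _ |XA _ _ ne].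
- rewrite /= !andbF /=; apply/negbTE.
  case: (ltgtP (X * Y) (A * B)) => [P|P|P].
  + by rewrite leNgt (Pl P) /= andbF.
  + by rewrite (ltW (Pg P)) andbF.
  + have Y0 : 0 < Y by nra.
    have YB : Y < B by nra.
    suff -> : (X * X - Y * Y < A * A - B * B) = false by [].
    by apply/negbTE; rewrite -leNgt; nra.
- rewrite eqxx andbF addFb /=.
  case: (ltgtP (X * Y) (A * B)) => [P|P|P].
  + rewrite (Pl P) (leNgt _ (X' * _)) (Pl P) /= andbF addbF !andbT.
    case: (ltgtP 0 Y) => [Y0|Y0|Y0]; first by rewrite Yp.
      by apply/esym/negbTE; rewrite -leNgt ltW // Yn.
    by exfalso; nra.
  + by rewrite (ltW (Pg P)) /= !andbF (ltNge (X' * _)) (ltW (Pg P)) /= !andbF.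
  + rewrite !andbF /= -ltNge.
    case: (ltgtP 0 Y) => [Y0|Y0|Y0].
    * have X0 : X < 0 by nra.
      rewrite Yp // hT // andbT /= .
      suff -> : X * X - Y * Y < A * A - B * B by [].
      have YB : B < Y by nra.
      by nra.
    * have X0 : 0 < X by nra.
      by rewrite (negbTE (hF Y0 X0)) !andbF (ltNge 0 Y') (ltW (Yn Y0)).
    * by exfalso; nra.
- have YB : Y != B by apply/eqP => YB; apply: ne.
  case: (ltgtP B Y) YB => // [BY|BY] _.
    have P : X * Y < A * B by rewrite XA; nra.
    rewrite !(leNgt (A * B)) P (Pl P) /= andbF addbF !andbT.
    by rewrite Yp (lt_trans B0 BY) //; case: s; case: s'.
  have P : A * B < X * Y by rewrite XA; nra.
  by rewrite !(ltNge _ (A * B)) (ltW P) (ltW (Pg P)) /= !andbF.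
Qed.

(** The analogue for b: the cut at -c is vertical, so its preimage lies on x^2 - y^2 = D, and the
    cut at (x2, y2) is horizontal. *)
Lemma diagonal_strip_flip (x2 y2 D x y x' y' : R) (h : bool) :
  0 < x2 -> y2 < 0 -> 0 < D -> x2 * x2 - y2 * y2 = D ->
  ~ (x = x2 /\ y = y2) -> sgn_le x x' -> sgn_le (y - y2) (y' - y2) ->
  sgn_le (x * x - y * y - D) (x' * x' - y' * y' - D) ->
  (- x < y -> y < x -> h) -> (x < y -> x < - y -> ~~ h) ->
  [&& 0 < x, y < y2 & D <= x * x - y * y] (+)
    [&& x * y < x2 * y2,
        (D <= x * x - y * y) != (D <= x' * x' - y' * y') & h] =
  ((x2 < x) && ((y2 <= y) != (y2 <= y'))) (+)
    [&& 0 < x', y' < y2 & D <= x' * x' - y' * y'].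
Proof.
move=> x20 y20 D0 DE ne [xp xn] /sgn_le_addl[yl yg] /sgn_le_addl[Sl Sg] hT hF.
set S := x * x - y * y in Sl Sg *; set S' := x' * x' - y' * y' in Sl Sg *.
case: (ltgtP y y2) yl yg => [yy /(_ isT) yl _|yy _ /(_ isT) yg|yy _ _].
- rewrite (leNgt y2 y') yl /= andbF.
  case: (ltgtP D S) Sl Sg => [DS _ /(_ isT) Sg|DS /(_ isT) Sl _|DS _ _].
  + rewrite (ltW Sg) /= andbF addbF !andbT.
    case: (ltgtP 0 x) => [x0|x0|x0]; first by rewrite xp.
      by rewrite [RHS]ltNge ltW // xn.
    by exfalso; rewrite /S -x0 in DS; nra.
  + by rewrite leNgt Sl /= !andbF.
  + rewrite andbT; case: (ltgtP 0 x) => [x0|x0|x0].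
    * rewrite xp // hT; [|rewrite /S in DS; nra..].
      have xx : x2 < x by rewrite /S in DS; nra.
      have -> : x * y < x2 * y2 by nra.
      by rewrite /= andbT; case: (D <= S').
    * have -> : (0 < x') = false by rewrite ltNge ltW // xn.
      by rewrite (negbTE (hF _ _)) ?andbF //; rewrite /S in DS; nra.
    * by exfalso; rewrite /S -x0 in DS; nra.
- rewrite (ltNge y') (ltW yg) /= !andbF /=.
  case: (ltgtP D S) Sl Sg => [DS _ /(_ isT) Sg|DS /(_ isT) Sl _|DS _ _].
  + by rewrite (ltW Sg) /= andbF.
  + by rewrite leNgt Sl /= andbF.
  + case: (ltgtP 0 x) => [x0|x0|x0].
    * suff -> : (x * y < x2 * y2) = false by [].
      apply/negbTE; rewrite -leNgt; rewrite /S in DS.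
      case: (leP 0 y) => y0; first by nra.
      have xx : x < x2 by nra.
      by nra.
    * by rewrite (negbTE (hF _ _)) ?andbF //; rewrite /S in DS; nra.
    * by exfalso; rewrite /S -x0 in DS; nra.
- rewrite yy /= andbF /= -ltNge.
  case: (ltgtP x2 x) => [xx|xx|xx].
  + have DS : D < S by rewrite /S yy; nra.
    rewrite (ltW DS) (ltW (Sg DS)) /= !andbF andbT xp ?(lt_trans x20 xx) //.
    by case: (y' < y2).
  + case: (ltgtP D S) Sl Sg => [DS _ /(_ isT) Sg|DS /(_ isT) Sl _|DS _ _].
    * rewrite (ltW Sg) /= andbF; have x0 : x < 0 by rewrite /S yy in DS; nra.
      by rewrite ltNge ltW // xn.
    * by rewrite leNgt Sl /= !andbF.
    * have x0 : x = - x2 by rewrite /S yy in DS; nra.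
      have -> : (x * y2 < x2 * y2) = false by apply/negbTE; rewrite -leNgt; nra.
      have x0' : x' < 0 by apply: xn; rewrite x0 oppr_lt0.
      by rewrite (ltNge 0 x') (ltW x0').
  + by exfalso; apply: ne.
Qed.

Variables (al be : R).
Hypothesis par : good_params al be.
Implicit Types (u v : R * R) (l : letter).

Local Notation cross := (cross al be).
Local Notation strip := (strip al be).
Local Notation cpt := (cpt al be).
Local Notation sq := (sq al be).
Local Notation close := (close al be).
Local Notation regular := (regular al be).

(* The section of the crossing word of [sq u] and [sq v] at [half u]. *)
Definition cross_sec l u v : bool :=
  match l with
  | LT => cross LA (sq u) (sq v) && ~~ half u
  | LA => cross LB (sq u) (sq v) && ~~ half u
  | LB => cross LC (sq u) (sq v) && half u
  | LC => cross LA (sq u) (sq v) && half u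
  end.

Lemma half_true u : u.2 < 0 -> 0 < u.1 -> half u.
Proof. by rewrite /half => *; case: ifP => _; lra. Qed.

Lemma half_false u : 0 < u.2 -> u.1 < 0 -> half u = false.
Proof.
by rewrite /half => *; apply/negbTE; case: ifP => _; rewrite -?leNgt -?ltNge; lra.
Qed.

Lemma crossAE x y x' y' : cross LA (sq (x, y)) (sq (x', y')) =
  (x * x - y * y < al * al - be * be) &&
  ((al * be <= x * y) != (al * be <= x' * y')).
Proof.
have H1 : (0 < beyond al be LA (sq (x, y))) = (x * x - y * y < al * al - be * be).
  by rewrite /=; apply/idP/idP; lra.
have H2 t r : (0 <= side al be LA (sq (t, r))) = (al * be <= t * r).
  by rewrite /=; apply/idP/idP; lra.
by rewrite /cross H1 !H2.
Qed.

Lemma sgn_le2 (a b a' b' : R) : sgn_le a b -> a = a' + a' -> b = b' + b' ->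
  sgn_le a' b'.
Proof. by case=> h1 h2 E1 E2; split; lra. Qed.

Lemma strip_flipT u v : regular u -> close u v -> close (sq u) (sq v) ->
  strip LT u (+) cross_sec LT u v = cross LT u v (+) strip LT v.
Proof.
case: u v => x y [x' y'] ur [/(_ LT)[sT bT] sx sy _] [/(_ LA)[sA _] _ _ _].
have [_ [_ a0 b0 ab]] := par; case: b0 ab => // b0 ab _ _.
rewrite /cross_sec crossAE -andbA /strip.
have -> : cross LT (x, y) (x', y') = (be < y) && ((al <= x) != (al <= x')).
  by rewrite /cross /= !subr_gt0 !subr_ge0.
have [xl xg] := sgn_le_addl sT.
apply: hyperbola_strip_flip => //.
- by lra.
- by case=> xE yE; apply: (ur LT); rewrite xE yE.
- by move=> /= xa; rewrite -!ltNge xl.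
- by move=> /= xa; rewrite !ltW ?xg.
- by apply: (sgn_le2 sA); rewrite /side /=; ring.
- by move=> y0 x0; rewrite half_false.
- by move=> y0 x0; rewrite negbK half_true.
Qed.

(** The reflection (X, Y) = (- y, - x) makes the cut to the left go up, so that
    [hyperbola_strip_flip] applies; for c the same is done by (- x, - y). *)
Lemma strip_flipA u v : regular u -> close u v -> close (sq u) (sq v) ->
  strip LA u (+) cross_sec LA u v = cross LA u v (+) strip LA v.
Proof.
case: u v => x y [x' y'] ur [/(_ LA)[sA bA] sx sy _] [/(_ LB)[sB _] _ _ _].
have [_ _ [_ g2 g3 g4] _] := par.
move: (ur LA); rewrite /cross_sec /strip.
have -> : cross LA (x, y) (x', y') =
    (- (cpt LA).1 < - x) && ((y < (cpt LA).2) != (y' < (cpt LA).2)).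
  rewrite /cross /beyond /side subr_gt0 !subr_ge0 ltrN2 !leNgt.
  by case: (_ < _); case: (_ < _); case: (_ < _).
have -> : cross LB (sq (x, y)) (sq (x', y')) =
    (- y * - y - - x * - x < - (cpt LA).2 * - (cpt LA).2 - - (cpt LA).1 * - (cpt LA).1) &&
    ((- (cpt LA).2 * - (cpt LA).1 <= - y * - x) != (- (cpt LA).2 * - (cpt LA).1 <= - y' * - x')).
  have H1 : (0 < beyond al be LB (sq (x, y))) = (- y * - y - - x * - x <
      - (cpt LA).2 * - (cpt LA).2 - - (cpt LA).1 * - (cpt LA).1).
    rewrite /beyond -[cpt LB]/(sq (cpt LA)); move: (cpt LA) => [x1 y1].
    by rewrite /sq; cbn [fst snd]; apply/idP/idP; lra.
  have H2 t r : (0 <= side al be LB (sq (t, r))) =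
      (- (cpt LA).2 * - (cpt LA).1 <= - r * - t).
    rewrite /side -[cpt LB]/(sq (cpt LA)); move: (cpt LA) => [x1 y1].
    by rewrite /sq; cbn [fst snd]; apply/idP/idP; lra.
  by rewrite /cross H1 !H2.
move=> ne; rewrite -andbA.
have -> : [&& x < 0, y < (cpt LA).2 & x * y < (cpt LA).1 * (cpt LA).2] =
    [&& 0 < - x, y < (cpt LA).2 & - y * - x < - (cpt LA).2 * - (cpt LA).1].
  by rewrite oppr_gt0 !mulrNN (mulrC y) (mulrC (cpt LA).2).
have -> : [&& x' < 0, y' < (cpt LA).2 & x' * y' < (cpt LA).1 * (cpt LA).2] =
    [&& 0 < - x', y' < (cpt LA).2 & - y' * - x' < - (cpt LA).2 * - (cpt LA).1].
  by rewrite oppr_gt0 !mulrNN (mulrC y') (mulrC (cpt LA).2).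
have [yl yg] := sgn_le_addl sA.
apply: hyperbola_strip_flip.
- by lra.
- by lra.
- move=> [yE xE]; apply: ne; rewrite [cpt LA]surjective_pairing.
  by congr (_, _); apply: oppr_inj.
- by rewrite ltrN2 => ya; rewrite -!leNgt !ltW // yg.
- by rewrite ltrN2 => ya; rewrite ya yl.
- by case: sx => /= xp xn; split; rewrite ?oppr_lt0 ?oppr_gt0.
- apply: (sgn_le2 sB); rewrite /side -[cpt LB]/(sq (cpt LA));
  by move: (cpt LA) => [x1 y1]; rewrite /sq; cbn [fst snd]; ring.
- by rewrite oppr_gt0 oppr_lt0 => x0 y0; rewrite half_false.
- by rewrite oppr_gt0 oppr_lt0 => x0 y0; rewrite negbK half_true.
Qed.

Lemma strip_flipC u v : regular u -> close u v -> close (sq u) (sq v) ->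
  strip LC u (+) cross_sec LC u v = cross LC u v (+) strip LC v.
Proof.
case: u v => x y [x' y'] ur [/(_ LC)[sC _] sx sy _] [/(_ LA)[sA _] _ _ _].
have [_ [_ a0 b0 ab] _ _] := par.
move: (ur LC); rewrite /cross_sec crossAE -andbA /strip.
have -> : cross LC (x, y) (x', y') = (be < - y) && ((x < - al) != (x' < - al)).
  have -> : (be < - y) = (0 < - be - y) by apply/idP/idP; lra.
  have H t : (t < - al) = ~~ (0 <= t + al) by rewrite -ltNge; apply/idP/idP; lra.
  rewrite !H /cross /beyond /side; cbn [fst snd].
  by case: (_ < _); case: (_ <= _); case: (_ <= _).
move=> ne; rewrite -(mulrNN x y) -(mulrNN x' y') -(mulrNN x x) -(mulrNN y y).
rewrite -(oppr_gt0 y) -(oppr_gt0 y').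
have sC' : sgn_le (x - - al) (x' - - al) by rewrite !opprK.
have [xl xg] := sgn_le_addl sC'.
apply: hyperbola_strip_flip.
- by lra.
- by lra.
- by case=> xE yE; apply: ne; congr (_, _); apply: oppr_inj; rewrite opprK.
- by move=> xa; have ax : - al < x by [lra]; rewrite -!leNgt !ltW // xg.
- by move=> xa; have ax : x < - al by [lra]; rewrite ax xl.
- by case: sy => /= yp yn; split; rewrite ?oppr_lt0 ?oppr_gt0.
- by rewrite !mulrNN; apply: (sgn_le2 sA); rewrite /side /=; ring.
- by rewrite oppr_gt0 oppr_lt0 => y0 x0; rewrite half_true.
- by rewrite oppr_gt0 oppr_lt0 => y0 x0; rewrite half_false.
Qed.

(** The preimage of the upward ray at c is the diagonal x = y. The half-open choices in [half] on
    its two rays are made to match [0 <= side] for [LT]. *)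
Lemma half_flip u v : u != (0, 0) -> close u v -> close (sq u) (sq v) ->
  half v = half u (+) cross LT (sq u) (sq v).
Proof.
case: u v => x y [x' y'] u0 [_ [xp xn] [yp yn] [[dp dn] [ep en]]] [/(_ LT)[sT _] _ _ _].
have -> : cross LT (sq (x, y)) (sq (x', y')) =
    (0 < x * y) && ((0 <= (x - y) * (x + y)) != (0 <= (x' - y') * (x' + y'))).
  have H1 : (0 < beyond al be LT (sq (x, y))) = (0 < x * y).
    by rewrite /=; apply/idP/idP; lra.
  have H2 t r : (0 <= side al be LT (sq (t, r))) = (0 <= (t - r) * (t + r)).
    by rewrite /=; apply/idP/idP; lra.
  by rewrite /cross H1 !H2.
rewrite /half; move: xp xn yp yn dp dn ep en => /= xp xn yp yn dp dn ep en.
case: (ltP 0 (x * y)) => xy /=.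
  case: (ltgtP 0 (x + y)) => s0.
  - rewrite (ep s0) -[y <= x]subr_ge0 -[y' <= x']subr_ge0.
    rewrite !pmulr_lge0 // ?ep //.
    by case: (0 <= _); case: (0 <= _).
  - have s0' := en s0; rewrite ltNge ltW //= -[y < x]subr_gt0 -[y' < x']subr_gt0.
    by rewrite !nmulr_lge0 // !(leNgt _ 0); case: (0 < _); case: (0 < _).
  - by exfalso; nra.
rewrite addbF; case: (ltgtP 0 (x - y)) => d0.
- have d0' := dp d0; move: d0 d0'; rewrite !subr_gt0 => d0 d0'.
  by rewrite !d0 !d0' !ltW // !if_same.
- have d0' := dn d0; move: d0 d0'; rewrite !subr_lt0 => d0 d0'.
  by rewrite !(leNgt _ x) !(leNgt _ x') !(ltNge _ x) !(ltNge _ x') ?(ltW d0) ?(ltW d0') ?d0 ?d0' !if_same.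
- exfalso; move/eqP: u0; apply; have xE : x = y by lra.
  by rewrite -xE in xy *; have -> : x = 0 by nra.
Qed.

Lemma cptB_sq : (cpt LB).1 * (cpt LB).1 - (cpt LB).2 * (cpt LB).2 = - al *+ 2 /\
  (cpt LB).1 * (cpt LB).2 = - be.
Proof.
have [sqB _ _ _] := par.
move: (congr1 fst sqB) (congr1 snd sqB).
by move: (cpt LB) => [x2 y2] /= *; split; lra.
Qed.

Lemma strip_flipB u v : regular u -> close u v -> close (sq u) (sq v) ->
  strip LB u (+) cross_sec LB u v = cross LB u v (+) strip LB v.
Proof.
case: u v => x y [x' y'] ur [/(_ LB)[sB bB] sx sy _] [/(_ LC)[sC _] _ _ _].
have [_ [_ a0 _ _] _ [g1 g2 g3 g4]] := par.
have [DE PE] := cptB_sq; move: (ur LB); rewrite /cross_sec /strip.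
have -> : cross LB (x, y) (x', y') =
    ((cpt LB).1 < x) && (((cpt LB).2 <= y) != ((cpt LB).2 <= y')).
  by rewrite /cross /beyond /side subr_gt0 !subr_ge0.
have -> : cross LC (sq (x, y)) (sq (x', y')) = (x * y < (cpt LB).1 * (cpt LB).2) &&
    ((- al *+ 2 <= x * x - y * y) != (- al *+ 2 <= x' * x' - y' * y')).
  have H1 : (0 < beyond al be LC (sq (x, y))) = (x * y < (cpt LB).1 * (cpt LB).2).
    by rewrite PE; rewrite /=; apply/idP/idP; lra.
  have H2 t r : (0 <= side al be LC (sq (t, r))) = (- al *+ 2 <= t * t - r * r).
    by rewrite /=; apply/idP/idP; lra.
  by rewrite /cross H1 !H2.
move=> ne; rewrite -andbA; apply: diagonal_strip_flip => //.
- by lra.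
- by case=> xE yE; apply: ne; rewrite xE yE -surjective_pairing.
- by case: sC => /= h1 h2; split=> h; lra.
- by rewrite /half => *; case: ifP => _ /=; lra.
- by rewrite /half => *; case: ifP => _ /=; rewrite -?leNgt -?ltNge; lra.
Qed.

Lemma strip_flip l u v : regular u -> close u v -> close (sq u) (sq v) ->
  strip l u (+) cross_sec l u v = cross l u v (+) strip l v.
Proof.
case: l; [exact: strip_flipT|exact: strip_flipA|exact: strip_flipB|].
exact: strip_flipC.
Qed.

Lemma strip_sector l u : strip l u -> sector l u.
Proof.
have [_ [_ a0 b0 ab] [_ _ g3 g4] [k1 _ k3 k4]] := par; have [DE _] := cptB_sq.
case: u => x y; rewrite /strip; case: l => /and3P[h1 h2 h3]; rewrite [sector _ _]/=.
- have x0 : x < 0 by nra.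
  have yb : be < y by nra.
  by apply/andP; split; lra.
- have y0 : 0 < y by nra.
  have x1 : x < (cpt LA).1 by nra.
  by apply/andP; split; lra.
- move: (cpt LB) k1 k3 k4 h2 DE => [x2 y2]; cbn [fst snd] => k1 k3 k4 h2 DE.
  have xx : x2 < x by nra.
  by apply/andP; split; nra.
- have x0 : 0 < x by nra.
  have yb : y < - be by nra.
  by apply/andP; split; lra.
Qed.

Lemma cross_side0 l u v : close u v -> cross l u v ->
  side al be l u = 0 /\ 0 < beyond al be l u.
Proof.
case=> /(_ l)[sl _] _ _ _ /andP[b]; case: eqVneq => // /eqP ne _; split=> //.
by apply/eqP; apply: contra_notT ne => s0; rewrite (sgn_le_ge0 sl s0).
Qed.

End Strips.

Section Strip_transport.
Variables (R : realType) (al be : R).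
Hypothesis par : good_params al be.
Implicit Types (u v : R * R) (l : letter).

Local Notation cross := (cross al be).
Local Notation strip := (strip al be).
Local Notation cpt := (cpt al be).
Local Notation sq := (sq al be).
Local Notation close := (close al be).
Local Notation regular := (regular al be).
Local Notation cross_sec := (cross_sec al be).

Lemma sqr_lt_bounds (a b : R) : 0 < b -> a * a < b * b -> - b < a /\ a < b.
Proof. by move=> b0 ab; split; nra. Qed.

(** By [cross_side0] such a [u] lies on a lifted cut; the equation of this curve and [half] locate
    the sector. *)
Lemma cross_sec_sector l u v : close (sq u) (sq v) ->
  cross_sec l u v -> sector l u.
Proof.
move=> c; have [_ [_ a0 b0 ab] [_ g2 g3 g4] [k1 _ k3 k4]] := par.
have [DE PE] := cptB_sq par.
case: u v c => x y [x' y'] c; case: l => /andP[/(cross_side0 c)[s0 b1] h1];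
  rewrite [sector _ _]/=.
- move: s0 b1 => /= s0 b1; case: (ltP 0 y) => y0; last first.
    have x0 : 0 < x by nra.
    by rewrite half_true in h1 => //=; nra.
  have x0 : x < 0 by nra.
  have S : x * x < y * y by nra.
  by have [? ?] := sqr_lt_bounds y0 S; apply/andP.
- move: s0 b1; rewrite /side /beyond -[cpt LB]/(sq (cpt LA)).
  move: (cpt LA) g2 g3 g4 => [x1 y1]; rewrite /sq; cbn [fst snd] => g2 g3 g4 s0 b1.
  have x1y1 : x1 * y1 < 0 by nra.
  case: (ltP 0 y) => y0; last first.
    have x0 : 0 < x by nra.
    by rewrite half_true in h1 => //=; nra.
  have x0 : x < 0 by nra.
  have xy1 : y1 * y1 < x1 * x1 by nra.
  have S : y * y < - x * - x by nra.
  have nx : 0 < - x by lra.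
  have [? ?] := sqr_lt_bounds nx S.
  by apply/andP; split; lra.
- move: s0 b1 => /= s0 b1; case: (ltP 0 y) => y0.
    have x0 : x < 0 by nra.
    by rewrite half_false in h1.
  have y1 : y < 0.
    by rewrite lt_neqAle y0 andbT; apply/eqP => yE; rewrite yE in s0 b1; nra.
  have x0 : 0 < x by nra.
  have S : y * y < x * x by nra.
  by have [? ?] := sqr_lt_bounds x0 S; apply/andP; split; lra.
- move: s0 b1 => /= s0 b1; case: (ltP 0 y) => y0.
    have x0 : x < 0 by nra.
    by rewrite half_false in h1.
  have y1 : y < 0.
    by rewrite lt_neqAle y0 andbT; apply/eqP => yE; rewrite yE in s0 b1; nra.
  have x0 : 0 < x by nra.
  have S : x * x < - y * - y by nra.
  have ny : 0 < - y by lra.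
  have [? ?] := sqr_lt_bounds ny S.
  by apply/andP; split; lra.
Qed.

(** Infinitesimal form of the relation between a path and its lift: the crossings of the image,
    passed through the section, are those of the lift up to the corrections at both points. *)
Lemma strip_transport u v : regular u -> close u v -> close (sq u) (sq v) ->
  wact (flips (strip^~ u) ++ flips (fun l => cross_sec l u v)) =1
  wact (flips (fun l => cross l u v) ++ flips (strip^~ v)).
Proof.
move=> ur c cs.
apply: (@flips_eq (fun l => sector l u) (strip^~ u)
  (fun l => cross_sec l u v) (fun l => cross l u v) (strip^~ v)).
- by move=> l l'; exact: sector_inj.
- by move=> l; exact: (strip_sector par).
- by move=> l; exact: cross_sec_sector cs.
- by move=> l; exact: (cross_sector par).
- by move=> l; exact: (strip_flip par).
Qed.

Lemma cross_transport z u v : regular z -> close z u -> close z v ->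
  wact (flips (fun l => cross l z v)) =1
  wact (flips (fun l => cross l z u) ++ flips (fun l => cross l u v)).
Proof.
move=> zr zu zv s.
rewrite -[X in wact X s = _]cats0.
apply: (@flips_eq (fun l => sector l z) (fun l => cross l z v) (fun=> false)
  (fun l => cross l z u) (fun l => cross l u v)) => //.
- by move=> l l'; exact: sector_inj.
- by move=> l; exact: (cross_sector par).
- by move=> l; exact: (cross_sector par).
- by move=> l; exact: cross_trans.
Qed.

Lemma cross_flips z u : close z u ->
  exists l, flips (fun l => cross l z u) = if cross l z u then [:: l] else [::].
Proof.
move=> zu.
case: (boolP [|| cross LT z u, cross LA z u, cross LB z u | cross LC z u]).
  move=> H; have [l lz] : exists l, cross l z u.
    by case/or4P: H => H; [exists LT|exists LA|exists LB|exists LC].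
  exists l; rewrite lz /flips.
  have E l' : cross l' z u = (l' == l).
    apply/idP/eqP => [H'|->//].
    by apply: (@sector_inj _ z); exact: (cross_sector par zu).
  by rewrite /= !E; case: (l).
rewrite !negb_or => /and4P[/negbTE H1 /negbTE H2 /negbTE H3 /negbTE H4].
by exists LT; rewrite /flips /= H1 H2 H3 H4.
Qed.

Lemma sec_cross_flips u v : close (sq u) (sq v) ->
  odd (count_mem LT (flips (fun l => cross l (sq u) (sq v)))) =
    cross LT (sq u) (sq v) /\
  sec (half u) (flips (fun l => cross l (sq u) (sq v))) =
    flips (fun l => cross_sec l u v).
Proof.
move=> c; have [l] := cross_flips c; rewrite /flips /cross_sec /=.
by case: l; case: (cross LT _ _); case: (cross LA _ _); case: (cross LB _ _);
  case: (cross LC _ _) => //= _; case: (half u).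
Qed.

End Strip_transport.

(** * The parameter *)

Section Root_nearby.
Variable F : numClosedFieldType.
Implicit Types (P : {poly F}) (z e a : F) (r : seq F).

(** The logarithmic derivative at [z] is the sum of 1 / (z - y) over the roots, each term of modulus
    at most 1 / e; here denominators are cleared. *)
Lemma logderiv_le r a z e : 0 <= e -> {in r, forall y, e <= `|z - y|} ->
  let P := a *: \prod_(y <- r) ('X - y%:P) in
  e * `|P^`().[z]| <= (size r)%:R * `|P.[z]|.
Proof.
move=> e0 H /=; rewrite derivZ !hornerZ !normrM [e * _]mulrCA [_ * (`|a| * _)]mulrCA.
apply: ler_wpM2l => //; elim: r H => [|y r IHr] H.
  by rewrite big_nil derivC horner0 normr0 mulr0 mul0r.
have yz := H _ (mem_head _ _).
have := IHr (fun x xr => H x (mem_behead (s := y :: r) xr)).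
rewrite big_cons derivM derivB derivX derivC subr0 mul1r hornerD !hornerM.
rewrite hornerXsubC; set v := _.[z]; set u := _.[z] => IH.
apply: le_trans (_ : e * (`|u| + `|z - y| * `|v|) <= _).
  by apply: ler_wpM2l => //; rewrite -normrM; exact: ler_normD.
rewrite mulrDr normrM [size _]/= -natr1 mulrDl mul1r addrC lerD //.
  by rewrite mulrCA [leRHS]mulrCA ler_wpM2l.
by rewrite ler_wpM2r.
Qed.

Lemma root_nearby P z e : 0 < e -> (size P <= 7)%N ->
  6 * `|P.[z]| < e * `|P^`().[z]| -> exists2 y, root P y & `|z - y| < e.
Proof.
move=> e0 sP; have [r PE] := closed_field_poly_normal P.
have [P0|P0] := eqVneq P 0.
  by rewrite P0 derivC horner0 normr0 !mulr0 ltxx.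
have sr : (size r <= 6)%N.
  by move: sP; rewrite PE size_scale ?lead_coef_eq0 // size_prod_XsubC.
case: (pselect (exists2 y, y \in r & `|z - y| < e)) => [[y yr ze] _|H].
  by exists y => //; rewrite PE rootZ ?lead_coef_eq0 // root_prod_XsubC.
have H' : {in r, forall y, e <= `|z - y|}.
  move=> y yr.
  have [//|ze] := real_leP (gtr0_real e0) (normr_real (z - y)).
  by case: H; exists y.
have := logderiv_le (lead_coef P) (ltW e0) H'; rewrite /= -PE => le1.
move=> /lt_le_trans/(_ le1); 
have le2 : (size r)%:R * `|P.[z]| <= 6 * `|P.[z]| by rewrite ler_wpM2r ?ler_nat.
by move=> /lt_le_trans/(_ le2); rewrite ltxx.
Qed.

End Root_nearby.

Section Misiurewicz.
Variable R : realType.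
Local Notation C := R[i].

(** The condition that the third iterate of c be -c is c (c + 2) times this polynomial; the roots 0
    and -2 have shorter critical orbits. *)
Definition misiurewicz_poly : {poly C} := Poly [:: 1; 0; 1; 2; 2; 2; 1].

Lemma misiurewicz_polyE (z : C) : misiurewicz_poly.[z] =
  1 + z ^+ 2 + 2 * z ^+ 3 + 2 * z ^+ 4 + 2 * z ^+ 5 + z ^+ 6.
Proof. by rewrite horner_Poly /=; ring. Qed.

Lemma misiurewicz_derivE (z : C) : misiurewicz_poly^`().[z] =
  2 * z + 6 * z ^+ 2 + 8 * z ^+ 3 + 10 * z ^+ 4 + 6 * z ^+ 5.
Proof.
rewrite /misiurewicz_poly /= !cons_poly_def !derivMXaddC.
by rewrite !(hornerD, hornerM, hornerX, hornerC, deriv0, horner0); ring.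
Qed.

Lemma mulC_complex (a b c d : R) :
  (Complex a b * Complex c d : C) = Complex (a * c - b * d) (a * d + b * c).
Proof. by []. Qed.

(** A rational approximation of the root. Numerators below are written in base 1000, which keeps the
    numerals small. *)
Let z : C := Complex (- 7 / 45) (50 / 45).

Lemma misiurewicz_eval :
  misiurewicz_poly.[z] =
    Complex (((65 * 1000 + 788) * 1000 + 569) / 45 / 45 / 45 / 45 / 45 / 45)
    (- ((20 * 1000 + 999) * 1000 + 600) / 45 / 45 / 45 / 45 / 45 / 45) /\
  misiurewicz_poly^`().[z] =
    Complex (((669 * 1000 + 130) * 1000 + 8) / 45 / 45 / 45 / 45 / 45)
    ((((1 * 1000 + 176) * 1000 + 639) * 1000) / 45 / 45 / 45 / 45 / 45).
Proof.
have z2 : z ^+ 2 =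
    Complex (- (2 * 1000 + 451) / 45 / 45)
    (- 700 / 45 / 45).
  by rewrite exprSr expr1 mulC_complex; congr Complex; lra.
have z3 : z ^+ 3 =
    Complex ((52 * 1000 + 157) / 45 / 45 / 45)
    (- (117 * 1000 + 650) / 45 / 45 / 45).
  by rewrite exprSr z2 mulC_complex; congr Complex; lra.
have z4 : z ^+ 4 =
    Complex (((5 * 1000 + 517) * 1000 + 401) / 45 / 45 / 45 / 45)
    (((3 * 1000 + 431) * 1000 + 400) / 45 / 45 / 45 / 45).
  by rewrite exprSr z3 mulC_complex; congr Complex; lra.
have z5 : z ^+ 5 =
    Complex (- ((210 * 1000 + 191) * 1000 + 807) / 45 / 45 / 45 / 45 / 45)
    (((251 * 1000 + 850) * 1000 + 250) / 45 / 45 / 45 / 45 / 45).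
  by rewrite exprSr z4 mulC_complex; congr Complex; lra.
have z6 : z ^+ 6 =
    Complex (- (((11 * 1000 + 121) * 1000 + 169) * 1000 + 851) / 45 / 45 / 45 / 45 / 45 / 45)
    (- (((12 * 1000 + 272) * 1000 + 542) * 1000 + 100) / 45 / 45 / 45 / 45 / 45 / 45).
  by rewrite exprSr z5 mulC_complex; congr Complex; lra.
have qE : misiurewicz_poly.[z] =
    Complex (((65 * 1000 + 788) * 1000 + 569) / 45 / 45 / 45 / 45 / 45 / 45)
    (- ((20 * 1000 + 999) * 1000 + 600) / 45 / 45 / 45 / 45 / 45 / 45).
  rewrite misiurewicz_polyE z2 z3 z4 z5 z6; apply/eqP; rewrite eq_complex /=.
  by apply/andP; split; apply/eqP; lra.
have dE : misiurewicz_poly^`().[z] =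
    Complex (((669 * 1000 + 130) * 1000 + 8) / 45 / 45 / 45 / 45 / 45)
    ((((1 * 1000 + 176) * 1000 + 639) * 1000) / 45 / 45 / 45 / 45 / 45).
  rewrite misiurewicz_derivE z2 z3 z4 z5; apply/eqP; rewrite eq_complex /=.
  by apply/andP; split; apply/eqP; lra.
split=> //.
Qed.

End Misiurewicz.

Section Misiurewicz_root.
Variable R : realType.
Local Notation C := R[i].

Lemma misiurewicz_root : exists2 c : C, root (misiurewicz_poly R) c &
  `|complex.Re c + 7 / 45| < 1 / 100 /\ `|complex.Im c - 50 / 45| < 1 / 100.
Proof.
pose z : C := Complex (- 7 / 45) (50 / 45).
have [qE dE] := misiurewicz_eval R.
have norm_lt (x : C) e : `|x| < (e%:C)%C -> `|complex.Re x| < e /\ `|complex.Im x| < e.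
  move=> xe; split; rewrite -ltcR; apply: le_lt_trans xe; first exact: normc_ge_Re.
  by rewrite normc_def lecR -sqrtr_sqr ler_wsqrtr // lerDr sqr_ge0.
have e0 : 0 <= (1 / 100 : R) by lra.
have [| | |c c0 /norm_lt[cr ci]] := @root_nearby C (misiurewicz_poly R) z (1 / 100)%:C%C.
- by rewrite ltcR; lra.
- exact: size_Poly.
(* Squaring replaces the complex norms by sums of squares of rational numbers. *)
- rewrite -(@ltr_pXn2r _ 2) ?nnegrE ?(normr_ge0, mulr_ge0, ler0c, e0) //.
  rewrite !exprMn qE dE -!add_Re2_Im2; cbn [complex.Re complex.Im].
  rewrite (_ : 6 ^+ 2 = ((36 : R)%:C)%C); last by rewrite -natrX rmorph_nat.
  by rewrite -!rmorphXn -!rmorphM ltcR; lra.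
exists c => //; split; rewrite -normrN.
  suff -> : - (complex.Re c + 7 / 45) = complex.Re (z - c) by [].
  by rewrite /z; case: (c) => p q /=; ring.
suff -> : - (complex.Im c - 50 / 45) = complex.Im (z - c) by [].
by rewrite /z; case: (c) => p q /=; ring.
Qed.

Lemma misiurewicz_relation (c : C) : root (misiurewicz_poly R) c ->
  ((c ^+ 2 + c) ^+ 2 + c) ^+ 2 + c = - c.
Proof.
move/rootP; rewrite misiurewicz_polyE => c0; apply/eqP; rewrite -subr_eq0.
by apply/eqP; rewrite -[RHS](mulr0 (c * (c + 2))) -c0; ring.
Qed.

Lemma sq_complex (a b x y : R) :
  (Complex x y) ^+ 2 + Complex a b =
  Complex (sq a b (x, y)).1 (sq a b (x, y)).2 :> C.
Proof.
by rewrite expr2 mulC_complex; apply/eqP; rewrite eq_complex /= [y * x]mulrC !eqxx.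
Qed.

Lemma param_bounds1 (al be : R) :
  - (1 / 6) < al -> al < - (1 / 7) -> 11 / 10 < be -> be < 9 / 8 ->
  [/\ - (10 / 7) < al * al - be * be + al, al * al - be * be + al < - (13 / 10),
      7 / 10 < al * be + al * be + be & al * be + al * be + be < 5 / 6].
Proof.
move=> a1 a2 b1 b2.
have aa1 : 1 / 7 * (1 / 7) < al * al by nra.
have aa2 : al * al < 1 / 6 * (1 / 6) by nra.
have bb1 : 11 / 10 * (11 / 10) < be * be by nra.
have bb2 : be * be < 9 / 8 * (9 / 8) by nra.
have ab1 : - (1 / 6 * (9 / 8)) < al * be by nra.
have ab2 : al * be < - (1 / 7 * (11 / 10)) by nra.
by split; lra.
Qed.

Lemma param_bounds2 (al be x y : R) :
  - (1 / 6) < al -> al < - (1 / 7) -> be < 9 / 8 ->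
  - (10 / 7) < x -> x < - (13 / 10) -> 7 / 10 < y -> y < 5 / 6 ->
  [/\ 0 < x * x - y * y + al, x * x - y * y + al < 3 & x * y + x * y + be < 0].
Proof.
move=> a1 a2 b2 x1 x2 y1 y2.
have xx1 : 13 / 10 * (13 / 10) < x * x by nra.
have xx2 : x * x < 3 by nra.
have yy1 : 0 < y * y by nra.
have yy2 : y * y < 5 / 6 * (5 / 6) by nra.
have xy2 : x * y < - (13 / 10 * (7 / 10)) by nra.
by split; lra.
Qed.

Lemma good_params_exist : exists al be : R, good_params al be.
Proof.
have [[al be] c0 []] := misiurewicz_root.
cbn [complex.Re complex.Im].
rewrite !ltr_norml => /andP[a1 a2] /andP[b1 b2].
have {}a1 : - (1 / 6) < al by lra.
have {}a2 : al < - (1 / 7) by lra.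
have {}b1 : 11 / 10 < be by lra.
have {}b2 : be < 9 / 8 by lra.
have [x1 x2 y1 y2] := param_bounds1 a1 a2 b1 b2.
have [u1 u2 v1] := param_bounds2 a1 a2 b2 x1 x2 y1 y2.
have := misiurewicz_relation c0.
rewrite (sq_complex al be al be) (sq_complex al be) (sq_complex al be).
rewrite -!surjective_pairing => -[r1 r2].
have sqB : sq al be (cpt al be LB) = cpt al be LC.
  by rewrite [LHS]surjective_pairing; congr (_, _); [exact: r1|exact: r2].
have {}x1 : - (10 / 7) < (cpt al be LA).1 := x1.
have {}x2 : (cpt al be LA).1 < - (13 / 10) := x2.
have {}y1 : 7 / 10 < (cpt al be LA).2 := y1.
have {}y2 : (cpt al be LA).2 < 5 / 6 := y2.
have {}u1 : 0 < (cpt al be LB).1 := u1.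
have {}u2 : (cpt al be LB).1 < 3 := u2.
have {}v1 : (cpt al be LB).2 < 0 := v1.
have r : (cpt al be LB).1 * (cpt al be LB).1 - (cpt al be LB).2 * (cpt al be LB).2 +
    al = - al := congr1 fst sqB.
exists al, be; split => //.
- by clear -a1 a2 b1 b2; split; lra.
- by clear -x1 x2 y1 y2; move: (cpt al be LA).1 (cpt al be LA).2 x1 x2 y1 y2 => x y *; split; lra.
- clear -u1 u2 v1 r a2; move: (cpt al be LB).1 (cpt al be LB).2 u1 u2 v1 r => x y u1 u2 v1 r.
  by split=> //; nra.
Qed.

End Misiurewicz_root.

(** * Transport and lifting of paths *)

Section Paths.
Variable R : realType.
Implicit Types (s d : R) (f g : R -> R) (p q : R -> R * R) (Q : R -> Prop).

Definition near01 s Q : Prop := \forall t \near within `[0, 1] (nbhs s), Q t.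

Lemma near01P s Q : near01 s Q <->
  exists2 d, 0 < d & forall t, 0 <= t <= 1 -> `|t - s| < d -> Q t.
Proof.
rewrite /near01 /within /=; split.
  move=> /nbhs_ballP[d /= d0 H]; exists d => // t t01 td.
  by apply: H => //; rewrite -ball_normE /ball_ /= distrC.
move=> [d d0 H]; apply/nbhs_ballP; exists d => //= t td t01; apply: H => //.
by move: td; rewrite -ball_normE /ball_ /= distrC.
Qed.

Lemma near01_and s Q Q' : near01 s Q -> near01 s Q' ->
  near01 s (fun t => Q t /\ Q' t).
Proof.
move=> /near01P[d d0 H] /near01P[d' d'0 H']; apply/near01P.
exists (Num.min d d') => [|t t01]; first by rewrite lt_min d0.
by rewrite lt_min => /andP[td td']; split; [exact: H|exact: H'].
Qed.

Lemma near01_sub s Q Q' : (forall t, 0 <= t <= 1 -> Q t -> Q' t) ->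
  near01 s Q -> near01 s Q'.
Proof.
by move=> QQ' /near01P[d d0 H]; apply/near01P; exists d => // t t01 /(H t t01)/QQ'; apply.
Qed.

(** Connectedness of [0, 1]: the truth value of [Q] is locally constant, so the initial intervals on
    which [Q] holds have supremum 1. *)
Lemma real_induction Q : Q 0 ->
  (forall s, 0 <= s <= 1 -> near01 s (fun t => Q s <-> Q t)) ->
  forall s, 0 <= s <= 1 -> Q s.
Proof.
move=> Q0 H.
pose S : set R := [set s | 0 <= s <= 1 /\ forall r, 0 <= r <= s -> Q r].
have S0 : S 0.
  split; first by rewrite lexx ler01.
  by move=> r; rewrite -eq_le => /eqP <-.
have Sub : has_sup S by split; [exists 0|exists 1 => s [/andP[]]].
have s0 : 0 <= sup S by apply: (ub_le_sup Sub.2).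
have s1 : sup S <= 1 by apply: ge_sup; [exists 0|move=> s [/andP[]]].
have s01 : 0 <= sup S <= 1 by rewrite s0.
have /near01P[d d0 Hd] := H _ s01.
have [e [e01 Qe] de] := sup_adherent d0 Sub.
have es : e <= sup S by apply: (ub_le_sup Sub.2).
have Qs : Q (sup S).
  apply/(Hd e) => //; last by apply: Qe; case/andP: e01 => ->; rewrite lexx.
  by rewrite ltr_norml; lra.
have Q1 r : 0 <= r <= 1 -> r < sup S + d -> Q r.
  move=> /[dup] r01 /andP[r0 r1] rd; case: (leP r e) => re.
    by apply: Qe; rewrite r0.
  by apply/(Hd r) => //; rewrite ltr_norml; lra.
have E1 : sup S = 1.
  apply/eqP; rewrite eq_le s1 leNgt; apply/negP => s1'.
  pose r := Num.min 1 (sup S + d / 2).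
  have : r <= sup S.
    apply: (ub_le_sup Sub.2); split.
      by rewrite le_min ler01 ge_min lexx addr_ge0 // ltW // divr_gt0.
    move=> t /andP[t0]; rewrite le_min => /andP[t1 td].
    by apply: Q1; [rewrite t0|apply: le_lt_trans td _; lra].
  by rewrite ge_min leNgt s1' /=; lra.
by move=> s /[dup] s01' /andP[_ s1']; apply: Q1 => //; rewrite E1; lra.
Qed.

Definition rcont f : Prop :=
  forall s, 0 <= s <= 1 -> f t @[t --> within `[0, 1] (nbhs s)] --> f s.

Definition pcont p : Prop := rcont (fun s => (p s).1) /\ rcont (fun s => (p s).2).

Lemma rcont_cst (c : R) : rcont (fun=> c).
Proof. by move=> s _; exact: cvg_cst. Qed.

Lemma rcont_id : rcont id.
Proof. by move=> s _; exact: cvg_within. Qed.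

Lemma rcontD f g : rcont f -> rcont g -> rcont (fun s => f s + g s).
Proof. by move=> cf cg s s01; apply: cvgD; [exact: cf|exact: cg]. Qed.

Lemma rcontN f : rcont f -> rcont (fun s => - f s).
Proof. by move=> cf s s01; apply: cvgN; exact: cf. Qed.

Lemma rcontB f g : rcont f -> rcont g -> rcont (fun s => f s - g s).
Proof. by move=> cf cg; apply: rcontD => //; exact: rcontN. Qed.

Lemma rcontM f g : rcont f -> rcont g -> rcont (fun s => f s * g s).
Proof. by move=> cf cg s s01; apply: cvgM; [exact: cf|exact: cg]. Qed.

Lemma rcontV f : rcont f -> (forall s, 0 <= s <= 1 -> f s != 0) ->
  rcont (fun s => (f s)^-1).
Proof. by move=> cf f0 s s01; apply: cvgV; [exact: f0|exact: cf]. Qed.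

Lemma rcont_sqrt f : rcont f -> rcont (fun s => Num.sqrt (f s)).
Proof.
move=> cf s s01; apply: (@cvg_comp _ _ _ f Num.sqrt _ (nbhs (f s))).
  exact: cf.
exact: sqrt_continuous.
Qed.

Lemma rcont_comp f g : rcont f -> (forall s, 0 <= s <= 1 -> 0 <= g s <= 1) ->
  rcont g -> rcont (fun s => f (g s)).
Proof.
move=> cf g01 cg s s01.
apply: (@cvg_comp _ _ _ g f _ (within `[0, 1] (nbhs (g s)))); last exact: cf (g01 s s01).
move=> A /near01P[d d0 H]; apply/near01P.
have /cvgrPdist_lt/(_ _ d0)/near01P[e e0 He] := cg s s01.
exists e => // t t01 ts; apply: H; first exact: g01.
by rewrite distrC; exact: He.
Qed.

Lemma rcont_sgn f s : rcont f -> 0 <= s <= 1 ->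
  near01 s (fun t => sgn_le (f s) (f t)).
Proof.
move=> cf s01; case: (eqVneq (f s) 0) => [->|f0].
  by apply/near01P; exists 1 => // t _ _; split; rewrite ltxx.
have f0' : 0 < `|f s| by rewrite normr_gt0.
have /cvgrPdist_lt/(_ _ f0')/near01P[d d0 H] := cf s s01.
apply/near01P; exists d => // t t01 ts; have := H t t01 ts.
by rewrite ltr_norml; split=> h; move: H0; rewrite ?(gtr0_norm h) ?(ltr0_norm h); lra.
Qed.

End Paths.

(** * Crossing words along paths *)

Section Transport.
Variables (R : realType) (al be : R).
Hypothesis par : good_params al be.
Implicit Types (p q : R -> R * R) (H : R -> seq letter) (s t m M : R).

Local Notation sq := (sq al be).
Local Notation close := (close al be).
Local Notation regular := (regular al be).

Definition crossing (u v : R * R) : seq letter :=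
  flips (fun l => cross al be l u v).

Definition corr (u : R * R) : seq letter := flips (fun l => strip al be l u).

Lemma pcont_close p s : pcont p -> 0 <= s <= 1 ->
  near01 s (fun t => close (p s) (p t)).
Proof.
move=> [p1 p2] s01.
have sg f : rcont f -> near01 s (fun t => sgn_le (f s) (f t)).
  by move=> cf; exact: rcont_sgn.
have cst := @rcont_cst R.
have H1 l : near01 s (fun t => sgn_le (side al be l (p s)) (side al be l (p t)) /\
    sgn_le (beyond al be l (p s)) (beyond al be l (p t))).
  apply: near01_and; apply: (sg (fun t => _ (p t))); rewrite /side /beyond;
    by case: l; do ?[exact: rcontB|exact: rcontD].
have H2 := near01_and (sg _ p1) (sg _ p2).
have H3 := near01_and (sg _ (rcontB p1 p2)) (sg _ (rcontD p1 p2)).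
have := near01_and (near01_and (near01_and (H1 LT) (H1 LA))
  (near01_and (H1 LB) (H1 LC))) (near01_and H2 H3).
apply: near01_sub => t _ [[[hT hA] [hB hC]] [[h1 h2] [h3 h4]]].
by split=> //; case.
Qed.

Lemma pcont_sq p : pcont p -> pcont (fun s => sq (p s)).
Proof.
move=> [p1 p2]; have cst := @rcont_cst R; split.
  exact: rcontD (rcontB (rcontM p1 p1) (rcontM p2 p2)) (cst al).
exact: rcontD (rcontD (rcontM p1 p2) (rcontM p1 p2)) (cst be).
Qed.

(* [H s] is the word of the cuts that [p] crosses on [[0, s]]. *)
Definition is_transport p H : Prop :=
  wact (H 0) =1 id /\ forall s, 0 <= s <= 1 ->
    near01 s (fun t => wact (H t) =1 wact (H s ++ crossing (p s) (p t))).

Lemma crossing_self u : crossing u u = [::].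
Proof.
have cr l : cross al be l u u = false by rewrite /cross eqxx andbF.
by rewrite /crossing /flips /= !cr.
Qed.

Lemma wactK w : cancel (wact w) (wact (rev w)).
Proof. exact: wact_rev. Qed.

Lemma wactVK w : cancel (wact (rev w)) (wact w).
Proof. by move=> x; rewrite -{1}(revK w) wact_rev. Qed.

(** All positions near time [s] are close to [p s], so the word is continued past [m] by going back
    from [p m] to [p s] and out again to [p r]; [cross_transport] gives the compatibility. *)
Lemma transport_exists p : pcont p -> (forall s, 0 <= s <= 1 -> regular (p s)) ->
  exists H, is_transport p H.
Proof.
move=> cp rp.
pose upto m H := H 0 = [::] /\ forall s, 0 <= s <= m ->
  near01 s (fun t => t <= m -> wact (H t) =1 wact (H s ++ crossing (p s) (p t))).
have [|s s01| |H [H0 HP]] := @real_induction R (fun m => exists H, upto m H) _ _ 1 _.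
- exists (fun=> [::]); split=> // s; rewrite -eq_le => /eqP <-.
  apply/near01P; exists 1 => // t /andP[t0 _] _ t0'.
  have -> : t = 0 by apply/eqP; rewrite eq_le t0'.
  by rewrite crossing_self.
- have /near01P[d d0 Hd] := pcont_close cp s01.
  have ext m M : 0 <= m <= 1 -> `|m - s| < d -> 0 <= M <= 1 -> `|M - s| < d ->
      (exists H, upto m H) -> exists H, upto M H.
    move=> m01 md M01 Md [H [H0 HP]].
    case: (leP M m) => [Mm|mM].
      exists H; split=> // r /andP[r0 rM]; have := HP r.
      rewrite r0 (le_trans rM Mm) => /(_ isT); apply: near01_sub => t _ HH tM.
      by apply: HH; exact: le_trans Mm.
    have inball t : m <= t <= M -> close (p s) (p t).
      move=> /andP[mt tM]; apply: Hd.
        by case/andP: m01 M01 => ? ? /andP[? ?]; apply/andP; split; lra.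
      by move: md Md; rewrite !ltr_norml => /andP[? ?] /andP[? ?]; lra.
    have mm : m <= m <= M by rewrite lexx ltW.
    pose H' r := if r <= m then H r
      else H m ++ rev (crossing (p s) (p m)) ++ crossing (p s) (p r).
    have H'E r : m <= r <= M -> wact (H' r) =1
        wact (H m ++ rev (crossing (p s) (p m)) ++ crossing (p s) (p r)).
      rewrite /H'; case: (ltgtP m r) => // <- _ x.
      by rewrite !wact_cat wactVK.
    exists H'; split; first by rewrite /H'; case/andP: m01 => ->.
    move=> r /andP[r0 rM]; case: (ltgtP r m) => rm.
    + have := HP r; rewrite r0 ltW // => /(_ isT) /near01P[e e0 He].
      apply/near01P; exists (Num.min e (m - r)).
        by rewrite lt_min e0 subr_gt0.
      move=> t t01; rewrite lt_min => /andP[te tm] _.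
      have tm' : t <= m by move: tm; rewrite ltr_norml => /andP[? ?]; lra.
      by rewrite /H' tm' (ltW rm); exact: He.
    + apply/near01P; exists (r - m); first by rewrite subr_gt0.
      move=> t t01; rewrite ltr_norml => /andP[tm _] tM x.
      have tI : m <= t <= M by rewrite tM andbT; lra.
      have rI : m <= r <= M by rewrite rM ltW.
      rewrite wact_cat !H'E // !wact_cat.
      rewrite (cross_transport par (rp _ s01) (inball _ rI) (inball _ tI)).
      by rewrite wact_cat.
    + have := HP r; rewrite r0 rm lexx => /(_ isT) /near01P[e e0 He].
      apply/near01P; exists e => // t t01 te tM x; case: (leP t m) => tm.
        by rewrite /H' tm lexx; exact: He.
      have tI : m <= t <= M by rewrite tM ltW.
      rewrite H'E // wact_cat /H' lexx !wact_cat.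
      rewrite (cross_transport par (rp _ s01) (inball _ mm) (inball _ tI)).
      by rewrite wact_cat wactVK.
  apply/near01P; exists d => // t t01 td; split; apply: ext => //;
    by rewrite subrr normr0.
- by rewrite ler01 lexx.
exists H; split=> [|s s01]; first by rewrite H0.
have := HP s s01; apply: near01_sub => t /andP[_ t1] HH.
exact: HH.
Qed.

Lemma corrK u : cancel (wact (corr u)) (wact (corr u)).
Proof.
move=> x; rewrite -wact_cat.
apply: (@flips_eq (fun l => sector l u) (fun l => strip al be l u)
  (fun l => strip al be l u) (fun=> false) (fun=> false)) => // [l l'|l|l|l].
- exact: sector_inj.
- exact: (strip_sector par).
- exact: (strip_sector par).
- by rewrite addbb.
Qed.

(** Between nearby times both sides change by the crossing word of the image: [half_flip] gives its
    effect on the first letter and [strip_transport] its section. Connectedness does the rest. *)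
Lemma transport_section q (Hp Hq : R -> seq letter) : pcont q ->
  (forall s, 0 <= s <= 1 -> regular (q s)) ->
  (forall s, 0 <= s <= 1 -> regular (sq (q s))) ->
  is_transport (fun s => sq (q s)) Hp -> is_transport q Hq ->
  forall s w, 0 <= s <= 1 -> wact (Hp s) (half (q 0) :: w) =
    half (q s) :: wact (corr (q 0) ++ Hq s ++ corr (q s)) w.
Proof.
move=> cq rq rp [Hp0 HpP] [Hq0 HqP] s w; move: s.
apply: real_induction; first by rewrite Hp0 !wact_cat Hq0 corrK.
move=> s s01.
have c1 := pcont_close cq s01; have c2 := pcont_close (pcont_sq cq) s01.
apply: near01_sub (near01_and (near01_and c1 c2) (near01_and (HpP s s01) (HqP s s01))).
move=> t _ [[cqt cpt] [pt qt]].
rewrite pt [wact (Hp s ++ _) _]wact_cat.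
have -> : half (q t) :: wact (corr (q 0) ++ Hq t ++ corr (q t)) w =
    wact (crossing (sq (q s)) (sq (q t)))
      (half (q s) :: wact (corr (q 0) ++ Hq s ++ corr (q s)) w).
  have [pE sE] := sec_cross_flips par cpt.
  rewrite wact_sec pE sE (half_flip _ cqt cpt); last first.
    by apply/eqP => q0; apply: (rp s s01 LT); rewrite q0 /cpt /sq /= !mulr0 subr0 !add0r.
  congr (_ :: _); rewrite !wact_cat qt wact_cat.
  by rewrite -[RHS]wact_cat (strip_transport par (rq s s01) cqt cpt) wact_cat.
split=> [->//|E].
by apply: (can_inj (wactK (crossing (sq (q s)) (sq (q t))))).
Qed.

End Transport.

(** * Lifting paths by continuous square roots *)

Section Lifting.
Variables (R : realType) (al be : R).
Implicit Types (p q : R -> R * R) (s t m M : R).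

Local Notation sq := (sq al be).

Lemma rcont_min (m : R) : rcont (fun t => Num.min t m).
Proof.
move=> s s01; apply/cvgrPdist_lt => e e0; apply/near01P; exists e => // t t01.
rewrite !ltr_norml => /andP[? ?]; rewrite /Num.min.
by case: (ltP s m) => ?; case: (ltP t m) => ?; apply/andP; split; lra.
Qed.

(** Half angle formula for the square root with positive real part. *)
Lemma sqrt_branch (a b : R) : 0 < a ->
  let x := Num.sqrt ((Num.sqrt (a * a + b * b) + a) / 2) in
  let y := b / (x + x) in
  [/\ 0 < x, x * x - y * y = a & x * y + x * y = b].
Proof.
move=> a0 /=; have n0 : 0 <= a * a + b * b by rewrite addr_ge0 -?expr2 ?sqr_ge0.
have := sqr_sqrtr n0; set r := Num.sqrt (a * a + b * b) => rr.
set x := Num.sqrt ((r + a) / 2); set y := b / (x + x).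
have r0 : 0 <= r by exact: sqrtr_ge0.
have ra : 0 < r + a by lra.
have xx : x * x = (r + a) / 2 by rewrite -expr2 sqr_sqrtr // divr_ge0 // ltW.
have x0 : 0 < x by rewrite sqrtr_gt0 divr_gt0.
have x0' : x != 0 by rewrite gt_eqF.
have ra' : r + a != 0 by rewrite gt_eqF.
have yE : y = b / (2 * x) by rewrite /y; congr (_ / _); ring.
have xy : x * y = b / 2 by rewrite yE; field.
split=> //; last by rewrite xy; lra.
have yy : y * y = b * b / (2 * (r + a)).
  have -> : y * y = b * b / (4 * (x * x)) by rewrite yE; field.
  by rewrite xx; field.
have bb : b * b = r ^+ 2 - a * a by rewrite rr; ring.
by rewrite xx yy bb; field.
Qed.

(** Two vectors close to the same nonzero vector form an acute angle, so their quotient lies in the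
    half plane where [sqrt_ratio] is continuous. *)
Lemma dot_pos (x y x0 y0 x1 y1 : R) :
  let e := (`|x| + `|y|) / 8 in 0 < e ->
  `|x0 - x| < e -> `|y0 - y| < e -> `|x1 - x| < e -> `|y1 - y| < e ->
  0 < x0 * x1 + y0 * y1.
Proof.
have key (e u u0 u1 : R) : 0 < e -> `|u0 - u| < e -> `|u1 - u| < e ->
    u * u - 2 * e * `|u| - e * e <= u0 * u1.
  move=> e0 h0 h1.
  have -> : u0 * u1 = u * u + u * ((u0 - u) + (u1 - u)) + (u0 - u) * (u1 - u) by ring.
  have a1 : - (e * e) <= (u0 - u) * (u1 - u).
    rewrite lerNl (le_trans (ler_norm _)) // normrN normrM.
    by rewrite ler_pM // ltW.
  have a2 : - (`|u| * (e + e)) <= u * ((u0 - u) + (u1 - u)).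
    rewrite lerNl (le_trans (ler_norm _)) // normrN normrM ler_wpM2l //.
    by rewrite (le_trans (ler_normD _ _)) // lerD // ltW.
  have -> : u * u - 2 * e * `|u| - e * e = u * u + (- (`|u| * (e + e)) + - (e * e)).
    by ring.
  by rewrite -addrA lerD2l lerD.
move=> e e0 h1 h2 h3 h4.
have := key _ _ _ _ e0 h1 h3; have := key _ _ _ _ e0 h2 h4.
have sx : `|x| * `|x| = x * x by rewrite -normrM ger0_norm // -expr2 sqr_ge0.
have sy : `|y| * `|y| = y * y by rewrite -normrM ger0_norm // -expr2 sqr_ge0.
rewrite -sx -sy; move: (normr_ge0 x) (normr_ge0 y) e0; rewrite /e.
move: `|x| `|y| => X Y X0 Y0 e0 k1 k2.
have XY0 : 0 < X + Y by lra.
have XY : 0 < (X + Y) * (X + Y) by rewrite mulr_gt0.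
have XY' : 0 <= (X - Y) * (X - Y) by rewrite -expr2 sqr_ge0.
by clear -XY XY' k1 k2; lra.
Qed.

Definition cmul (u v : R * R) : R * R :=
  (u.1 * v.1 - u.2 * v.2, u.1 * v.2 + u.2 * v.1).

(* A continuous square root of [u / v], for [u / v] in the right half plane. *)
Definition sqrt_ratio (u v : R * R) : R * R :=
  let n := v.1 * v.1 + v.2 * v.2 in
  let a := (u.1 * v.1 + u.2 * v.2) / n in
  let b := (u.2 * v.1 - u.1 * v.2) / n in
  let x := Num.sqrt ((Num.sqrt (a * a + b * b) + a) / 2) in (x, b / (x + x)).

Lemma sqrt_ratioP u v : 0 < v.1 * v.1 + v.2 * v.2 ->
  0 < u.1 * v.1 + u.2 * v.2 ->
  cmul v (cmul (sqrt_ratio u v) (sqrt_ratio u v)) = u.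
Proof.
move=> n0 d0; have n0' : v.1 * v.1 + v.2 * v.2 != 0 by rewrite gt_eqF.
have a0 := divr_gt0 d0 n0.
have [x0 E1 E2] := sqrt_branch ((u.2 * v.1 - u.1 * v.2) / (v.1 * v.1 + v.2 * v.2)) a0.
rewrite /cmul /sqrt_ratio; cbn [fst snd].
set x := Num.sqrt _ in E1 E2 *; set y := _ / (x + x) in E1 E2 *.
rewrite E1 [y * x]mulrC E2 {E1 E2 x y x0}.
by case: u v n0 n0' d0 a0 => u1 u2 [v1 v2] /= *; congr (_, _); field.
Qed.

Lemma sqrt_ratio_self v : 0 < v.1 * v.1 + v.2 * v.2 -> sqrt_ratio v v = (1, 0).
Proof.
move=> n0; rewrite /sqrt_ratio /= divff ?gt_eqF // [v.2 * v.1]mulrC subrr !mul0r.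
by rewrite mulr1 addr0 sqrtr1 (_ : (1 + 1) / 2 = 1 :> R) ?sqrtr1 //; lra.
Qed.

Lemma pcont_cmul p q : pcont p -> pcont q -> pcont (fun s => cmul (p s) (q s)).
Proof.
move=> [p1 p2] [q1 q2]; split.
  exact: rcontB (rcontM p1 q1) (rcontM p2 q2).
exact: rcontD (rcontM p1 q2) (rcontM p2 q1).
Qed.

Lemma pcont_sqrt_ratio p q : pcont p -> pcont q ->
  (forall s, 0 <= s <= 1 -> 0 < (q s).1 * (q s).1 + (q s).2 * (q s).2) ->
  (forall s, 0 <= s <= 1 -> 0 < (p s).1 * (q s).1 + (p s).2 * (q s).2) ->
  pcont (fun s => sqrt_ratio (p s) (q s)).
Proof.
move=> [p1 p2] [q1 q2] n0 d0.
pose n s := (q s).1 * (q s).1 + (q s).2 * (q s).2.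
have cn : rcont (fun s => (n s)^-1).
  apply: rcontV; first exact: rcontD (rcontM q1 q1) (rcontM q2 q2).
  by move=> s s01; rewrite gt_eqF // n0.
have ca := rcontM (rcontD (rcontM p1 q1) (rcontM p2 q2)) cn.
have cb := rcontM (rcontB (rcontM p2 q1) (rcontM p1 q2)) cn.
have cx := rcont_sqrt (rcontM (rcontD (rcont_sqrt (rcontD (rcontM ca ca) (rcontM cb cb))) ca)
  (@rcont_cst R 2^-1)).
split; first exact: cx.
apply: (rcontM cb); apply: rcontV; first exact: (rcontD cx cx).
move=> s s01; have a0 := divr_gt0 (d0 s s01) (n0 s s01).
have [x0 _ _] := sqrt_branch (((p s).2 * (q s).1 - (p s).1 * (q s).2) / n s) a0.
by rewrite gt_eqF // addr_gt0.
Qed.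

(** Freezing the path after time [m] makes partial lifts defined on all of [0, 1]. Passing from [m]
    to a nearby [M] multiplies the lift by the root of a quotient that stays in the right half
    plane. *)
Lemma sqrt_lift p u0 : pcont p -> (forall s, 0 <= s <= 1 -> p s <> (al, be)) ->
  sq u0 = p 0 ->
  exists2 q, pcont q & q 0 = u0 /\ forall s, 0 <= s <= 1 -> sq (q s) = p s.
Proof.
move=> cp pn u0p.
pose w s : R * R := ((p s).1 - al, (p s).2 - be).
have cw : pcont w.
  by case: cp => p1 p2; split; apply: rcontB => //; exact: rcont_cst.
have wn s : 0 <= s <= 1 -> 0 < (w s).1 * (w s).1 + (w s).2 * (w s).2.
  move=> s01; rewrite lt_neqAle addr_ge0 -?expr2 ?sqr_ge0 // andbT eq_sym.
  rewrite paddr_eq0 ?sqr_ge0 // !sqrf_eq0 !subr_eq0; apply/negP => /andP[/eqP h1 /eqP h2].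
  by apply: (pn s s01); rewrite [LHS]surjective_pairing h1 h2.
pose Q m := exists2 q, pcont q & q 0 = u0 /\
  forall r, 0 <= r <= 1 -> sq (q r) = p (Num.min r m).
suff QH : forall m, 0 <= m <= 1 -> Q m.
  have [|q cq [q0 qE]] := QH 1; first by rewrite ler01 lexx.
  exists q => //; split=> // s s01; rewrite qE //; congr p.
  by apply/min_idPl; case/andP: s01.
apply: real_induction.
  exists (fun=> u0); first by split; exact: rcont_cst.
  split=> // r /andP[r0 _]; rewrite u0p; congr p.
  by apply/esym/min_idPr.
move=> s s01.
pose e := (`|(w s).1| + `|(w s).2|) / 8.
have e0 : 0 < e.
  rewrite divr_gt0 // lt_neqAle addr_ge0 // andbT eq_sym paddr_eq0 // !normr_eq0.
  by apply/negP => /andP[/eqP h1 /eqP h2]; have := wn s s01; rewrite h1 h2 !mulr0 addr0 ltxx.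
have [c1 c2] := cw.
have /cvgrPdist_lt/(_ _ e0) n1 := c1 s s01; have /cvgrPdist_lt/(_ _ e0) n2 := c2 s s01.
have /near01P[d d0 Hd] := near01_and n1 n2.
have minI (r k : R) : 0 <= r <= 1 -> 0 <= k <= 1 -> 0 <= Num.min r k <= 1.
  by move=> r01 k01; rewrite /Num.min; case: ifP.
have ext m M : 0 <= m <= 1 -> `|m - s| < d -> 0 <= M <= 1 -> `|M - s| < d -> Q m -> Q M.
  move=> m01 md M01 Md [q cq [q0 qE]].
  pose W k r := w (Num.min r k).
  have cW k : 0 <= k <= 1 -> pcont (W k).
    move=> k01; have g01 t : 0 <= t <= 1 -> 0 <= Num.min t k <= 1 by move=> ?; exact: minI.
    split; first exact: (rcont_comp c1 g01 (@rcont_min k)).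
    exact: (rcont_comp c2 g01 (@rcont_min k)).
  have wW k r : 0 <= k <= 1 -> 0 <= r <= 1 -> 0 < (W k r).1 * (W k r).1 + (W k r).2 * (W k r).2.
    by move=> k01 r01; apply: wn; exact: minI.
  have dW r : 0 <= r <= 1 -> 0 < (W M r).1 * (W m r).1 + (W M r).2 * (W m r).2.
    move=> r01; case: (boolP ((r <= m) && (r <= M))) => [/andP[rm rM]|rmM].
      by rewrite /W !(min_idPl _) //; exact: wn.
    have inball k : k = m \/ k = M -> `|Num.min r k - s| < d.
      clear -md Md rmM; move: md Md rmM; rewrite !ltr_norml negb_and -!ltNge => /andP[? ?] /andP[? ?] rmM.
      by case=> ->; rewrite /Num.min; case: ifP => h; case/orP: rmM => ?; apply/andP; split; lra.
    have [a1 a2] := Hd _ (minI _ _ r01 M01) (inball _ (or_intror erefl)).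
    have [b1 b2] := Hd _ (minI _ _ r01 m01) (inball _ (or_introl erefl)).
    by apply: (@dot_pos (w s).1 (w s).2); rewrite // distrC.
  exists (fun r => cmul (q r) (sqrt_ratio (W M r) (W m r))).
    apply: pcont_cmul => //; apply: pcont_sqrt_ratio; [exact: cW|exact: cW| |exact: dW].
    by move=> r r01; exact: wW.
  have z01 : 0 <= (0 : R) <= 1 by rewrite lexx ler01.
  split.
    have -> : W M 0 = W m 0.
      by rewrite /W !(min_idPl _) //; [case/andP: m01|case/andP: M01].
    rewrite sqrt_ratio_self; last exact: wW.
    by rewrite q0 /cmul /= !mulr0 !mulr1 subr0 add0r -surjective_pairing.
  move=> r r01.
  have := sqrt_ratioP (wW _ _ m01 r01) (dW _ r01).
  set z := sqrt_ratio _ _; move: z => [x y]; have := qE r r01.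
  case: (q r) => a b E1 E2.
  move: E1 E2; rewrite /W /w; case: (p (Num.min r m)) => P1 P2.
  case: (p (Num.min r M)) => Q1 Q2; rewrite /sq /cmul; cbn [fst snd].
  case=> <- <- [F1 F2]; congr (_, _).
    by rewrite -[RHS](subrK al) -F1; ring.
  by rewrite -[RHS](subrK be) -F2; ring.
apply/near01P; exists d => // t t01 td; split; apply: ext => //; by rewrite subrr normr0.
Qed.

End Lifting.

(** * Realizing words by paths *)

Section Reach.
Variables (R : realType) (al be : R).
Hypothesis par : good_params al be.
Implicit Types (p q : R -> R * R) (H : R -> seq letter) (s t : R) (z y : R * R).

Local Notation regular := (regular al be).
Local Notation side := (side al be).
Local Notation beyond := (beyond al be).
Local Notation cpt := (cpt al be).

Definition reach z y (w : seq letter) : Prop :=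
  exists p H, [/\ pcont p, forall s, 0 <= s <= 1 -> regular (p s),
    p 0 = z /\ p 1 = y, is_transport al be p H & wact (H 1) =1 wact w].

Lemma reach_eq z y w w' : wact w =1 wact w' -> reach z y w -> reach z y w'.
Proof.
by move=> E [p [H [cp rp e tr Hw]]]; exists p, H; split=> // x; rewrite Hw E.
Qed.

Lemma near01_comp g s Q : rcont g -> 0 <= s <= 1 ->
  (forall t, 0 <= t <= 1 -> 0 <= g t <= 1) ->
  near01 (g s) Q -> near01 s (fun t => Q (g t)).
Proof.
move=> cg s01 g01 /near01P[d d0 HQ].
have /cvgrPdist_lt/(_ _ d0) := cg s s01; apply: near01_sub => t t01 gt.
by apply: HQ; [exact: g01|rewrite distrC].
Qed.

Lemma reach_path p : pcont p -> (forall s, 0 <= s <= 1 -> regular (p s)) ->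
  exists w, reach (p 0) (p 1) w.
Proof.
move=> cp rp; have [H tr] := transport_exists par cp rp.
by exists (H 1), p, H.
Qed.

Lemma rcont_oppmin : rcont (fun s : R => 1 - s).
Proof. by apply: rcontB; [exact: rcont_cst|exact: rcont_id]. Qed.

Lemma reach_rev z y w : reach z y w -> reach y z (rev w).
Proof.
move=> [p [H [[c1 c2] rp [p0 p1] [H0 HP] Hw]]].
have g01 (t : R) : 0 <= t <= 1 -> 0 <= 1 - t <= 1.
  by move=> /andP[? ?]; apply/andP; split; lra.
exists (fun s => p (1 - s)), (fun s => rev (H 1) ++ H (1 - s)); split.
- by split; [apply: (rcont_comp c1 g01)|apply: (rcont_comp c2 g01)]; exact: rcont_oppmin.
- by move=> s s01; apply: rp; exact: g01.
- by rewrite subr0 subrr.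
- split=> [x|s s01]; first by rewrite subr0 wact_cat wactVK.
  have := near01_comp rcont_oppmin s01 g01 (HP _ (g01 s s01)).
  by apply: near01_sub => t _ E x; rewrite -catA !wact_cat E wact_cat.
- move=> x; rewrite subrr wact_cat H0.
  by apply: (can_inj (wactK w)); rewrite wactVK -Hw wactVK.
Qed.

Lemma reach_cat z y x v w : reach z y v -> reach y x w -> reach z x (v ++ w).
Proof.
move=> [p1 [H1 [[c1 c1'] r1 [p10 p11] [H10 H1P] Hv]]].
move=> [p2 [H2 [[c2 c2'] r2 [p20 p21] [H20 H2P] Hw]]].
pose g1 (s : R) := Num.min (s + s) 1.
pose g2 (s : R) := - Num.min (1 - (s + s)) 0.
have cg1 : rcont g1.
  move=> s s01; apply/cvgrPdist_lt => e e0; apply/near01P.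
  exists (e / 2) => [|t t01]; first by rewrite divr_gt0.
  rewrite !ltr_norml => /andP[? ?]; rewrite /g1 /Num.min.
  by case: (ltP (s + s) 1) => ?; case: (ltP (t + t) 1) => ?; apply/andP; split; lra.
have cg2 : rcont g2.
  move=> s s01; apply/cvgrPdist_lt => e e0; apply/near01P.
  exists (e / 2) => [|t t01]; first by rewrite divr_gt0.
  rewrite !ltr_norml => /andP[? ?]; rewrite /g2 /Num.min.
  by case: (ltP (1 - (s + s)) 0) => ?; case: (ltP (1 - (t + t)) 0) => ?; apply/andP; split; lra.
have g1I t : 0 <= t <= 1 -> 0 <= g1 t <= 1.
  by move=> /andP[? ?]; rewrite /g1 /Num.min; case: ltP => ?; apply/andP; split; lra.
have g2I t : 0 <= t <= 1 -> 0 <= g2 t <= 1.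
  by move=> /andP[? ?]; rewrite /g2 /Num.min; case: ltP => ?; apply/andP; split; lra.
have g1h t : 2^-1 <= t -> g1 t = 1.
  by move=> ?; rewrite /g1 /Num.min; case: ltP => ? //; lra.
have g2h t : t <= 2^-1 -> g2 t = 0.
  by move=> ?; rewrite /g2 /Num.min; case: ltP => ? //; lra.
(* On each half of [0, 1] one of the summands rests at [y], so this is the concatenation and its
   continuity needs no gluing. *)
pose p s := ((p1 (g1 s)).1 + (p2 (g2 s)).1 - y.1,
  (p1 (g1 s)).2 + (p2 (g2 s)).2 - y.2).
have pl s : s <= 2^-1 -> p s = p1 (g1 s).
  by move=> h; rewrite /p g2h // p20 !addrK -surjective_pairing.
have pr s : 2^-1 <= s -> p s = p2 (g2 s).
  by move=> h; rewrite /p g1h // p11 ![y.1 + _]addrC ![y.2 + _]addrC !addrK -surjective_pairing.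
exists p, (fun s => H1 (g1 s) ++ H2 (g2 s)); split.
- have k := @rcont_cst R; split.
    exact: (rcontB (rcontD (rcont_comp c1 g1I cg1) (rcont_comp c2 g2I cg2)) (k y.1)).
  exact: (rcontB (rcontD (rcont_comp c1' g1I cg1) (rcont_comp c2' g2I cg2)) (k y.2)).
- move=> s s01; case: (leP s 2^-1) => h; first by rewrite pl //; apply: r1; exact: g1I.
  by rewrite pr ?ltW //; apply: r2; exact: g2I.
- split.
    rewrite pl ?invr_ge0 // -p10; congr p1; rewrite /g1 addr0.
    by apply/min_idPl; exact: ler01.
  have h : 2^-1 <= 1 :> R by lra.
  rewrite pr // -p21; congr p2; rewrite /g2 /Num.min; case: ltP => ?; lra.
- split=> [u|s s01].
    rewrite wact_cat g2h ?invr_ge0 // H20 /g1 addr0.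
    by rewrite (min_idPl _) ?ler01 // H10.
  have n1 := near01_comp cg1 s01 g1I (H1P _ (g1I s s01)).
  have n2 := near01_comp cg2 s01 g2I (H2P _ (g2I s s01)).
  have n3 : near01 s (fun t => (s <= 2^-1 /\ t <= 2^-1) \/ (2^-1 <= s /\ 2^-1 <= t)).
    apply/near01P; case: (ltgtP s 2^-1) => h.
    + exists (2^-1 - s); first by rewrite subr_gt0.
      by move=> t _; rewrite ltr_norml => /andP[? ?]; left; split=> //; lra.
    + exists (s - 2^-1); first by rewrite subr_gt0.
      by move=> t _; rewrite ltr_norml => /andP[? ?]; right; split=> //; lra.
    + by exists 1 => // t _ _; case: (leP t 2^-1) => ?; [left|right; rewrite ltW].
  apply: near01_sub (near01_and n3 (near01_and n1 n2)) => t _ [[[hs ht]|[hs ht]] [E1 E2]] u.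
    by rewrite !wact_cat !(g2h _) // !H20 E1 wact_cat !pl.
  by rewrite !wact_cat E2 wact_cat !(g1h _) // !pr.
- move=> u; have h : 2^-1 <= 1 :> R by lra.
  rewrite !wact_cat g1h // Hv; have -> : g2 1 = 1.
    by rewrite /g2 /Num.min; case: ltP => ?; lra.
  exact: Hw.
Qed.

Definition segment z y s : R * R :=
  (z.1 + s * (y.1 - z.1), z.2 + s * (y.2 - z.2)).

Lemma pcont_segment z y : pcont (segment z y).
Proof.
have k := @rcont_cst R; have i := @rcont_id R.
split; [exact: (rcontD (k z.1) (rcontM i (k _)))|exact: (rcontD (k z.2) (rcontM i (k _)))].
Qed.

Lemma segment01 z y : segment z y 0 = z /\ segment z y 1 = y.
Proof.
by case: z y => ? ? [? ?]; rewrite /segment /=; split; congr (_, _); ring.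
Qed.

Definition off_cut l z : Prop := side l z = 0 -> beyond l z < 0.

Lemma side_cpt l : side l (cpt l) = 0 /\ beyond l (cpt l) = 0.
Proof. by case: l; rewrite /side /beyond /= ?subrr ?addNr; split. Qed.

Lemma off_cut_neq l z : off_cut l z -> z <> cpt l.
Proof. by move=> + zE; rewrite zE /off_cut; have [-> ->] := side_cpt l; rewrite ltxx => /(_ erefl). Qed.

Lemma cross_off l z y : close al be z y -> off_cut l z -> cross al be l z y = false.
Proof.
move=> c off; apply/negbTE/negP => /(cross_side0 c)[/off b1].
by rewrite ltNge ltW.
Qed.

Lemma segment_close z y s : 0 <= s <= 1 ->
  near01 s (fun t => close al be (segment z y s) (segment z y t)).
Proof. by move=> s01; apply: pcont_close s01; exact: pcont_segment. Qed.

Lemma reach_off z y :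
  (forall s l, 0 <= s <= 1 -> off_cut l (segment z y s)) -> reach z y [::].
Proof.
move=> off; exists (segment z y), (fun=> [::]); split=> //.
- exact: pcont_segment.
- by move=> s s01 l; apply: off_cut_neq; exact: off.
- exact: segment01.
split=> // s s01; have := segment_close z y s01; apply: near01_sub => t _ c x.
by rewrite /crossing /flips /= !(cross_off c) //; exact: off.
Qed.

(** Only the line of the cut [l] matters, and the segment stays beyond its end point; the word at
    time [s] just records whether the side differs from the initial one. *)
Lemma reach_cross l z y :
  (forall s l', 0 <= s <= 1 -> l' != l -> off_cut l' (segment z y s)) ->
  (forall s, 0 <= s <= 1 -> 0 < beyond l (segment z y s)) ->
  (0 <= side l z) != (0 <= side l y) -> reach z y [:: l].
Proof.
move=> off on sd; pose sg s := 0 <= side l (segment z y s).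
exists (segment z y), (fun s => if sg s == sg 0 then [::] else [:: l]); split=> //.
- exact: pcont_segment.
- move=> s s01 l'; case: (eqVneq l' l) => [->|l'l] sE.
    by have := on s s01; rewrite sE (side_cpt l).2 ltxx.
  exact: off_cut_neq (off _ _ s01 l'l) sE.
- exact: segment01.
- split=> [x|s s01]; first by rewrite eqxx.
  have := segment_close z y s01; apply: near01_sub => t _ c x.
  have E l' : cross al be l' (segment z y s) (segment z y t) = (l' == l) && (sg s != sg t).
    case: (eqVneq l' l) => [->|l'l]; first by rewrite /cross on.
    by rewrite (cross_off c) //; exact: off.
  have -> : crossing al be (segment z y s) (segment z y t) =
      if sg s != sg t then [:: l] else [::].
    by rewrite /crossing /flips /= !E; case: (l) => /=; case: ifP.
  case: (sg s) (sg t) (sg 0) => [] [] [] //=; by rewrite letter_actK.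
- by rewrite /sg !(segment01 z y).1 !(segment01 z y).2 eq_sym (negbTE sd).
Qed.

End Reach.

Section Loops.
Variables (R : realType) (al be : R).
Hypothesis par : good_params al be.
Implicit Types (s t : R) (z y : R * R) (l : letter).

Local Notation regular := (regular al be).
Local Notation side := (side al be).
Local Notation beyond := (beyond al be).
Local Notation cpt := (cpt al be).
Local Notation reach := (reach al be).
Local Notation off_cut := (off_cut al be).

Lemma off_cutP z : (z.1 = al -> z.2 < be) ->
  (z.2 = (cpt LA).2 -> (cpt LA).1 < z.1) ->
  (z.2 = (cpt LB).2 -> z.1 < (cpt LB).1) ->
  (z.1 = - al -> - be < z.2) -> forall l, off_cut l z.
Proof.
move=> h1 h2 h3 h4 [] /eqP; rewrite /beyond ?subr_eq0 ?addr_eq0 => /eqP sE.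
- by rewrite subr_lt0 h1.
- by rewrite subr_lt0 h2.
- by rewrite subr_lt0 h3.
- by rewrite subr_lt0 h4.
Qed.

(** The triangle from the origin through [apex l] and [foot l] crosses the cut [l] once, between
    these two points. For t its first side is y = - 4 x, hence the condition - 4 al < be in
    [good_params]. *)
Definition apex l : R * R :=
  match l with
  | LT => (- 2^-1, 2) | LA => (- 3, 3) | LB => (3, - 3) | LC => (2^-1, - 2)
  end.

Definition foot l : R * R :=
  match l with
  | LT => (0, 2) | LA => (- 3, 0) | LB => (3, 0) | LC => (0, - 2)
  end.

Lemma generator_loop l : reach (0, 0) (0, 0) [:: l].
Proof.
have [_ [h1 h2 h3 h4] [g1 g2 g3 g4] [k1 k2 k3 k4]] := par.
rewrite -[[:: l]]/([::] ++ [:: l] ++ [::]).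
apply: (@reach_cat _ _ _ _ (apex l)); last apply: (@reach_cat _ _ _ _ (foot l)).
- apply: reach_off => s l' /andP[s0 s1]; apply: off_cutP; rewrite /segment;
    case: (l); rewrite /apex; cbn [fst snd]; rewrite ?subr0 ?add0r;
    move: (cpt LA) (cpt LB) g1 g2 g3 g4 k1 k2 k3 k4 => [x1 y1] [x2 y2];
    cbn [fst snd] => g1 g2 g3 g4 k1 k2 k3 k4 E; lra.
- apply: reach_cross => [s l' /andP[s0 s1] l'l|s /andP[s0 s1]|].
  + suff : off_cut l' (segment (apex l) (foot l) s) by [].
    move: l'l; rewrite /off_cut /side /beyond /segment;
    case: (l); case: l' => // _; rewrite /apex /foot; cbn [fst snd];
    move: (cpt LA) (cpt LB) g1 g2 g3 g4 k1 k2 k3 k4 => [x1 y1] [x2 y2];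
    cbn [fst snd] => g1 g2 g3 g4 k1 k2 k3 k4 E; lra.
  + rewrite /beyond /segment; case: (l); rewrite /apex /foot; cbn [fst snd];
    move: (cpt LA) (cpt LB) g1 g2 g3 g4 k1 k2 k3 k4 => [x1 y1] [x2 y2];
    cbn [fst snd] => g1 g2 g3 g4 k1 k2 k3 k4; lra.
  + rewrite /side; case: (l); rewrite /apex /foot; cbn [fst snd];
    move: (cpt LA) (cpt LB) g1 g2 g3 g4 k1 k2 k3 k4 => [x1 y1] [x2 y2];
    cbn [fst snd] => g1 g2 g3 g4 k1 k2 k3 k4.
    * have -> : (0 <= - 2^-1 - al) = false by apply/negbTE; rewrite -ltNge; lra.
      by have -> : 0 <= 0 - al by lra.
    * have -> : (0 <= 0 - y1) = false by apply/negbTE; rewrite -ltNge; lra.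
      by have -> : 0 <= 3 - y1 by lra.
    * have -> : (0 <= - 3 - y2) = false by apply/negbTE; rewrite -ltNge; lra.
      by have -> : 0 <= 0 - y2 by lra.
    * have -> : (0 <= 0 + al) = false by apply/negbTE; rewrite -ltNge; lra.
      by have -> : 0 <= 2^-1 + al by lra.
- apply: reach_off => s l' /andP[s0 s1]; apply: off_cutP; rewrite /segment;
    case: (l); rewrite /foot; cbn [fst snd]; rewrite ?sub0r ?subrr ?oppr0 ?mulr0 ?addr0;
    move: (cpt LA) (cpt LB) g1 g2 g3 g4 k1 k2 k3 k4 => [x1 y1] [x2 y2];
    cbn [fst snd] => g1 g2 g3 g4 k1 k2 k3 k4 E; lra.
Qed.

Lemma origin_loops w : reach (0, 0) (0, 0) w.
Proof.
have [_ [h1 h2 h3 h4] [g1 g2 g3 g4] [k1 k2 k3 k4]] := par.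
elim: w => [|l w IHw]; last first.
  by rewrite -cat1s; apply: reach_cat IHw; exact: generator_loop.
apply: reach_off => s l' _; have -> : segment (0, 0) (0, 0) s = (0, 0) :> R * R.
  by rewrite /segment /= subrr mulr0 addr0.
by apply: off_cutP; cbn [fst snd] => E; lra.
Qed.

(** A segment might hit a postcritical point, so it is bent: on the arcs z (s + i t s (1 - s)),
    large [t] avoids all four points. *)
Lemma reach_from_origin z : regular z -> exists w, reach (0, 0) z w.
Proof.
move=> rz; case: (eqVneq z (0, 0)) => [->|z0]; first by exists [::]; exact: origin_loops.
have [_ [h1 h2 h3 h4] [g1 g2 g3 g4] [k1 k2 k3 k4]] := par.
have c0 l : cpt l != (0, 0).
  apply/eqP => /(congr1 snd) E; move: E h1 h2 h3 h4 g1 g2 g3 g4 k1 k2 k3 k4.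
  case: l; move: (cpt LA) (cpt LB) => [x1 y1] [x2 y2]; rewrite /cpt;
    cbn [fst snd] => *; lra.
move: z z0 rz => [x y] z0 rz.
have n0 : 0 < x * x + y * y.
  rewrite lt_neqAle addr_ge0 -?expr2 ?sqr_ge0 // andbT eq_sym.
  rewrite paddr_eq0 ?sqr_ge0 // !sqrf_eq0; apply: contra z0.
  by move=> /andP[/eqP-> /eqP->].
pose arc (t s : R) : R * R :=
  (x * s - y * (t * (s * (1 - s))), y * s + x * (t * (s * (1 - s)))).
(* A point determines its parameter [s] on the arcs from [0] to [z], and then
   the arc. *)
have bad l : exists T, forall t s, T < t -> 0 <= s <= 1 -> arc t s <> cpt l.
  case: (pselect (exists t s, 0 <= s <= 1 /\ arc t s = cpt l)); last first.
    by move=> H; exists 0 => t s _ s01 E; apply: H; exists t, s.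
  move=> [t0 [s0 [s001 E0]]]; exists t0 => t s tt s01 E.
  have E1 := congr1 fst (etrans E (esym E0)).
  have E2 := congr1 snd (etrans E (esym E0)).
  cbn [fst snd arc] in E1, E2; rewrite /= in E1 E2.
  have ss : s = s0.
    have : (x * x + y * y) * (s - s0) = 0.
      by have := congr1 ( *%R x) E1; have := congr1 ( *%R y) E2; lra.
    by move/eqP; rewrite mulf_eq0 gt_eqF //= subr_eq0 => /eqP.
  rewrite ss in E1 E2.
  have : (x * x + y * y) * ((t - t0) * (s0 * (1 - s0))) = 0.
    by have := congr1 ( *%R (- y)) E1; have := congr1 ( *%R x) E2; lra.
  move/eqP; rewrite mulf_eq0 gt_eqF //= mulf_eq0 subr_eq0 gt_eqF //= mulf_eq0.
  case/orP=> /eqP sE.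
    by move/eqP: (c0 l); apply; rewrite -E0 /arc sE !(mulr0, mul0r, addr0, subr0).
  have {}sE : s0 = 1 by lra.
  by apply: (rz l); rewrite -E0 /arc sE subrr !(mulr0, mulr1, addr0, subr0).
have [TT HT] := bad LT; have [TA HA] := bad LA.
have [TB HB] := bad LB; have [TC HC] := bad LC.
pose t := Num.max (Num.max TT TA) (Num.max TB TC) + 1.
have tmax : [/\ TT < t, TA < t, TB < t & TC < t].
  by split; rewrite /t; 
    apply: (@le_lt_trans _ _ (Num.max (Num.max TT TA) (Num.max TB TC)));
    rewrite ?ltrDl // !le_max lexx ?orbT.
have [tT tA tB tC] := tmax.
have k := @rcont_cst R; have i := @rcont_id R.
have q : rcont (fun s : R => t * (s * (1 - s))).
  exact: (rcontM (k t) (rcontM i (rcontB (k 1) i))).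
have [||w Hw] := @reach_path R al be par (arc t).
- split; first exact: (rcontB (rcontM (k x) i) (rcontM (k y) q)).
  exact: (rcontD (rcontM (k y) i) (rcontM (k x) q)).
- by move=> s s01; case; [exact: HT|exact: HA|exact: HB|exact: HC].
exists w; move: Hw; rewrite /arc subrr !(mulr0, mul0r, mulr1, addr0, subr0).
exact.
Qed.

(** Loops at the origin are moved to [z] along a path with word [h]; conjugating [w] by [h]
    beforehand compensates. *)
Lemma all_loops z w : regular z -> reach z z w.
Proof.
move=> /reach_from_origin[h zh].
apply: (@reach_eq _ _ _ _ _ (rev h ++ (h ++ w ++ rev h) ++ h)) => [x|].
  by rewrite !wact_cat wactVK wactVK.
apply: reach_cat (reach_rev zh) _.
exact: reach_cat (origin_loops _) zh.
Qed.

End Loops.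

(** * Coding of iterated preimages *)

Section Preimage_coding.
Variables (R : realType) (al be : R).
Hypothesis par : good_params al be.
Implicit Types (p q : R -> R * R) (u z y : R * R) (x : bool) (w : seq bool).

Local Notation sq := (sq al be).
Local Notation regular := (regular al be).
Local Notation corr := (corr al be).
Local Notation cpt := (cpt al be).

Definition next_letter (l : letter) : letter :=
  match l with LT => LA | LA => LB | LB => LC | LC => LA end.

Lemma sq_cpt l : sq (cpt l) = cpt (next_letter l).
Proof.
case: l => //; first by case: par.
by rewrite /sq /cpt /= !mulrNN.
Qed.

Lemma regular_sq u : regular (sq u) -> regular u.
Proof. by move=> r l uE; apply: (r (next_letter l)); rewrite uE sq_cpt. Qed.

Lemma regular_iter n u : regular (iter n sq u) -> regular u.
Proof. by elim: n => [//|n IHn] /= /regular_sq. Qed.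

Lemma half_opp u : u != (0, 0) -> half (- u.1, - u.2) = ~~ half u.
Proof.
case: u => a b u0; rewrite /half; cbn [fst snd].
case: (ltgtP 0 (a + b)) => ab.
- have -> : (0 < - a - b) = false by apply/negbTE; rewrite -leNgt; lra.
  by rewrite ltrN2 -ltNge.
- have -> : 0 < - a - b by lra.
  by rewrite lerN2 -leNgt.
- have -> : (0 < - a - b) = false by apply/negbTE; rewrite -leNgt; lra.
  rewrite ltrN2; have -> : b = - a by lra.
  case: (ltgtP a 0) => a0.
  + have [-> ->] // : (a < - a) /\ (- a < a) = false.
    by split; [lra|apply/negbTE; rewrite -leNgt; lra].
  + have [-> ->] // : (a < - a) = false /\ (- a < a).
    by split; [apply/negbTE; rewrite -leNgt; lra|lra].
  + by move/eqP: u0; case; congr (_, _); lra.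
Qed.

Lemma sq_eq u y : sq u = sq y -> y = u \/ y = (- u.1, - u.2).
Proof.
move=> E; have := congr1 fst E; have := congr1 snd E.
case: u y {E} => a b [c d] /= E2 E1.
have F1 : (a - c) * (a + c) = (b - d) * (b + d) by lra.
have F2 : a * b = c * d by lra.
(* The modulus is recovered from (a^2 + b^2)^2 = (a^2 - b^2)^2 + 4 (a b)^2. *)
have N : (a * a + b * b) = (c * c + d * d).
  apply/eqP; rewrite -(@eqrXn2 _ 2) ?addr_ge0 -?expr2 ?sqr_ge0 //.
  rewrite -subr_eq0; apply/eqP.
  have -> : (a ^+ 2 + b ^+ 2) ^+ 2 - (c ^+ 2 + d ^+ 2) ^+ 2 =
    (a * a - b * b) ^+ 2 - (c * c - d * d) ^+ 2 + 4 * (a * b) ^+ 2 -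
    4 * (c * d) ^+ 2 by ring.
  by have -> : a * a - b * b = c * c - d * d by [lra]; rewrite F2; ring.
have A : (a - c) * (a + c) = 0 by lra.
have B : (b - d) * (b + d) = 0 by lra.
move/eqP: A; rewrite mulf_eq0 => /orP[]/eqP A; move/eqP: B; rewrite mulf_eq0 => /orP[]/eqP B.
- by left; congr (_, _); lra.
- have ac : c = a by lra.
  have bd : d = - b by lra.
  rewrite ac bd in F2 *; have : a * b = 0 by lra.
  by move/eqP; rewrite mulf_eq0 => /orP[]/eqP->; [right|left]; rewrite ?oppr0.
- have ac : c = - a by lra.
  have bd : d = b by lra.
  rewrite ac bd in F2 *; have : a * b = 0 by lra.
  by move/eqP; rewrite mulf_eq0 => /orP[]/eqP->; [left|right]; rewrite ?oppr0.
- by right; congr (_, _); lra.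
Qed.

Lemma regular_sq_neq0 u : regular (sq u) -> u != (0, 0).
Proof.
by move=> r; apply/eqP => u0; apply: (r LT); rewrite u0 /sq /= !mulr0 subr0 !add0r.
Qed.

(** Regularity stands under the quantifier so that [pre] is a total function, with an arbitrary
    value at the other points. *)
Lemma pre_exists x z : exists u, regular z -> sq u = z /\ half u = x.
Proof.
case: (pselect (regular z)) => [rz|]; last by exists (0, 0).
pose v : R[i] := sqrtc (Complex (z.1 - al) (z.2 - be)).
have vE : sq (complex.Re v, complex.Im v) = z.
  have : v ^+ 2 = Complex (z.1 - al) (z.2 - be) by exact: sqr_sqrtc.
  case: v => a b; rewrite expr2 mulC_complex => -[E1 E2].
  by rewrite /sq; cbn [fst snd complex.Re complex.Im];
    rewrite [LHS]surjective_pairing [RHS]surjective_pairing; cbn [fst snd]; congr (_, _); lra.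
move: (complex.Re v, complex.Im v) vE => u uE.
case: (eqVneq (half u) x) => [<-|ux]; first by exists u.
exists (- u.1, - u.2) => _; split; first by rewrite -uE /sq /= !mulrNN.
rewrite half_opp; last by apply: regular_sq_neq0; rewrite uE.
by case: (half u) x ux => -[].
Qed.

Definition pre x z : R * R := sval (cid (pre_exists x z)).

Lemma preP x z : regular z -> sq (pre x z) = z /\ half (pre x z) = x.
Proof. exact: (svalP (cid (pre_exists x z))). Qed.

Lemma pre_half u : regular (sq u) -> pre (half u) (sq u) = u.
Proof.
move=> r; have [E h] := preP (half u) r.
case: (sq_eq E) => [/esym//|uE].
have p0 : pre (half u) (sq u) != (0, 0) by apply: regular_sq_neq0; rewrite E.
by have := half_opp p0; rewrite -uE h; case: half.
Qed.

(** The rest of the word is corrected before the recursive call, so the recursion runs on its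
    length. *)
Fixpoint coding_rec n z w : R * R :=
  if n is n'.+1 then
    if w is x :: w' then 
      coding_rec n' (pre x z) (wact (corr (pre x z)) w')
    else z
  else z.

Definition coding z w := coding_rec (size w) z w.

Lemma coding_cons z x w :
  coding z (x :: w) = coding (pre x z) (wact (corr (pre x z)) w).
Proof. by rewrite /coding /= wact_size. Qed.

Lemma regular_pre x z : regular z -> regular (pre x z).
Proof. by move=> r; apply: regular_sq; rewrite (preP x r).1. Qed.

Lemma iter_coding n z w : regular z -> size w = n -> iter n sq (coding z w) = z.
Proof.
elim: n z w => [|n IHn] z [|x w] r //= [wn].
by rewrite coding_cons IHn ?wact_size //; [exact: (preP x r).1|exact: regular_pre].
Qed.

Lemma coding_rcons z w x : regular z -> sq (coding z (rcons w x)) = coding z w.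
Proof.
move: {-1}(size w) (erefl (size w)) => n; elim: n z w x => [|n IHn] z [|y w] x //= wn r.
  exact: (preP x r).1.
case: wn => wn; rewrite !coding_cons.
set v := wact _ (rcons w x); have : size v = n.+1 by rewrite wact_size size_rcons wn.
have vw : take n v = wact (corr (pre y z)) w.
  by rewrite -wact_take -cats1 take_size_cat.
case/lastP: v vw => [//|v' x'] vw; rewrite size_rcons => -[v'n].
rewrite IHn //; last exact: regular_pre.
by rewrite -vw -cats1 take_size_cat.
Qed.

(** Iterating the map recovers the first preimage, whose [half] is the first letter; the correction
    of the rest is invertible. *)
Lemma coding_inj z w w' : regular z -> size w = size w' ->
  coding z w = coding z w' -> w = w'.
Proof.
move: {-1}(size w) (erefl (size w)) => n.
elim: n z w w' => [|n IHn] z [|x w] [|x' w'] // [wn] r [ww'].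
rewrite !coding_cons => E.
have n1 := iter_coding (@regular_pre x _ r) (wact_size (corr (pre x z)) w).
have n2 := iter_coding (@regular_pre x' _ r) (wact_size (corr (pre x' z)) w').
have pE : pre x z = pre x' z by rewrite -n1 E wn ww' n2.
have xx : x = x' by rewrite -(preP x r).2 pE (preP x' r).2.
rewrite -xx in E *; congr (_ :: _).
apply: (can_inj (wactK (corr (pre x z)))); apply: IHn E; rewrite ?wact_size //; exact: regular_pre.
Qed.

Lemma coding_surj n z y : regular z -> iter n sq y = z ->
  exists2 w, size w = n & coding z w = y.
Proof.
elim: n z y => [|n IHn] z y r; first by move=> <-; exists [::].
rewrite iterS => yz; set u := iter n sq y in yz.
have uE : pre (half u) z = u by rewrite -yz pre_half // yz.
have ru : regular u by rewrite -uE; exact: regular_pre.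
have [w wn wy] := IHn u y ru erefl.
exists (half u :: wact (corr u) w); first by rewrite /= wact_size wn.
by rewrite coding_cons uE (corrK par).
Qed.

Lemma transport_ext p p' H : (forall s, 0 <= s <= 1 -> p s = p' s) ->
  is_transport al be p H -> is_transport al be p' H.
Proof.
move=> pp' [H0 HP]; split=> // s s01; have := HP s s01.
by apply: near01_sub => t t01; rewrite !pp'.
Qed.

Lemma pcont_iter n p : pcont p -> pcont (fun s => iter n sq (p s)).
Proof. by move=> cp; elim: n => [//|n IHn]; exact: (pcont_sq al be IHn). Qed.

(** Induction on the level along the first lift [q]: the corrections in [transport_section] cancel
    those built into [coding], and what remains is the word of [q]. *)
Lemma coding_transport n w p delta H : size w = n -> pcont delta ->
  (forall s, 0 <= s <= 1 -> regular (p s)) -> is_transport al be p H ->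
  (forall s, 0 <= s <= 1 -> iter n sq (delta s) = p s) ->
  delta 0 = coding (p 0) w -> delta 1 = coding (p 1) (wact (H 1) w).
Proof.
have z01 : 0 <= (0 : R) <= 1 by rewrite lexx ler01.
have o01 : 0 <= (1 : R) <= 1 by rewrite lexx ler01.
elim: n w p delta H => [|n IHn] [|x w] p delta H //= => [_|[wn]] cd rp tr dp d0.
  by rewrite wact_nil dp.
pose q s := iter n sq (delta s); have cq : pcont q by exact: pcont_iter.
have rsq s : 0 <= s <= 1 -> regular (sq (q s)) by move=> s01; rewrite dp //; exact: rp.
have rq s : 0 <= s <= 1 -> regular (q s) by move=> s01; exact: regular_sq (rsq s s01).
have [Hq trq] := transport_exists par cq rq.
have tr' : is_transport al be (fun s => sq (q s)) H.
  by apply: transport_ext tr => s s01; rewrite dp.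
have q0 : q 0 = pre x (p 0).
  rewrite /q d0 coding_cons iter_coding ?wact_size //.
  by apply: regular_pre; exact: rp.
have hq0 : half (q 0) = x by rewrite q0 (preP x (rp 0 z01)).2.
have := transport_section par cq rq rsq tr' trq w o01; rewrite hq0 => ->.
rewrite coding_cons -(dp 1 o01) (pre_half (rsq 1 o01)) !wact_cat (corrK par).
apply: (IHn _ q delta Hq) => //; first by rewrite wact_size.
by rewrite d0 coding_cons q0.
Qed.

Lemma iterated_lift n p y : pcont p ->
  (forall s, 0 <= s <= 1 -> regular (p s)) -> iter n sq y = p 0 ->
  exists2 delta, pcont delta & delta 0 = y /\
    forall s, 0 <= s <= 1 -> iter n sq (delta s) = p s.
Proof.
move=> cp rp; elim: n y => [|n IHn] y yE; first by exists p.
rewrite iterSr in yE; have [d cd [d0 dE]] := IHn _ yE.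
have [|q cq [q0 qE]] := @sqrt_lift R al be d y cd _ (esym d0).
  move=> s s01 dd; have r : regular (d s) by apply: (@regular_iter n); rewrite dE //; exact: rp.
  exact: (r LT).
by exists q => //; split=> // s s01; rewrite iterSr qE // dE.
Qed.

End Preimage_coding.

(** * Identification with the iterated monodromy group *)

Section Complex_bridge.
Variable R : realType.
Local Notation C := (R[i] : numFieldType).
Implicit Types (gamma : R -> C).

Definition to_plane (z : C) : R * R := (complex.Re z, complex.Im z).
Definition of_plane (u : R * R) : C := Complex u.1 u.2.

Lemma of_planeK : cancel of_plane to_plane.
Proof. by case. Qed.

Lemma to_planeK : cancel to_plane of_plane.
Proof. by case. Qed.

Lemma normc_le (a b : R) : `|Complex a b| <= ((`|a| + `|b|)%:C)%C :> R[i].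
Proof.
rewrite normc_def lecR /= -[leRHS]ger0_norm ?addr_ge0 // -sqrtr_sqr ler_wsqrtr //.
rewrite sqrrD !real_normK ?num_real // lerD2r lerDl.
by rewrite mulrn_wge0 // mulr_ge0.
Qed.

Lemma normc_ge_Im (x : R[i]) : ((`|complex.Im x|)%:C)%C <= `|x|.
Proof. by rewrite normc_def lecR -sqrtr_sqr ler_wsqrtr // lerDr sqr_ge0. Qed.

Lemma within_pcont gamma : {within `[0, 1], continuous gamma} <->
  pcont (fun s => to_plane (gamma s)).
Proof.
split=> [/subspace_continuousP cg|[c1 c2]].
  have H (s : R) : 0 <= s <= 1 -> gamma t @[t --> within `[0, 1] (nbhs s)] --> gamma s.
    by move=> s01; apply: cg; rewrite /= in_itv.
  have H' (s e : R) : 0 <= s <= 1 -> 0 < e ->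
      near01 s (fun t => `|gamma s - gamma t| < (e%:C)%C).
    move=> s01 e0; have := H s s01; move/cvgrPdist_lt; apply.
    by rewrite ltcR.
  split=> s s01; apply/cvgrPdist_lt => e e0; apply: near01_sub (H' s e s01 e0) => t _ le;
    rewrite -ltcR; apply: le_lt_trans le.
    have := normc_ge_Re (gamma s - gamma t).
    by case: (gamma s) (gamma t) => ? ? [? ?].
  have := normc_ge_Im (gamma s - gamma t).
  by case: (gamma s) (gamma t) => ? ? [? ?].
apply/subspace_continuousP => s; rewrite /= in_itv => s01.
suff : gamma t @[t --> within `[0, 1] (nbhs s)] --> gamma s by [].
apply/cvgrPdist_lt => -[e e'] /[dup] e0; rewrite ltcE /= => /andP[/eqP e'0 e0'].
rewrite e'0; have e2 : 0 < e / 2 by rewrite divr_gt0.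
have /cvgrPdist_lt/(_ _ e2) n1 := c1 s s01; have /cvgrPdist_lt/(_ _ e2) n2 := c2 s s01.
apply: near01_sub (near01_and n1 n2) => t _ [/= l1 l2].
have -> : gamma s - gamma t = Complex (complex.Re (gamma s) - complex.Re (gamma t))
    (complex.Im (gamma s) - complex.Im (gamma t)).
  by case: (gamma s) (gamma t) => ? ? [? ?].
by apply: le_lt_trans (normc_le _ _) _; rewrite ltcR; lra.
Qed.

Variables (al be : R).
Hypothesis par : good_params al be.
Local Notation sq := (sq al be).
Local Notation regular := (regular al be).
Local Notation cpt := (cpt al be).

Definition quadratic : {poly C} := 'X^2 + (Complex al be : C)%:P.

Lemma size_quadratic : size quadratic = 3%N.
Proof.
by rewrite /quadratic size_polyDl size_polyXn // (leq_ltn_trans (size_polyC_leq1 _)).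
Qed.

Lemma horner_quadratic u : quadratic.[of_plane u] = of_plane (sq u).
Proof. by rewrite /quadratic !hornerE /of_plane sq_complex -surjective_pairing. Qed.

Lemma iter_quadratic n u :
  iter n (horner quadratic) (of_plane u) = of_plane (iter n sq u).
Proof. by elim: n => [//|n IHn] /=; rewrite IHn horner_quadratic. Qed.

Lemma root_quadratic_deriv (c : C) : root quadratic^`() c = (c == 0).
Proof.
rewrite /root /quadratic derivD derivXn derivC addr0 /= hornerMn hornerX.
by rewrite mulrn_eq0.
Qed.

Lemma orbit_zero n : exists l, iter n.+1 sq (0, 0) = cpt l.
Proof.
elim: n => [|n [l E]]; last by exists (next_letter l); rewrite iterS E (sq_cpt par).
by exists LT; rewrite /= /sq /= !mulr0 subrr !add0r.
Qed.

Lemma orbit_zero_cpt l : exists n, iter n.+1 sq (0, 0) = cpt l.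
Proof.
have E1 : iter 1 sq (0, 0) = cpt LT by rewrite /= /sq /= !mulr0 subrr !add0r.
have E2 : iter 2 sq (0, 0) = cpt LA by rewrite iterS E1.
have E3 : iter 3 sq (0, 0) = cpt LB by rewrite iterS E2 (sq_cpt par).
have E4 : iter 4 sq (0, 0) = cpt LC by rewrite iterS E3 (sq_cpt par).
by case: l; [exists 0%N|exists 1%N|exists 2%N|exists 3%N].
Qed.

Lemma postcriticalP z :
  postcritical_set quadratic z <-> exists l, z = of_plane (cpt l).
Proof.
have z0 : 0 = of_plane (0, 0) :> C by [].
split=> [[c /=]|[l ->]].
  rewrite root_quadratic_deriv => /eqP -> [n _ <-]; rewrite z0 iter_quadratic.
  by have [l ->] := orbit_zero n; exists l.
exists 0; first by rewrite /= root_quadratic_deriv.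
by have [n <-] := orbit_zero_cpt l; exists n => //; rewrite z0 iter_quadratic.
Qed.

Lemma regularP z : ~ postcritical_set quadratic z <-> regular (to_plane z).
Proof.
split=> [H l E|H /postcriticalP[l zE]].
  by apply: H; apply/postcriticalP; exists l; rewrite -E to_planeK.
by apply: (H l); rewrite zE of_planeK.
Qed.

Lemma quadratic_postcritically_finite : postcritically_finite quadratic.
Proof.
move=> c; rewrite root_quadratic_deriv => /eqP ->.
apply: (@sub_finite_set _ _ [set` [seq of_plane (cpt l) | l <- [:: LT; LA; LB; LC]]]);
  last exact: finite_seq.
move=> _ [n _ <-]; rewrite [0](_ : _ = of_plane (0, 0)) // iter_quadratic.
have [l ->] := orbit_zero n; apply/mapP; exists l => //.
by case: l.
Qed.

(** Commuting with parents and fixing the root, an automorphism cannot increase the depth; its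
    inverse cannot either. *)
Lemma tree_aut_level z0 (h : tree_aut (preimage_tree quadratic z0)) v :
  (val (h v)).1 = (val v).1.
Proof.
have level n (u : preimage_tree quadratic z0) :
    (val (iter n (@tree_parent (preimage_tree quadratic z0)) u)).1 = ((val u).1 - n)%N.
  elim: n => [|n IHn]; first by rewrite subn0.
  rewrite iterS subnS -IHn; case: (iter n _ u) => -[[|m] y] //=.
have le (g : tree_aut (preimage_tree quadratic z0)) u : ((val (g u)).1 <= (val u).1)%N.
  have [_ groot gpar] := tree_autP g.
  set n := (val u).1.
  have par_n k : g (iter k (@tree_parent _) u) = iter k (@tree_parent _) (g u).
    by elim: k => [//|k IHk]; rewrite !iterS gpar IHk.
  have ur : iter n (@tree_parent _) u = tree_root (preimage_tree quadratic z0).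
    apply: val_inj; have := level n u; rewrite subnn.
    case: (iter n _ u) => -[m y] /= yP m0; rewrite m0 in yP *.
    by move/eqP: yP => /= ->.
  have := level n (g u); rewrite -par_n ur groot /= => /esym/eqP.
  by rewrite subn_eq0.
apply/eqP; rewrite eqn_leq le /=.
by have := le (tree_aut_inv h) (h v); rewrite tree_autK.
Qed.

Section Base_point.
Variable z0 : C.
Hypothesis z0P : ~ postcritical_set quadratic z0.
Let z := to_plane z0.
Let rz : regular z := (regularP z0).1 z0P.

Lemma coding_vertex_subproof w :
  iter (size w) (horner quadratic) (of_plane (coding al be z w)) == z0.
Proof.
by apply/eqP; rewrite iter_quadratic iter_coding // /z to_planeK.
Qed.

Definition coding_vertex (w : binary_tree) : preimage_tree quadratic z0 :=
  exist _ (size w, of_plane (coding al be z w)) (coding_vertex_subproof w).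

Lemma coding_vertex_surj v : exists w, coding_vertex w = v.
Proof.
case: v => -[n y] yP; have yE := eqP yP; move: yE => /= yE.
have : iter n sq (to_plane y) = z.
  by apply: (can_inj of_planeK); rewrite -iter_quadratic !to_planeK yE.
move=> /(coding_surj par rz)[w wn wy]; exists w; apply: val_inj => /=.
by rewrite wn wy to_planeK.
Qed.

Lemma coding_vertex_inj : injective coding_vertex.
Proof.
move=> w w' /(congr1 val) /= [ww' E1 E2]; apply: (@coding_inj _ _ _ par z w w' rz ww').
by rewrite [LHS]surjective_pairing E1 E2 -surjective_pairing.
Qed.

Lemma coding_vertex_iso : tree_iso coding_vertex.
Proof.
split.
- pose g v := sval (cid (coding_vertex_surj v)).
  have gK : cancel g coding_vertex by move=> v; exact: (svalP (cid (coding_vertex_surj v))).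
  by exists g => // w; apply: coding_vertex_inj; rewrite gK.
- by apply: val_inj; rewrite /= /coding /= to_planeK.
- move=> w; apply: val_inj; case/lastP: w => [//|w x].
  rewrite /= word_parent_rcons size_rcons /preimage_parent_fun /=.
  by rewrite horner_quadratic coding_rcons.
Qed.

Lemma coding_lift_endpoint gamma H w y :
  pcont (fun s => to_plane (gamma s)) ->
  (forall s, 0 <= s <= 1 -> regular (to_plane (gamma s))) ->
  gamma 0 = z0 -> gamma 1 = z0 ->
  is_transport al be (fun s => to_plane (gamma s)) H ->
  lift_endpoint quadratic (size w) gamma (of_plane (coding al be z w)) y ->
  y = of_plane (coding al be z (wact (H 1) w)).
Proof.
move=> cg rg g0 g1 tr [d [/within_pcont cd dE d0 <-]].
have := coding_transport par (erefl (size w)) cd rg tr.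
rewrite g0 g1 d0 of_planeK => H'; apply: (can_inj to_planeK); rewrite of_planeK.
apply: H' => // s s01; apply: (can_inj of_planeK).
by rewrite -iter_quadratic !to_planeK dE // in_itv.
Qed.

Lemma loop_plane gamma : is_loop (~` postcritical_set quadratic) z0 gamma ->
  [/\ pcont (fun s => to_plane (gamma s)),
      forall s, 0 <= s <= 1 -> regular (to_plane (gamma s)), gamma 0 = z0 & gamma 1 = z0].
Proof.
move=> [/within_pcont cg gD g0 g1]; split=> // s s01.
by apply/regularP; apply: gD; rewrite in_itv.
Qed.

Lemma loop_homotopic_refl gamma : is_loop (~` postcritical_set quadratic) z0 gamma ->
  loop_homotopic (~` postcritical_set quadratic) z0 gamma gamma.
Proof.
move=> [/subspace_continuousP cg gD g0 g1]; exists (fun us => gamma us.2); split=> //.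
  apply/subspace_continuousP => -[u s] [/= u01 s01].
  suff : gamma us.2 @[us --> within (`[0, 1] `*` `[0, 1]) (nbhs (u, s))] --> gamma s by [].
  apply: (@cvg_comp _ _ _ snd gamma _ (within `[0, 1] (nbhs s))); last exact: cg.
  move=> A; rewrite /within /= => sA.
  have cs : (snd : R * R -> R) @ (u, s) --> s by exact: cvg_snd.
  have := cs _ sA; rewrite /nbhs /=; apply: filterS => -[a b] /= HA [_ b01].
  exact: HA.
by move=> u s _ s01; exact: gD.
Qed.

(** Any loop that represents a class has a crossing word, which acts on codes as the lifts act on
    preimages. Conversely [all_loops] gives a loop with a prescribed word, and [iterated_lift] gives
    its lifts. *)
Lemma img_coding : IMG quadratic z0 = [set h | exists2 g, automaton_group g &
  forall w, h (coding_vertex w) = coding_vertex (g w)].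
Proof.
apply/seteqP; split=> h.
  move=> [kappa [gamma0 _ <-] [gamma [gl _] mono]].
  have [cg rg g0 g1] := loop_plane gl.
  have [H tr] := transport_exists par cg rg.
  exists (waut (H 1)); first by apply/automaton_groupP; exists (H 1).
  move=> w; apply: val_inj; rewrite [LHS]surjective_pairing; congr (_, _).
    by rewrite tree_aut_level /= wact_size.
  exact: coding_lift_endpoint tr (mono (coding_vertex w)).
move=> [_ /automaton_groupP[v ->] hE].
have [p [H [cp rp [p0 p1] tr Hv]]] := all_loops par v rz.
pose gamma s : C := of_plane (p s).
have gE : (fun s => to_plane (gamma s)) = p by apply/funext => s; rewrite of_planeK.
have gl : is_loop (~` postcritical_set quadratic) z0 gamma.
  split; rewrite ?/gamma ?p0 ?p1 ?to_planeK //.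
    by apply/within_pcont; rewrite gE.
  move=> s; rewrite in_itv /= => s01; apply/regularP; rewrite of_planeK; exact: rp.
exists (homotopy_class (~` postcritical_set quadratic) z0 gamma); first by exists gamma.
exists gamma; first by split=> //; exact: loop_homotopic_refl.
move=> u; have [w <-] := coding_vertex_surj u; rewrite hE /=.
have it : iter (size w) sq (coding al be z w) = p 0 by rewrite p0 iter_coding.
have [d cd [d0 dE]] := iterated_lift par cp rp it.
exists (fun s => of_plane (d s)); split.
- apply/within_pcont; have -> // : (fun s => to_plane (of_plane (d s))) = d.
  by apply/funext => s; rewrite of_planeK.
- move=> s; rewrite in_itv /= => s01.
  by rewrite iter_quadratic dE.
- by rewrite d0.
- rewrite (coding_transport par (erefl (size w)) cd rp tr dE); last by rewrite d0 p0.
  by rewrite p1 Hv.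
Qed.

End Base_point.

Lemma quadratic_is_IMG : is_IMG_of automaton_group quadratic.
Proof.
move=> z0 z0P; exists (coding_vertex z0P); split; first exact: coding_vertex_iso.
exact: img_coding.
Qed.

End Complex_bridge.

Theorem theorem4p12 (R : realType) :
  subexponential_growth R automaton_group /\
  exists p : {poly Cplx R},
    [/\ size p = 3%N, postcritically_finite p & is_IMG_of automaton_group p].
Proof.
split; first exact: automaton_group_subexponential.
have [al [be par]] := good_params_exist R.
exists (quadratic al be); split; first exact: size_quadratic.
  exact: quadratic_postcritically_finite.
exact: quadratic_is_IMG.
Qed.
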